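(* Let $s\ge0$ be arbitrarily given. Then the Sobolev space $H^s(\mathbb{T})$ admits an equivalent norm $\|\cdot\|_{\tilde H^s}$ such that for every $T>0$ there exists a constant $q_0\in(0,1)$ satisfying $$\|S_a(T)\|_{\mathcal L(\tilde H^s)}\le q_0,$$ where $\tilde H^s$ denotes $H^s(\mathbb{T})$ equipped with $\|\cdot\|_{\tilde H^s}$.
   Context: $\mathbb{T}=\mathbb{R}/2\pi\mathbb{Z}$; functions are complex-valued. The function $a:\mathbb{T}\to[0,\infty)$ is smooth and there are $a_0>0$ and a nonempty open set $\mathcal I_1\subset\mathbb{T}$ with $a\ge a_0$ on $\mathcal I_1$. $S_a(t)$, $t\in\mathbb{R}$, is the $C_0$-group of operators on $H^s(\mathbb{T})$ generated by $i\partial_x^2-a(x)$. $\mathcal L(X)$ denotes bounded linear operators on $X$ with the operator norm. *)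

(* Defs.v *)
From HB Require Import structures.
From mathcomp Require Import all_boot all_order all_algebra.
From mathcomp Require Import generic_quotient ring_quotient.
From mathcomp Require Import complex.
From mathcomp Require Import all_classical all_reals all_analysis.
From mathcomp Require Import measurable_realfun ring lra.

Set Implicit Arguments.
Unset Strict Implicit.
Unset Printing Implicit Defensive.

Import Order.TTheory GRing.Theory Num.Theory.
Import numFieldNormedType.Exports.
Import Normc.

Local Open Scope quotient_scope.
Local Open Scope classical_set_scope.
Local Open Scope ring_scope.

(* Functions on the circle R/2piZ are 2pi-periodic functions on R; integrals
   over the circle are integrals over one period, for Lebesgue measure. *)

Section Circle.
Context {R : realType}.
Notation C := R[i].
Notation mu := (@lebesgue_measure R).

Definition period : R := pi *+ 2.

Definition circle : set R := `[0, period]%classic.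

Definition smooth_on_circle (phi : R -> R) : Prop :=
  periodic phi period /\ forall n x, derivable (phi^`(n)%classic) x 1.

(* Open subsets of R/2piZ are the 2pi-translation invariant open sets of R. *)
Definition open_on_circle (U : set R) : Prop :=
  open U /\ forall x, U (x + period) <-> U x.

Definition cintegral (f : R -> C) : C :=
  Complex (\int[mu]_(x in circle) complex.Re (f x))
          (\int[mu]_(x in circle) complex.Im (f x)).

Definition cexpi (k : int) (x : R) : C :=
  Complex (cos (k%:~R * x)) (sin (k%:~R * x)).

Definition fourier (f : R -> C) (k : int) : C :=
  (period^-1)%:C%C * cintegral (fun x => f x * cexpi (- k) x).

Definition sq_integrable (f : R -> C) : Prop :=
  [/\ measurable_fun setT (fun x => complex.Re (f x)),
      measurable_fun setT (fun x => complex.Im (f x)) &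
      (\int[mu]_(x in circle) (normc (f x) ^+ 2)%:E < +oo)%E].

Definition sobolev_energy (s : R) (f : R -> C) : \bar R :=
  \esum_(k in [set: int])
    ((1 + k%:~R ^+ 2) `^ s * normc (fourier f k) ^+ 2)%:E.

(* Meant for s >= 0, where H^s is contained in L^2. *)
Definition sobolev_fun (s : R) (f : R -> C) : Prop :=
  [/\ periodic f period, sq_integrable f & (sobolev_energy s f < +oo)%E].

Lemma measurable_circle : measurable circle.
Proof. exact: measurable_itv. Qed.

Lemma mu_circle_fin : (mu circle < +oo)%E.
Proof. by rewrite /circle lebesgue_measure_itv/=; case: ifP => _; rewrite ?ltry. Qed.

Lemma normc_sqE (z : C) : normc z ^+ 2 = complex.Re z ^+ 2 + complex.Im z ^+ 2.
Proof. by case: z => x y /=; rewrite sqr_sqrtr// addr_ge0 ?sqr_ge0. Qed.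

Lemma normc_sq_linear (c y z : C) :
  normc (c * y + z) ^+ 2 <= 2 * normc c ^+ 2 * normc y ^+ 2 + 2 * normc z ^+ 2.
Proof.
rewrite -mulrA -exprMn -normcM; move: (c * y) => w.
rewrite !normc_sqE; case: w z => [a b] [a' b'] /=.
have := sqr_ge0 (a - a'); have := sqr_ge0 (b - b'); nra.
Qed.

Lemma sq_integrable_measurable f : sq_integrable f ->
  measurable_fun setT (fun x => normc (f x) ^+ 2).
Proof.
case=> mr mi _; under eq_fun => x do rewrite normc_sqE.
by apply: measurable_funD; apply: measurable_funX.
Qed.

Lemma sq_integrable0 : sq_integrable (0 : R -> C).
Proof.
split; [exact: (measurable_cst (0 : R))..|].
rewrite integral0_eq ?ltry// => x _.
by rewrite [normc _]normc0 expr0n.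
Qed.

Lemma sq_integrable_linear (c : C) (f g : R -> C) :
  sq_integrable f -> sq_integrable g -> sq_integrable (c *: f + g).
Proof.
move=> If Ig; have [mfr mfi lf] := If; have [mgr mgi lg] := Ig.
have mf := sq_integrable_measurable If.
have mg := sq_integrable_measurable Ig.
have mcircle := measurable_circle.
have mr : measurable_fun setT (fun x => complex.Re ((c *: f + g) x)).
  rewrite (_ : (fun x => _) = (fun x => complex.Re c * complex.Re (f x) -
     complex.Im c * complex.Im (f x) + complex.Re (g x))); last first.
    by apply/funext => x /=; rewrite !fctE; move: (f x) (g x) => [? ?] [? ?]; case: (c).
  apply: measurable_funD => //; apply: measurable_funB => //;
    by apply: measurable_funM.
have mi : measurable_fun setT (fun x => complex.Im ((c *: f + g) x)).
  rewrite (_ : (fun x => _) = (fun x => complex.Re c * complex.Im (f x) +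
     complex.Im c * complex.Re (f x) + complex.Im (g x))); last first.
    by apply/funext => x /=; rewrite !fctE; move: (f x) (g x) => [? ?] [? ?]; case: (c).
  apply: measurable_funD => //; apply: measurable_funD => //;
    by apply: measurable_funM.
split=> //.
have c0 : (0 <= (2 * normc c ^+ 2)%:E)%E by rewrite lee_fin pmulr_rge0 ?sqr_ge0.
apply: (@le_lt_trans _ _ (\int[mu]_(x in circle)
    ((2 * normc c ^+ 2)%:E * (normc (f x) ^+ 2)%:E + 2%:E * (normc (g x) ^+ 2)%:E))%E).
  apply: ge0_le_integral => //.
  - by move=> x _; rewrite lee_fin sqr_ge0.
  - apply/measurable_EFinP; apply: (measurable_funS measurableT) => //.
    under eq_fun => x do rewrite normc_sqE.
    by apply: measurable_funD; apply: measurable_funX.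
  - apply: emeasurable_funD; apply: measurable_funeM; apply/measurable_EFinP;
      exact: (measurable_funS measurableT).
  - by move=> x _; rewrite -!EFinM -EFinD lee_fin !fctE normc_sq_linear.
have n0 (h : R -> C) x : circle x -> (0 <= (normc (h x) ^+ 2)%:E)%E.
  by rewrite lee_fin sqr_ge0.
have mE (h : R -> C) : measurable_fun setT (fun x => normc (h x) ^+ 2) ->
    measurable_fun circle (fun x => (normc (h x) ^+ 2)%:E).
  by move=> mh; apply/measurable_EFinP; exact: (measurable_funS measurableT).
rewrite ge0_integralD//.
- rewrite !ge0_integralZl//; [|exact: mE|exact: n0|exact: mE|exact: n0].
  by apply: lte_add_pinfty; apply: lte_mul_pinfty.
- by move=> x cx; rewrite mule_ge0 ?n0.
- by apply: measurable_funeM; exact: mE.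
- by move=> x cx; rewrite mule_ge0 ?n0.
- by apply: measurable_funeM; exact: mE.
Qed.

Definition cintegrable (f : R -> C) : Prop :=
  mu.-integrable circle (EFin \o (fun x => complex.Re (f x))) /\
  mu.-integrable circle (EFin \o (fun x => complex.Im (f x))).

Lemma sq_integrable_cexpi f k : sq_integrable f ->
  cintegrable (fun x => f x * cexpi k x).
Proof.
move=> If; have [mr mi lf] := If.
have mcircle := measurable_circle.
have mf := sq_integrable_measurable If.
have mcos : measurable_fun setT (fun x : R => cos (k%:~R * x)).
  apply: (measurableT_comp (f := cos)); last exact: mulrl_measurable.
  by apply: continuous_measurable_fun; exact: continuous_cos.
have msin : measurable_fun setT (fun x : R => sin (k%:~R * x)).
  apply: (measurableT_comp (f := sin)); last exact: mulrl_measurable.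
  by apply: continuous_measurable_fun; exact: continuous_sin.
have bound (b : R) (z : R) : b ^+ 2 <= z -> `|b| <= 1 + z.
  by move=> bz; rewrite ler_norml; apply/andP; split; nra.
have Ibound : mu.-integrable circle (EFin \o (fun x => 1 + normc (f x) ^+ 2)).
  rewrite (_ : _ \o _ = (EFin \o cst 1) \+ (EFin \o (fun x => normc (f x) ^+ 2)))//.
  apply: integrableD => //.
    apply: measurable_bounded_integrable => //; first exact: mu_circle_fin.
    exact: bounded_cst.
  apply/integrableP; split.
    by apply/measurable_EFinP; exact: (measurable_funS measurableT).
  by under eq_integral => x _ do rewrite /= ger0_norm ?sqr_ge0//.
have sqb (z : C) x : normc (z * cexpi k x) ^+ 2 = normc z ^+ 2.
  by rewrite normcM exprMn [X in _ * X]normc_sqE /= cos2Dsin2 mulr1.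
split; apply: le_integrable Ibound => //.
- apply/measurable_EFinP; apply: (measurable_funS measurableT) => //.
  rewrite (_ : (fun x => _) = fun x => complex.Re (f x) * cos (k%:~R * x) -
    complex.Im (f x) * sin (k%:~R * x)); last first.
    by apply/funext => x; case: (f x).
  by apply: measurable_funB; apply: measurable_funM.
- move=> x _ /=; rewrite lee_fin [leRHS]ger0_norm ?addr_ge0 ?sqr_ge0//.
  by apply: bound; rewrite -(sqb (f x) x) normc_sqE lerDl sqr_ge0.
- apply/measurable_EFinP; apply: (measurable_funS measurableT) => //.
  rewrite (_ : (fun x => _) = fun x => complex.Re (f x) * sin (k%:~R * x) +
    complex.Im (f x) * cos (k%:~R * x)); last first.
    by apply/funext => x; case: (f x).
  by apply: measurable_funD; apply: measurable_funM.
- move=> x _ /=; rewrite lee_fin [leRHS]ger0_norm ?addr_ge0 ?sqr_ge0//.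
  by apply: bound; rewrite -(sqb (f x) x) normc_sqE lerDr sqr_ge0.
Qed.

Lemma cintegral_linear (c : C) (f g : R -> C) :
  cintegrable f -> cintegrable g ->
  cintegral (fun x => c * f x + g x) = c * cintegral f + cintegral g.
Proof.
have mcircle := measurable_circle.
case=> fr fi [gr gi]; rewrite /cintegral.
have IZ (r : R) (h : R -> R) : mu.-integrable circle (EFin \o h) ->
    mu.-integrable circle (EFin \o (fun x => r * h x)).
  exact: integrableZl.
under [X in Complex X _]eq_Rintegral => x _.
  rewrite (_ : complex.Re _ = (complex.Re c * complex.Re (f x) -
    complex.Im c * complex.Im (f x)) + complex.Re (g x)); last first.
    by move: (f x) (g x) => [? ?] [? ?]; case: (c).
  over.
under [X in Complex _ X]eq_Rintegral => x _.
  rewrite (_ : complex.Im _ = (complex.Re c * complex.Im (f x) +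
    complex.Im c * complex.Re (f x)) + complex.Im (g x)); last first.
    by move: (f x) (g x) => [? ?] [? ?]; case: (c).
  over.
rewrite RintegralD//; last exact: integrableB (IZ _ _ _) (IZ _ _ _).
rewrite RintegralB//; [|exact: IZ..].
rewrite [in X in Complex _ X]RintegralD//; last exact: integrableD (IZ _ _ _) (IZ _ _ _).
rewrite [in X in Complex _ X]RintegralD//; [|exact: IZ..].
by rewrite !RintegralZl//; case: c.
Qed.

Lemma fourier_linear (c : C) (f g : R -> C) k :
  sq_integrable f -> sq_integrable g ->
  fourier (c *: f + g) k = c * fourier f k + fourier g k.
Proof.
move=> If Ig; rewrite /fourier mulrCA -mulrDr; congr (_ * _).
rewrite -cintegral_linear; [|exact: sq_integrable_cexpi..].
by congr cintegral; apply/funext => x; rewrite !fctE mulrDl mulrA.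
Qed.

Lemma fourier0 k : fourier (0 : R -> C) k = 0.
Proof.
have := fourier_linear (- 1) k sq_integrable0 sq_integrable0.
by rewrite scaler0 addr0 mulN1r addNr.
Qed.

Lemma sobolev_energy_linear s (c : C) (f g : R -> C) :
  sq_integrable f -> sq_integrable g ->
  (sobolev_energy s f < +oo)%E -> (sobolev_energy s g < +oo)%E ->
  (sobolev_energy s (c *: f + g)%R < +oo)%E.
Proof.
move=> If Ig Ef Eg.
pose E (h : R -> C) k := ((1 + k%:~R ^+ 2) `^ s * normc (fourier h k) ^+ 2)%:E.
have E0 (h : R -> C) k : (0 <= E h k)%E.
  by rewrite lee_fin mulr_ge0 ?powR_ge0 ?sqr_ge0.
have esumM (r : R) (h : R -> C) : 0 <= r -> (sobolev_energy s h < +oo)%E ->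
    (\esum_(k in [set: int]) (r%:E * E h k) < +oo)%E.
  move=> r0 Eh; apply: (@le_lt_trans _ _ (r%:E * sobolev_energy s h)%E); last first.
    by rewrite lte_mul_pinfty.
  apply: ub_ereal_sup => _ [F [Ffin _] <-].
  rewrite -ge0_mule_fsumr; last by move=> ?; exact: E0.
  apply: lee_wpmul2l; first by rewrite lee_fin.
  by apply: ereal_sup_ubound; exists F => //; split.
apply: (@le_lt_trans _ _ (\esum_(k in [set: int])
    ((2 * normc c ^+ 2)%:E * E f k + 2%:E * E g k))%E).
  apply: le_esum => k _; rewrite fourier_linear// /E -!EFinM -EFinD lee_fin.
  have := normc_sq_linear c (fourier f k) (fourier g k).
  move/(ler_wpM2l (powR_ge0 (1 + k%:~R ^+ 2) s)).
  by rewrite mulrDr [_ * (2 * _ * _)]mulrCA [_ * (2 * _)]mulrCA.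
rewrite esumD; first by apply: lte_add_pinfty; apply: esumM => //;
  rewrite mulr_ge0 ?sqr_ge0.
  by move=> k _; rewrite mule_ge0 ?E0// lee_fin mulr_ge0 ?sqr_ge0.
by move=> k _; rewrite mule_ge0 ?E0.
Qed.

Definition sobolev_pred s : {pred R -> C} := [pred f | `[< sobolev_fun s f >]].

Lemma sobolev_fun_submod s : submod_closed (sobolev_pred s).
Proof.
split=> [|c f g].
  apply/asboolP; split=> //; first exact: sq_integrable0.
  rewrite /sobolev_energy esum1 ?ltry// => k _.
  by rewrite fourier0 [normc _]normc0 expr0n mulr0.
move=> /asboolP[pf If Ef] /asboolP[pg Ig Eg]; apply/asboolP; split.
- by move=> x; rewrite !fctE pf pg.
- exact: sq_integrable_linear.
- exact: sobolev_energy_linear.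
Qed.

HB.instance Definition _ s :=
  GRing.isSubmodClosed.Build R[i] (R -> C) (sobolev_pred s) (sobolev_fun_submod s).

End Circle.

Record sobolev_rep (R : realType) (s : R) :=
  SobolevRep { rep_fun :> R -> R[i]; rep_funP : rep_fun \in sobolev_pred s }.

Section SobolevSpace.
Context {R : realType} (s : R).
Notation mu := (@lebesgue_measure R).

HB.instance Definition _ := [isSub for @rep_fun R s].
HB.instance Definition _ := [Choice of sobolev_rep s by <:].
HB.instance Definition _ := [SubChoice_isSubLmodule of sobolev_rep s by <:].

Definition null_fun : {pred sobolev_rep s} :=
  [pred f : sobolev_rep s | `[< {ae mu, forall x, f x = 0} >]].

Lemma null_fun_zmod : zmod_closed null_fun.
Proof.
split; first by apply/asboolP; apply: aeW.
move=> f g /asboolP f0 /asboolP g0; apply/asboolP.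
apply: (@filterS2 _ _ (ae_filter_ringOfSetsType mu) _ _ _ _ f0 g0) => x /= fx gx.
by rewrite !fctE fx gx subrr.
Qed.

HB.instance Definition _ := GRing.isZmodClosed.Build _ null_fun null_fun_zmod.

(* H^s: square-integrable functions with finite Sobolev norm, modulo equality
   almost everywhere. *)
Definition sobolev : Type := Quotient.quot null_fun.

HB.instance Definition _ := Choice.on sobolev.
HB.instance Definition _ := ZmodQuotient.on sobolev.

Definition sobolev_scale (c : R[i]) (u : sobolev) : sobolev :=
  \pi_sobolev (c *: repr u).

Lemma null_funZ c : {in null_fun, forall f, c *: f \in null_fun}.
Proof.
move=> f /asboolP f0; apply/asboolP; apply: (@filterS _ _ (ae_filter_ringOfSetsType mu) _ _ _ f0) => x /= fx.
by rewrite !fctE fx scaler0.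
Qed.

Lemma pi_sobolev_scale c f :
  \pi_sobolev (c *: f) = sobolev_scale c (\pi_sobolev f).
Proof.
have fK : f - repr (\pi_sobolev f) \in null_fun.
  by rewrite [_ \in _](Quotient.idealrBE null_fun) reprK.
apply/eqP; rewrite -[_ == _](Quotient.idealrBE null_fun) -scalerBr.
exact: null_funZ.
Qed.

Fact sobolev_scaleA a b u :
  sobolev_scale a (sobolev_scale b u) = sobolev_scale (a * b) u.
Proof.
by rewrite -[u]reprK -(pi_sobolev_scale b) -!pi_sobolev_scale scalerA.
Qed.

Fact sobolev_scale1 : left_id 1 sobolev_scale.
Proof. by move=> u; rewrite -[u]reprK -pi_sobolev_scale scale1r. Qed.

Lemma pi_sobolevD f g : \pi_sobolev (f + g) = \pi_sobolev f + \pi_sobolev g.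
Proof. exact: (Quotient.pi_add null_fun). Qed.

Fact sobolev_scaleDr : right_distributive sobolev_scale +%R.
Proof.
move=> c u v; rewrite -[u]reprK -[v]reprK -!pi_sobolev_scale.
by rewrite -!pi_sobolevD -pi_sobolev_scale scalerDr.
Qed.

Fact sobolev_scaleDl u : {morph sobolev_scale^~ u : a b / a + b}.
Proof.
move=> a b; rewrite -[u]reprK -!pi_sobolev_scale.
by rewrite -pi_sobolevD -scalerDl.
Qed.

HB.instance Definition _ := GRing.Zmodule_isLmodule.Build R[i] sobolev
  sobolev_scaleA sobolev_scale1 sobolev_scaleDr sobolev_scaleDl.

End SobolevSpace.
Arguments sobolev R s : clear implicits.

Definition sobolev_norm (R : realType) (s : R) (u : sobolev R s) : R :=
  Num.sqrt (fine (sobolev_energy s (repr u))).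

Section NormsAndGroups.
Context {R : realType} {V : lmodType R[i]}.
Implicit Types (N : V -> R) (S : R -> {linear V -> V}).

Definition is_norm N : Prop :=
  [/\ forall u, N u = 0 -> u = 0,
      forall u v, N (u + v) <= N u + N v &
      forall c u, N (c *: u) = normc c * N u].

Definition equivalent_norms N N' : Prop :=
  exists m M : R, [/\ 0 < m, 0 < M &
    forall u, m * N' u <= N u /\ N u <= M * N' u].

Definition opnorm N (A : V -> V) : \bar R :=
  ereal_sup [set (N (A u))%:E | u in [set u | N u <= 1]].

Record C0_group N S : Prop := {
  C0_group_bounded : forall t, (opnorm N (S t) < +oo)%E;
  C0_group0 : forall u, S 0 u = u;
  C0_groupD : forall t t' u, S (t + t') u = S t (S t' u);
  C0_group_cvg : forall u, (fun t => N (S t u - u)) @ (0 : R) --> (0 : R)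
}.

(* u is in the domain of the infinitesimal generator of S, which maps it to v *)
Definition generator N S (u v : V) : Prop :=
  (fun h : R => N ((h^-1)%:C%C *: (S h u - u) - v)) @ 0^' --> (0 : R).

End NormsAndGroups.

Section DampedSchrodinger.
Context {R : realType}.
Notation mu := (@lebesgue_measure R).

Definition weak_derivative2 (f g : R -> R[i]) : Prop :=
  forall phi, smooth_on_circle phi ->
    cintegral (fun x => f x * (phi^`(2)%classic x)%:C%C) =
    cintegral (fun x => g x * (phi x)%:C%C).

(* Graph of the unbounded operator i d^2/dx^2 - a of H^s with domain H^(s+2) *)
Definition damped_schrodinger (a : R -> R) (s : R) (u v : sobolev R s) : Prop :=
  sobolev_fun (s + 2) (repr u) /\
  exists2 w : sobolev R s, weak_derivative2 (repr u) (repr w) &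
    {ae mu, forall x,
      repr v x = 'i%C * repr w x - (a x)%:C%C * repr u x}.

End DampedSchrodinger.

(* Main.v *)
(** On Fourier coefficients a domain element satisfies
    [(Au)_k = - i k^2 u_k - sum_j ah (k - j) u_j], where [ah] is the Fourier
    transform of [a]. The identity form dissipates only [<y, Ay>], with
    [A = (ah (k - j))], which has no uniform lower bound. Off the resonances
    [k^2 = j^2] the equation [[iK, B] = A], [K = diag (k^2)], has a bounded
    Hermitian solution [B], and the derivative of [eps <y, By>] contributes
    [eps (<y, Ay> - r)] with [r] the resonant part of [<y, Ay>], that is
    [r = sum_k ah 0 |y_k|^2 + Re (ah (2k) conj (y_k) y_{-k})]. Here
    [r >= delta |y|^2], because [a >= 0] is continuous and nonzero, so that
    [|ah m| <= ah 0 - delta] for [m <> 0]. The error [eps <By, Ay>] is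
    absorbed by [<y, Ay>] through Cauchy-Schwarz for the positive form [A]. In [H^s] this is applied to
    [y_k = (1 + k^2)^(s/2) u_k]; the commutator of the weight with [A] gains
    one derivative, so it is absorbed by a large multiple of the [L^2]
    functional. The sum of the two functionals is an equivalent inner product
    for which the generator is strictly dissipative on its domain, and Gronwall
    on orbits plus density of the trigonometric polynomials give
    [N (S T u) <= exp (- omega T / 2) N u]. *)

Require Import Defs.
From HB Require Import structures.
From mathcomp Require Import all_boot all_order all_algebra.
From mathcomp Require Import generic_quotient ring_quotient.
From mathcomp Require Import complex.
From mathcomp Require Import all_classical all_reals all_analysis.
From mathcomp Require Import measurable_realfun ring lra zify.

Set Implicit Arguments.
Unset Strict Implicit.
Unset Printing Implicit Defensive.

Import Order.TTheory GRing.Theory Num.Theory.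
Import numFieldNormedType.Exports.
Import Normc.

Local Open Scope quotient_scope.
Local Open Scope classical_set_scope.
Local Open Scope ring_scope.

(** * Hermitian forms and the commutator equation *)

Section ComplexSums.
Context {R : realType}.
Notation C := R[i].
Notation Re := complex.Re.
Notation Im := complex.Im.
Notation cj := (@conjc R).
Implicit Types (x y z : C).

(** The form [<y, Ay>] alone is blind to states concentrated where [a] vanishes. Dispersion moves
    such states: averaging [A] over the flow of [iK] leaves its resonant part, and [B] is the
    corrector of this averaging. Distinct integer squares differ by at least 1, so the entries of
    [B] are dominated by those of [A], and the l1 norm of the Fourier coefficients of [a] bounds
    both operators by Schur's test. Small [eps] keeps the form comparable to the squared norm. The
    decay is a differential inequality valid at each time, with no observation time, which is why
    every [T > 0] gets a factor below 1.

    The gap [delta] needs strictness and uniformity: equality [|ah m| = ah 0] would propagate to all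
    multiples of [m], against the decay of the coefficients, and the same decay settles all but
    finitely many [m].

    The unbounded [K] is handled only through finite sums: each identity is stated on a window
    [|k| <= n]. The entries of [A] leading out of the window join the weight commutator in one
    remainder, and only energies and bilinear forms pass to the limit in [n]. *)

Definition nsq z : R := Re z ^+ 2 + Im z ^+ 2.

Lemma nsqE z : nsq z = normc z ^+ 2. Proof. by rewrite normc_sqE. Qed.

Lemma nsq_ge0 z : 0 <= nsq z.
Proof. by rewrite addr_ge0 ?sqr_ge0. Qed.

Lemma nsq0 : nsq 0 = 0. Proof. by rewrite /nsq /= expr0n addr0. Qed.

Lemma nsq_eq0 z : nsq z = 0 -> z = 0.
Proof. by rewrite nsqE => /eqP; rewrite sqrf_eq0 => /eqP /eq0_normc. Qed.

Lemma nsqM x y : nsq (x * y) = nsq x * nsq y.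
Proof. by rewrite !nsqE normcM exprMn. Qed.

Lemma ReD x y : Re (x + y) = Re x + Re y.
Proof. by case: x y => [? ?] [? ?]. Qed.
Lemma ReN x : Re (- x) = - Re x.
Proof. by case: x. Qed.
Lemma ReB x y : Re (x - y) = Re x - Re y.
Proof. by case: x y => [? ?] [? ?]. Qed.
Lemma ReC x : Re (cj x) = Re x.
Proof. by case: x. Qed.
Lemma Re_realM (r : R) x : Re (r%:C%C * x) = r * Re x.
Proof. by case: x => a b /=; rewrite mul0r subr0. Qed.

Lemma Re_sum (I : Type) (r : seq I) (P : pred I) (f : I -> C) :
  Re (\sum_(i <- r | P i) f i) = \sum_(i <- r | P i) Re (f i).
Proof. by apply: big_morph => // x y; rewrite ReD. Qed.

Lemma Re_conjM z : Re (cj z * z) = nsq z.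
Proof. by case: z => a b; rewrite /nsq /= mulNr opprK !expr2. Qed.

Lemma Re_conjM_le x y : `|Re (cj x * y)| <= normc x * normc y.
Proof.
have -> : normc x * normc y = normc (cj x * y).
  by rewrite normcM; congr (_ * _); case: x => a b; rewrite /= sqrrN.
case: (cj x * y) => a b /=; by rewrite -sqrtr_sqr ler_wsqrtr// lerDl sqr_ge0.
Qed.

Lemma conjM x y : cj (x * y) = cj x * cj y.
Proof. exact: rmorphM. Qed.

Lemma conjD x y : cj (x + y) = cj x + cj y.
Proof. exact: rmorphD. Qed.

Lemma conj_sum (I : Type) (r : seq I) (P : pred I) (f : I -> C) :
  cj (\sum_(i <- r | P i) f i) = \sum_(i <- r | P i) cj (f i).
Proof. exact: rmorph_sum. Qed.

Section Form.
Variables (F : seq int) (A : int -> int -> C).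

Definition dot (u v : int -> C) : C := \sum_(k <- F) cj (u k) * v k.

Definition matvec (u : int -> C) (k : int) : C := \sum_(j <- F) A k j * u j.

Definition sumsq (u : int -> C) : R := \sum_(k <- F) nsq (u k).

Lemma Re_dot_self u : Re (dot u u) = sumsq u.
Proof. by rewrite Re_sum; apply: eq_bigr => k _; rewrite Re_conjM. Qed.

Lemma sumsq_ge0 u : 0 <= sumsq u.
Proof. by apply: sumr_ge0 => k _; exact: nsq_ge0. Qed.

Lemma dotC u v : cj (dot u v) = dot v u.
Proof.
by rewrite conj_sum; apply: eq_bigr => k _ /=; rewrite conjM conjcK mulrC.
Qed.

Lemma Re_dotC u v : Re (dot u v) = Re (dot v u).
Proof. by rewrite -dotC ReC. Qed.

Lemma dotDr u v w : dot u (fun k => v k + w k) = dot u v + dot u w.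
Proof. by rewrite -big_split; apply: eq_bigr => k _; rewrite mulrDr. Qed.

Lemma dotNr u v : dot u (fun k => - v k) = - dot u v.
Proof. by rewrite /dot -sumrN; apply: eq_bigr => k _; rewrite mulrN. Qed.

Lemma dotZr u (c : C) v : dot u (fun k => c * v k) = c * dot u v.
Proof. by rewrite /dot big_distrr; apply: eq_bigr => k _ /=; rewrite mulrCA. Qed.

Lemma dotDl u v w : dot (fun k => v k + w k) u = dot v u + dot w u.
Proof. by rewrite -big_split; apply: eq_bigr => k _; rewrite conjD mulrDl. Qed.

Lemma dotZl u (c : C) v : dot (fun k => c * v k) u = cj c * dot v u.
Proof.
by rewrite /dot big_distrr; apply: eq_bigr => k _ /=; rewrite conjM mulrA.
Qed.

Lemma eq_dot u u' v v' : {in F, u =1 u'} -> {in F, v =1 v'} ->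
  dot u v = dot u' v'.
Proof.
move=> uu vv; rewrite /dot big_seq [RHS]big_seq.
by apply: eq_bigr => k kF; rewrite uu// vv.
Qed.

(** Young's inequality with a free parameter; the dissipation estimate uses it with
    [t = eps * delta / 4] and with [t = eps]. *)
Lemma Re_dot_le u v (t : R) : 0 < t ->
  - 2 * Re (dot u v) <= t * sumsq u + t^-1 * sumsq v.
Proof.
move=> t0; rewrite Re_sum !big_distrr -big_split; apply: ler_sum => k _ /=.
case: (u k) (v k) => [a b] [c d]; rewrite /nsq /= (_ : a * c - - b * d = a * c + b * d); last by ring.
have h (p q : R) : - 2 * (p * q) <= t * p ^+ 2 + t^-1 * q ^+ 2.
  rewrite -subr_ge0 -(pmulr_rge0 _ t0).
  suff -> : t * (t * p ^+ 2 + t^-1 * q ^+ 2 - - 2 * (p * q)) = (t * p + q) ^+ 2.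
    exact: sqr_ge0.
  by field; rewrite gt_eqF.
by have := h a c; have := h b d; rewrite !mulrDr; lra.
Qed.

Hypothesis hermA : forall k j, A j k = cj (A k j).

Lemma herm_dot u v : dot u (matvec v) = cj (dot v (matvec u)).
Proof.
rewrite conj_sum; transitivity (\sum_(k <- F) \sum_(j <- F) cj (u k) * (A k j * v j)).
  by apply: eq_bigr => k _; rewrite big_distrr.
rewrite exchange_big; apply: eq_bigr => j _ /=.
rewrite conjM conjcK conj_sum big_distrr; apply: eq_bigr => k _ /=.
by rewrite conjM -hermA; ring.
Qed.

Definition quad u : R := Re (dot u (matvec u)).

Lemma matvecD u v k : matvec (fun j => u j + v j) k = matvec u k + matvec v k.
Proof. by rewrite -big_split; apply: eq_bigr => j _; rewrite mulrDr. Qed.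

Lemma matvecZ (c : C) u k : matvec (fun j => c * u j) k = c * matvec u k.
Proof. by rewrite /matvec big_distrr; apply: eq_bigr => j _; rewrite mulrCA. Qed.

Lemma quadD u v (t : R) :
  quad (fun k => u k + t%:C%C * v k) =
  quad u + 2 * t * Re (dot v (matvec u)) + t ^+ 2 * quad v.
Proof.
rewrite /quad (eq_dot (v' := fun k => matvec u k + t%:C%C * matvec v k)
  (fun _ _ => erefl _)); last by move=> k _; rewrite matvecD matvecZ.
rewrite dotDr !dotDl !dotZr !dotZl !ReD.
rewrite (_ : cj t%:C%C = t%:C%C); last by rewrite conjc_real.
by rewrite !Re_realM (herm_dot u v) ReC; ring.
Qed.

End Form.

(** * The commutator corrector and the finite-dimensional dissipation inequality *)

Section Commutator.
Variables (F : seq int) (A : int -> int -> C) (kap : int -> R).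
Hypothesis hermA : forall k j, A j k = cj (A k j).

(* Solves the commutator equation [iK, B] = A off the resonant set
   kap k = kap j, where K is the diagonal matrix of kap. *)
Definition comB (k j : int) : C :=
  if kap k == kap j then 0 else A k j * ('i%C * (kap k - kap j)%:C%C)^-1.

(** Conjugation sends [i (kap k - kap j)] to [i (kap j - kap k)]: the divisor is itself a Hermitian
    kernel, so the quotient stays Hermitian. *)
Lemma hermB k j : comB j k = cj (comB k j).
Proof.
rewrite /comB eq_sym; case: eqP => [_|_]; first by rewrite conjc0.
rewrite conjM -hermA conjc_inv conjM conjc_real; congr (_ * _^-1).
by rewrite -opprB rmorphN /= mulrN -mulNr; congr (_ * _); apply/eqP; rewrite eq_complex /= oppr0 !eqxx.
Qed.

(** Adding the conjugate turns the factor [- i kap j] into [i (kap k - kap j)]. Times the entry of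
    [comB] this gives back [A k j] off resonance and 0 on it, so exactly the resonant sum is missing
    from [quad]. *)
Lemma commutator_dot (y : int -> C) :
  2 * Re (dot F y (matvec F comB (fun k => - ('i%C * (kap k)%:C%C * y k)))) =
  quad F A y - \sum_(k <- F) \sum_(j <- F | kap k == kap j) Re (cj (y k) * (A k j * y j)).
Proof.
set X := dot _ _ _.
have -> : 2 * Re X = Re (X + cj X) by rewrite ReD ReC; ring.
have XE : X = \sum_(k <- F) \sum_(j <- F)
    cj (y k) * (comB k j * - ('i%C * (kap j)%:C%C * y j)).
  by apply: eq_bigr => k _; rewrite big_distrr.
have XcE : cj X = \sum_(k <- F) \sum_(j <- F)
    y j * (comB k j * ('i%C * (kap k)%:C%C * cj (y k))).
  rewrite XE conj_sum exchange_big; apply: eq_bigr => j _ /=.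
  rewrite conj_sum; apply: eq_bigr => k _.
  rewrite !conjM conjcK -hermB; congr (_ * (_ * _)).
  rewrite [LHS]rmorphN /= !conjM conjc_real -!mulNr; congr (_ * _ * _).
  by apply/eqP; rewrite eq_complex /= oppr0 opprK !eqxx.
rewrite XcE XE -big_split Re_sum /quad /dot Re_sum -sumrB /=.
apply: eq_bigr => k _; rewrite -big_split !Re_sum /= big_distrr Re_sum /=.
rewrite [X in X - _](bigID (fun j => kap k == kap j)) /= addrAC subrr add0r.
rewrite [LHS](bigID (fun j => kap k == kap j)) /= big1 ?add0r; last first.
  by move=> j kj; rewrite /comB kj !mul0r !mulr0 addr0.
apply: eq_bigr => j kj; congr Re; rewrite /comB (negbTE kj).
set w := 'i%C * _; have w0 : w != 0.
  rewrite mulf_neq0//; first by rewrite eq_complex /= oner_eq0 andbF.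
  by rewrite eq_complex /= eqxx andbT subr_eq0.
transitivity (cj (y k) * A k j * y j * (w^-1 * w)); last by rewrite mulVf// mulr1 mulrA.
move: (w^-1) => w'; rewrite /w rmorphB /=. ring.
Qed.

(** The left side is the derivative of [<y, (1 + eps B) y>] along [g]. Of the [2 quad] lost through
    [A], at most [quad] is spent on the commutator ([eps <= 1]) and half of [quad] on the cross term
    [eps <z, Ay>]. Of the gained [eps delta |y|^2], one quarter pays for [<y, rho>] and one quarter
    for the terms of order [eps^2], which is the smallness condition on [eps]; half is left. *)
Lemma lyapunov_dissipation (y g rho : int -> C) (alpha beta delta eps : R) :
  (forall x : int -> C, 0 <= quad F A x) ->
  (forall x : int -> C, quad F A x <= alpha * sumsq F x) ->
  (forall x : int -> C, sumsq F (matvec F comB x) <= beta * sumsq F x) ->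
  delta * sumsq F y <=
    \sum_(k <- F) \sum_(j <- F | kap k == kap j) Re (cj (y k) * (A k j * y j)) ->
  0 < delta -> 0 < eps -> eps <= 1 -> 0 <= alpha ->
  eps * ((2 * alpha + 1) * beta) <= delta / 4 ->
  (forall k, k \in F ->
    g k = - ('i%C * (kap k)%:C%C * y k) - matvec F A y k - rho k) ->
  2 * Re (dot F (fun k => y k + eps%:C%C * matvec F comB y k) g) <=
  - (eps * delta / 2) * sumsq F y + (1 + 4 / (eps * delta)) * sumsq F rho.
Proof.
move=> psd ub Bub dia d0 e0 e1 al0 eb gE.
set z := matvec F comB y; set Ay := matvec F A y.
have [Ky KyE] : exists Ky, Ky = fun k => - ('i%C * (kap k)%:C%C * y k) by eexists.
rewrite (eq_dot (fun _ _ => erefl) (v' := fun k => Ky k + (- Ay k + - rho k))); last first.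
  by move=> k kF; rewrite gE// KyE addrA.
rewrite dotDl dotZl conjc_real !dotDr !dotNr ReD Re_realM !ReD !ReN.
have -> : Re (dot F y Ky) = 0.
  rewrite Re_sum big1// => k _; rewrite KyE; case: (y k) => a b /=; ring.
have -> : Re (dot F y Ay) = quad F A y by [].
have hK : 2 * Re (dot F z Ky) <= quad F A y - delta * sumsq F y.
  by rewrite -dotC -(herm_dot _ hermB) KyE commutator_dot lerB.
have hA : - 2 * eps * Re (dot F z Ay) <=
    2^-1 * quad F A y + 2 * eps ^+ 2 * (alpha * beta) * sumsq F y.
  (* Positivity of the form at [y + 2 eps z] is Cauchy-Schwarz without square roots; the factor 2 is
     what limits the cost to half of [quad F A y]. *)
  have := psd (fun k => y k + (2 * eps)%:C%C * z k).
  rewrite quadD// => h.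
  have hz : quad F A z <= alpha * beta * sumsq F y.
    by apply: le_trans (ub _) _; rewrite -mulrA; apply: ler_wpM2l => //; exact: Bub.
  have := ler_wpM2l (sqr_ge0 eps) hz; rewrite -/Ay in h; nra.
have ed0 : 0 < eps * delta / 4 by rewrite divr_gt0// mulr_gt0.
have h1 := Re_dot_le F y rho ed0.
have h2 := Re_dot_le F z rho e0.
have h3 : eps * (eps * sumsq F z) <= eps ^+ 2 * beta * sumsq F y.
  by rewrite mulrA -expr2 -mulrA; apply: ler_wpM2l; [exact: sqr_ge0|exact: Bub].
have h4 : eps * (eps * ((2 * alpha + 1) * beta)) * sumsq F y <= eps * (delta / 4) * sumsq F y.
  by apply: ler_wpM2r; [exact: sumsq_ge0|rewrite ler_wpM2l// ltW].
have h5 : eps * quad F A y <= quad F A y by rewrite ler_piMl.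
have h6 : eps * (eps^-1 * sumsq F rho) = sumsq F rho by rewrite mulrA divff ?mul1r// gt_eqF.
have h7 : (eps * delta / 4)^-1 = 4 / (eps * delta).
  by rewrite invf_div.
have h8 := psd y.
rewrite h7 in h1.
have h9 := ler_wpM2l (ltW e0) h2; rewrite mulrDr h6 in h9.
have h10 := ler_wpM2l (ltW e0) hK.
move: (sumsq_ge0 F y) (sumsq_ge0 F rho) h1 h9 h10 hA h3 h4 h5 h8 => {h2 hK h6 h7}.
move: (4 / (eps * delta)) => t.
move: (sumsq F y) (sumsq F rho) (sumsq F z) (quad F A y) (Re (dot F z Ay))
  (Re (dot F y rho)) (Re (dot F z rho)) (Re (dot F z Ky)) => Y P Z q ra rb rc rd.
lra.
Qed.

End Commutator.

End ComplexSums.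

(** * Convolution bounds on the integers *)

Section IntSums.
Context {R : realType}.
Implicit Types (F G I J : seq int) (h p : int -> R).

(** Symmetric windows exhausting the integers, listed so that passing to the next window puts two
    new terms in front. *)
Fixpoint zrange (n : nat) : seq int :=
  if n is m.+1 then Posz m.+1 :: - Posz m.+1 :: zrange m else [:: 0].

Lemma mem_zrange n k : (k \in zrange n) = (`|k| <= n)%N.
Proof.
elim: n k => [|n IH] k /=; first by rewrite inE; apply/idP/idP; lia.
by rewrite !inE IH; apply/idP/idP; lia.
Qed.

Lemma zrange_uniq n : uniq (zrange n).
Proof.
by elim: n => //= n ->; rewrite !inE !mem_zrange andbT; apply/andP; split; lia.
Qed.

Lemma sub_zrange F : exists n, {subset F <= zrange n}.
Proof.
elim: F => [|k F [n Fn]]; first by exists 0%N.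
exists (maxn n `|k|%N) => j; rewrite inE => /predU1P[->|/Fn].
  by rewrite mem_zrange leq_maxr.
by rewrite !mem_zrange => /leq_trans; apply; rewrite leq_maxl.
Qed.

Lemma zrange_sub m n : (m <= n)%N -> {subset zrange m <= zrange n}.
Proof. by move=> mn k; rewrite !mem_zrange => /leq_trans; exact. Qed.

Lemma sub_sum_le (T : eqType) (F G : seq T) (f : T -> R) :
  uniq F -> uniq G -> {subset F <= G} -> (forall k, 0 <= f k) ->
  \sum_(k <- F) f k <= \sum_(k <- G) f k.
Proof.
move=> uF uG FG f0.
have rP : perm_eq G (F ++ [seq k <- G | k \notin F]).
  apply: uniq_perm => //.
    rewrite cat_uniq uF filter_uniq// andbT.
    by apply/hasPn => k; rewrite mem_filter => /andP[].
  move=> k; rewrite mem_cat mem_filter.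
  by have [/FG->|] := boolP (k \in F).
by rewrite (perm_big _ rP) big_cat /= lerDl sumr_ge0.
Qed.

(** For a nonnegative family this is summability with total at most [H], expressed by finite sums so
    that estimates stay in the reals. *)
Definition bsum h (H : R) := forall F, uniq F -> \sum_(k <- F) h k <= H.

Lemma bsum_zrange h H : (forall k, 0 <= h k) ->
  (forall n, \sum_(k <- zrange n) h k <= H) -> bsum h H.
Proof.
move=> h0 hH F uF; have [n Fn] := sub_zrange F.
by apply: le_trans (hH n); exact: sub_sum_le (zrange_uniq n) _ _.
Qed.

Lemma bsum_inv_sqr : bsum (fun k => (1 + k%:~R ^+ 2)^-1) 5.
Proof.
apply: bsum_zrange => [k|n]; first by rewrite invr_ge0 addr_ge0// sqr_ge0.
(* Telescoping majorant: the frequencies [t] and [- t], with [t = n.+1], add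
   [2 / (1 + t^2) <= 4 / t - 4 / (t + 1)], and the value 1 at [n = 0] fixes the constant 5. *)
suff: \sum_(k <- zrange n) (1 + (k%:~R : R) ^+ 2)^-1 <= 5 - 4 * n.+1%:R^-1.
  by move=> /le_trans; apply; rewrite gerBl mulr_ge0// invr_ge0.
elim: n => [|n IH]; first by rewrite big_seq1 expr0n addr0 invr1; lra.
rewrite /= !big_cons mulrNz sqrrN.
have -> : (Posz n.+1)%:~R = n.+1%:R :> R by [].
set t : R := n.+1%:R in IH *.
have t1 : 1 <= t by rewrite /t ler1n.
have -> : n.+2%:R = t + 1 :> R by rewrite /t -[in LHS]addn1 natrD.
have : 2 * (1 + t ^+ 2)^-1 <= 4 * t^-1 - 4 * (t + 1)^-1.
  rewrite (_ : 4 * t^-1 - 4 * (t + 1)^-1 = 4 / (t * (t + 1))); last first.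
    by field; apply/andP; split; lra.
  rewrite ler_pdivlMr; last by rewrite mulr_gt0//; lra.
  have t2 : 0 < 1 + t ^+ 2 by rewrite ltr_wpDr ?sqr_ge0.
  by rewrite mulrAC ler_pdivrMr//; nra.
move: IH; move: (\sum_(k <- _) _) (t^-1) ((t + 1)^-1) ((1 + t ^+ 2)^-1) => *; lra.
Qed.

Lemma sqr_sum_le (T : Type) (r : seq T) (h p : T -> R) :
  (forall i, 0 <= h i) ->
  (\sum_(i <- r) h i * p i) ^+ 2 <=
  (\sum_(i <- r) h i) * (\sum_(i <- r) h i * p i ^+ 2).
Proof.
move=> h0; elim: r => [|i r IH]; first by rewrite !big_nil expr0n mul0r.
rewrite !big_cons.
have S0 : 0 <= \sum_(j <- r) h j by apply: sumr_ge0.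
have T0 : 0 <= \sum_(j <- r) h j * p j ^+ 2.
  by apply: sumr_ge0 => j _; rewrite mulr_ge0 ?sqr_ge0.
move: (\sum_(j <- r) h j) (\sum_(j <- r) h j * p j ^+ 2)
  (\sum_(j <- r) h j * p j) IH S0 T0 (h0 i) => S V U IH S0 V0 hi0.
suff : 2 * (p i) * U <= V + p i ^+ 2 * S.
  move=> /(ler_wpM2l hi0); move: IH.
  move: (p i) (h i) => q a; move=> h1 h2; rewrite -subr_ge0 in h1; rewrite -subr_ge0 in h2.
  rewrite -subr_ge0; apply: le_trans (addr_ge0 h1 h2) _.
  by rewrite le_eqVlt; apply/orP; left; apply/eqP; ring.
(* If [S = 0], the induction hypothesis forces [U = 0]. Otherwise multiply by [S]: the difference
   becomes [(S V - U^2) + (U - p S)^2]. *)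
have [S_0|S_gt0] := eqVneq S 0.
  move: IH; rewrite S_0 mul0r => U0.
  have /eqP : U ^+ 2 == 0 by rewrite eq_le U0 sqr_ge0.
  by move/eqP; rewrite sqrf_eq0 => /eqP ->; rewrite !mulr0 addr0.
have {}S0 : 0 < S by rewrite lt_def S_gt0.
rewrite -(ler_pM2l S0) -subr_ge0; rewrite -subr_ge0 in IH.
apply: le_trans (addr_ge0 IH (sqr_ge0 (U - p i * S))) _.
by rewrite le_eqVlt; apply/orP; left; apply/eqP; ring.
Qed.

Lemma schur_bound (F J : seq int) (h p : int -> int -> R) H :
  (forall k j, 0 <= h k j) ->
  (forall k, \sum_(j <- J) h k j <= H) ->
  \sum_(k <- F) (\sum_(j <- J) h k j * p k j) ^+ 2 <=
  H * \sum_(k <- F) \sum_(j <- J) h k j * p k j ^+ 2.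
Proof.
move=> h0 hH; rewrite big_distrr; apply: ler_sum => k _ /=.
apply: le_trans (sqr_sum_le _ _ (h0 k)) _; apply: ler_wpM2r => //.
by apply: sumr_ge0 => j _; rewrite mulr_ge0 ?sqr_ge0.
Qed.

Section Convolution.
Variables (h : int -> R) (H : R).
Hypotheses (h0 : forall k, 0 <= h k) (hH : bsum h H).

Lemma bsum_ge0 : 0 <= H.
Proof. by have := hH (isT : uniq [::]); rewrite big_nil. Qed.

Lemma bsum_subl F j : uniq F -> \sum_(k <- F) h (k - j) <= H.
Proof.
move=> uF; rewrite -(big_map (fun k => k - j) xpredT); apply: hH.
by rewrite map_inj_uniq//; exact: addIr.
Qed.

Lemma bsum_subr F k : uniq F -> \sum_(j <- F) h (k - j) <= H.
Proof.
move=> uF; rewrite -(big_map (fun j => k - j) xpredT); apply: hH.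
by rewrite map_inj_uniq// => i j /addrI /oppr_inj.
Qed.

(** Schur's test: the rows and the columns of a kernel in [k - j] both sum to at most [H]. *)
Lemma toeplitz_bound F J p : uniq F -> uniq J ->
  \sum_(k <- F) (\sum_(j <- J) h (k - j) * p j) ^+ 2 <=
  H ^+ 2 * \sum_(j <- J) p j ^+ 2.
Proof.
move=> uF uJ.
apply: le_trans (schur_bound (H := H) _ _ _ _) _ => // [k|].
  exact: bsum_subr.
rewrite expr2 -mulrA; apply: ler_wpM2l; first exact: bsum_ge0.
rewrite exchange_big /= big_distrr; apply: ler_sum => j _ /=.
rewrite -big_distrl /=; apply: ler_wpM2r; first exact: sqr_ge0.
exact: bsum_subl.
Qed.

(** Young's inequality indexed by the shift [i]: [p] lives on all integers, so the output window [F]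
    and the range [I] of shifts are independent. Uniformity in [I] lets the convolution cutoff tend
    to infinity later. *)
Lemma convolution_bound F I p X : uniq F -> uniq I ->
  bsum (fun k => p k ^+ 2) X ->
  \sum_(k <- F) (\sum_(i <- I) h i * p (k - i)) ^+ 2 <= H ^+ 2 * X.
Proof.
move=> uF uI pX.
have X0 : 0 <= X by have := pX _ (isT : uniq [::]); rewrite big_nil.
apply: le_trans (schur_bound (H := H) _ _ _ _) _ => // [k|]; first exact: hH.
rewrite expr2 -mulrA; apply: ler_wpM2l; first exact: bsum_ge0.
rewrite exchange_big /=.
apply: (@le_trans _ _ (\sum_(i <- I) h i * X)); last first.
  by rewrite -big_distrl /=; apply: ler_wpM2r => //; exact: hH.
apply: ler_sum => i _; rewrite -big_distrr /=; apply: ler_wpM2l => //.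
rewrite -(big_map (fun k => k - i) xpredT (fun k => p k ^+ 2)); apply: pX.
by rewrite map_inj_uniq//; exact: addIr.
Qed.

End Convolution.

End IntSums.

(** * Fourier coefficients *)

Section CircleIntegrals.
Context {R : realType}.
Notation C := R[i].
Notation cj := (@conjc R).
Notation mu := (@lebesgue_measure R).
Notation circle := (@circle R).
Notation period := (@period R).

Lemma period_gt0 : 0 < period.
Proof. by rewrite /period mulr2n addr_gt0 ?pi_gt0. Qed.

Lemma cexpiE k (x : R) : cexpi k x = Complex (cos (k%:~R * x)) (sin (k%:~R * x)).
Proof. by []. Qed.

Lemma cexpiD k l (x : R) : cexpi (k + l) x = cexpi k x * cexpi l x.
Proof.
rewrite !cexpiE intrD mulrDl cosD sinD; apply/eqP; rewrite eq_complex /=.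
by apply/andP; split; apply/eqP; ring.
Qed.

Lemma cexpi0 (x : R) : cexpi 0 x = 1.
Proof. by rewrite cexpiE mul0r cos0 sin0. Qed.

Lemma cexpiN k (x : R) : cexpi (- k) x = cj (cexpi k x).
Proof. by rewrite !cexpiE mulrNz mulNr cosN sinN. Qed.

Lemma cexpi_period k (x : R) : cexpi k (x + period) = cexpi k x.
Proof.
have H (n : nat) (y : R) : cexpi (Posz n) (y + period) = cexpi (Posz n) y.
  rewrite !cexpiE mulrDr; have -> : (Posz n)%:~R * period = period *+ n.
    by rewrite mulr_natl.
  by rewrite /period !periodicn//; [exact: sinD2pi|exact: cosD2pi].
case: k => n; first exact: H.
by rewrite NegzE !cexpiN H.
Qed.

Lemma continuous_cosM (c : R) : continuous (fun x : R => cos (c * x)).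
Proof.
move=> x; apply: (@continuous_comp _ _ _ ( *%R c) cos).
  exact: mulrl_continuous.
exact: continuous_cos.
Qed.

Lemma continuous_sinM (c : R) : continuous (fun x : R => sin (c * x)).
Proof.
move=> x; apply: (@continuous_comp _ _ _ ( *%R c) sin).
  exact: mulrl_continuous.
exact: continuous_sin.
Qed.

Lemma continuous_integrable (f : R -> R) : continuous f ->
  mu.-integrable circle (EFin \o f).
Proof.
move=> cf; apply: continuous_compact_integrable; first exact: segment_compact.
exact: continuous_subspaceT.
Qed.

Definition has_derive (F f : R -> R) :=
  forall x : R, derivable F x 1 /\ F^`()%classic x = f x.

Lemma has_deriveP (F f : R -> R) :
  (forall x : R, is_derive x (1 : R) F (f x)) <-> has_derive F f.
Proof.
split=> H x; have [dF Ff] := H x; first by rewrite derive1E.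
by apply: DeriveDef => //; rewrite -derive1E.
Qed.

Lemma has_derive_continuous (F f : R -> R) : has_derive F f -> continuous F.
Proof.
move=> dF x; apply: differentiable_continuous.
by apply/derivable1_diffP; have [] := dF x.
Qed.

Lemma Rintegral_derive (F f : R -> R) : has_derive F f -> continuous f ->
  \int[mu]_(x in circle) f x = F period - F 0.
Proof.
move=> dF cf; have cF := has_derive_continuous dF.
rewrite /Rintegral (@continuous_FTC2 _ f F) //.
- exact: period_gt0.
- exact: continuous_subspaceT.
- split; first by move=> x _; have [] := dF x.
    by apply: cvg_at_right_filter; exact: cF.
  by apply: cvg_at_left_filter; exact: cF.
- by move=> x _; have [_ <-] := dF x.
Qed.

Lemma is_derive_mull (c x : R) : is_derive x (1 : R) ( *%R c) c.
Proof.
have := @is_deriveZ _ _ _ id c x 1 1 (is_derive_id x (1 : R)).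
by rewrite /GRing.scale /= mulr1.
Qed.

Lemma is_derive_cosM (c x : R) :
  is_derive x (1 : R) (fun x : R => cos (c * x)) (- c * sin (c * x)).
Proof.
apply: is_derive_eq (is_derive1_comp (is_derive_cos _) (is_derive_mull c x)) _.
by rewrite mulrC mulrN mulNr.
Qed.

Lemma is_derive_sinM (c x : R) :
  is_derive x (1 : R) (fun x : R => sin (c * x)) (c * cos (c * x)).
Proof.
apply: is_derive_eq (is_derive1_comp (is_derive_sin _) (is_derive_mull c x)) _.
by rewrite mulrC.
Qed.

Lemma cexpi_at_period k : cexpi k period = 1 :> C.
Proof. by rewrite -[period]add0r cexpi_period cexpiE mulr0 cos0 sin0. Qed.

Lemma mu_circle : mu circle = period%:E.
Proof.
by rewrite /Defs.circle lebesgue_measure_itv /= lte_fin period_gt0 -EFinD subr0.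
Qed.

Lemma cintegral_cexpi k : cintegral (cexpi k : R -> C) = if k == 0 then period%:C%C else 0.
Proof.
have [->|k0] := eqVneq k 0.
  rewrite /cintegral; congr Complex.
    under eq_Rintegral do rewrite cexpi0 /=.
    rewrite Rintegral_cst//; last exact: measurable_circle.
    by rewrite mul1r; have /= -> := mu_circle.
  under eq_Rintegral do rewrite cexpi0 /=.
  by rewrite Rintegral_cst ?mul0r//; exact: measurable_circle.
have kR : k%:~R != 0 :> R by rewrite intr_eq0.
have [c1 s1] : cos (k%:~R * period) = 1 /\ sin (k%:~R * period) = 0.
  by case: (cexpi_at_period k).
rewrite /cintegral; congr Complex.
  rewrite (@Rintegral_derive (fun x => k%:~R^-1 * sin (k%:~R * x))).
  - by rewrite s1 !mulr0 sin0 mulr0 subrr.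
  - apply/has_deriveP => x; apply: is_derive_eq (is_deriveZ _ (is_derive_sinM _ _)) _.
    by rewrite /GRing.scale /= mulKf.
  - exact: continuous_cosM.
rewrite (@Rintegral_derive (fun x => - k%:~R^-1 * cos (k%:~R * x))).
- by rewrite c1 mulr0 cos0 subrr.
- apply/has_deriveP => x; apply: is_derive_eq (is_deriveZ _ (is_derive_cosM _ _)) _.
  by rewrite /GRing.scale /= mulrA mulrNN mulVf// mul1r.
- exact: continuous_sinM.
Qed.

Lemma fourier_cexpi l k : fourier (cexpi l : R -> C) k = (k == l)%:R.
Proof.
rewrite /fourier (_ : (fun x => _) = cexpi (l - k)); last first.
  by apply/funext => x; rewrite cexpiD.
rewrite cintegral_cexpi subr_eq0 eq_sym; case: eqP => _; last by rewrite mulr0.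
by rewrite -rmorphM /= mulVf// gt_eqF// period_gt0.
Qed.

(* Integration by parts, using that the boundary terms agree. *)
Lemma fourier_derive (phi dphi : R -> R) k : periodic phi period ->
  has_derive phi dphi -> continuous dphi ->
  fourier (fun x => (dphi x)%:C%C) k =
  'i%C * k%:~R%:C%C * fourier (fun x => (phi x)%:C%C) k.
Proof.
move=> pphi dP cd; set r : R := k%:~R.
have cphi := has_derive_continuous dP.
move/has_deriveP in dP.
have ci (f g : R -> R) : continuous f -> continuous g ->
    mu.-integrable circle (EFin \o (fun x => f x * g x)).
  by move=> cf cg; apply: continuous_integrable => x; apply: cvgM; [exact: cf|exact: cg].
have [c1 s1] : cos (r * period) = 1 /\ sin (r * period) = 0.
  by case: (cexpi_at_period k).
have p0 : phi period = phi 0 by rewrite -[in LHS](add0r period) pphi.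
have cosI := @continuous_cosM r; have sinI := @continuous_sinM r.
have mc := @measurable_circle R.
have IZ (a : R) (h : R -> R) : mu.-integrable circle (EFin \o h) ->
    mu.-integrable circle (EFin \o (fun x => a * h x)).
  exact: integrableZl.
have E1 : \int[mu]_(x in circle) (dphi x * cos (r * x)) =
    r * \int[mu]_(x in circle) (phi x * sin (r * x)).
  apply/eqP; rewrite -subr_eq0 -RintegralZl//; last exact: ci.
  rewrite -RintegralB//; [|exact: ci|by apply: IZ; exact: ci].
  rewrite (@Rintegral_derive (fun x => phi x * cos (r * x))).
  - by rewrite c1 mulr0 cos0 p0 subrr.
  - apply/has_deriveP => x; apply: is_derive_eq (is_deriveM (dP x) (is_derive_cosM r x)) _.
    by rewrite /GRing.scale /=; ring.
  - move=> x; apply: cvgB; first by apply: cvgM; [exact: cd|exact: cosI].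
    by apply: cvgM; [exact: cvg_cst|apply: cvgM; [exact: cphi|exact: sinI]].
have E2 : \int[mu]_(x in circle) (dphi x * sin (r * x)) =
    - (r * \int[mu]_(x in circle) (phi x * cos (r * x))).
  apply/eqP; rewrite -addr_eq0 -RintegralZl//; last exact: ci.
  rewrite -RintegralD//; [|exact: ci|by apply: IZ; exact: ci].
  rewrite (@Rintegral_derive (fun x => phi x * sin (r * x))).
  - by rewrite s1 !mulr0 sin0 mulr0 subrr.
  - apply/has_deriveP => x; apply: is_derive_eq (is_deriveM (dP x) (is_derive_sinM r x)) _.
    by rewrite /GRing.scale /=; ring.
  - move=> x; apply: cvgD; first by apply: cvgM; [exact: cd|exact: sinI].
    by apply: cvgM; [exact: cvg_cst|apply: cvgM; [exact: cphi|exact: cosI]].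
have fE (f : R -> R) : continuous f -> fourier (fun x => (f x)%:C%C) k =
    period^-1%:C%C * Complex (\int[mu]_(x in circle) (f x * cos (r * x)))
                       (- \int[mu]_(x in circle) (f x * sin (r * x))).
  move=> cf; congr (_ * Complex _ _).
    by apply: eq_Rintegral => x _; rewrite cexpiN /= mul0r subr0.
  rewrite -[RHS]mulN1r -RintegralZl//; last exact: ci.
  by apply: eq_Rintegral => x _; rewrite cexpiN /= mul0r addr0 mulN1r mulrN.
rewrite !fE// E1 E2; apply/eqP; rewrite eq_complex /=; apply/andP; split; apply/eqP; ring.
Qed.

End CircleIntegrals.

(** * Uniqueness of Fourier coefficients *)

Section StepPolynomials.
Context {R : realType}.
Implicit Types t : R.

(* As n grows, tends to 1 for t < 1/2 and to 0 for t > 1/2. *)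
Definition step_approx (n : nat) t : R := (1 - t ^+ n) ^+ (2 ^ n).

Lemma bernoulli_ge (m : nat) t : -1 <= t -> 1 + m%:R * t <= (1 + t) ^+ m.
Proof.
move=> t1; elim: m => [|m IH]; first by rewrite mul0r addr0 expr0.
have t0 : 0 <= 1 + t by lra.
rewrite exprS; apply: le_trans (ler_wpM2l t0 IH).
rewrite -[m.+1]addn1 natrD.
have : 0 <= m%:R * t ^+ 2 by rewrite mulr_ge0 ?sqr_ge0.
by rewrite expr2; lra.
Qed.

Lemma step_approx_itv n t : 0 <= t <= 1 -> 0 <= step_approx n t <= 1.
Proof.
move=> /andP[t0 t1]; rewrite /step_approx.
have h0 := exprn_ge0 n t0; have h1 := exprn_ile1 n t0 t1.
by rewrite exprn_ge0 ?exprn_ile1; lra.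
Qed.

(** Bernoulli's inequality gives [(1 - t^n)^(2^n) >= 1 - (2 t)^n]. *)
Lemma step_approx_cvg1 t : 0 <= t < 2^-1 ->
  step_approx n t @[n --> \oo] --> (1 : R).
Proof.
move=> /andP[t0 t2].
apply: (@squeeze_cvgr _ _ _ _ (fun n => 1 - (2 * t) ^+ n) (cst 1)).
- apply: nearW => n; apply/andP; split; last first.
    by have /andP[] := @step_approx_itv n t ltac:(apply/andP; split; lra).
  rewrite /step_approx exprMn -natrX -mulrN.
  apply: le_trans (bernoulli_ge _ _) _ => //.
  by rewrite lerN2 exprn_ile1//; lra.
- rewrite -[X in _ --> X]subr0; apply: cvgB; first exact: cvg_cst.
  by apply: cvg_expr; rewrite ger0_norm; lra.
- exact: cvg_cst.
Qed.

(** Multiply by [(1 + t^n)^(2^n)], which is at least [(2 t)^n]: the product is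
    [(1 - t^(2n))^(2^n) <= 1], so the value is at most [(2 t)^(- n)]. *)
Lemma step_approx_cvg0 t : 2^-1 < t <= 1 ->
  step_approx n t @[n --> \oo] --> (0 : R).
Proof.
move=> /andP[t2 t1]; have t0 : 0 < t by lra.
apply: (@squeeze_cvgr _ _ _ _ (cst 0) (fun n => ((2 * t)^-1) ^+ n)).
- apply: nearW => n; apply/andP; split.
    by have /andP[] := @step_approx_itv n t ltac:(apply/andP; split; lra).
  have h0 := exprn_gt0 n t0; have h1 := exprn_ile1 n (ltW t0) t1.
  have p0 : 0 < (2 * t) ^+ n by rewrite exprn_gt0//; lra.
  rewrite exprVn -[leRHS]mul1r ler_pdivlMr//.
  have hb : (2 * t) ^+ n <= (1 + t ^+ n) ^+ (2 ^ n).
    apply: le_trans (bernoulli_ge _ _); last by lra.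
    by rewrite exprMn -natrX lerDr.
  apply: le_trans (ler_wpM2l _ hb) _; first by rewrite exprn_ge0//; lra.
  rewrite -exprMn exprn_ile1//; last first.
    by rewrite -subr_sqr expr1n gerBl sqr_ge0.
  by rewrite mulr_ge0//; lra.
- exact: cvg_cst.
- by apply: cvg_expr; rewrite ger0_norm ?invr_ge0 ?invf_lt1; lra.
Qed.

End StepPolynomials.

Section TrigonometricPolynomials.
Context {R : realType}.
Notation C := R[i].
Notation Re := complex.Re.
Notation Im := complex.Im.
Notation mu := (@lebesgue_measure R).
Notation circle := (@circle R).

(** Frequencies may repeat in the list, so sums and products of polynomials are concatenation and
    pairing of lists, without collecting terms. *)
Definition tpoly (s : seq (int * C)) (x : R) : C :=
  \sum_(p <- s) p.2 * cexpi p.1 x.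

Definition trigpoly (t : R -> C) := exists s, t = tpoly s.

Lemma trigpolyD t t' : trigpoly t -> trigpoly t' -> trigpoly (fun x => t x + t' x).
Proof.
move=> [s ->] [s' ->]; exists (s ++ s').
by apply/funext => x; rewrite /tpoly big_cat.
Qed.

Lemma trigpolyM t t' : trigpoly t -> trigpoly t' -> trigpoly (fun x => t x * t' x).
Proof.
move=> [s ->] [s' ->]; exists [seq (p.1 + q.1, p.2 * q.2) | p <- s, q <- s'].
apply/funext => x; rewrite /tpoly big_allpairs_dep big_distrl; apply: eq_bigr => p _.
rewrite big_distrr; apply: eq_bigr => q _ /=.
by rewrite cexpiD; ring.
Qed.

Lemma trigpoly_cst (c : C) : trigpoly (fun=> c).
Proof.
by exists [:: (0, c)]; apply/funext => x; rewrite /tpoly big_seq1 cexpi0 mulr1.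
Qed.

Lemma trigpolyX t n : trigpoly t -> trigpoly (fun x => t x ^+ n).
Proof.
move=> ht; elim: n => [|n IH]; first exact: trigpoly_cst.
rewrite (_ : (fun x => _) = (fun x => t x * t x ^+ n)); first exact: trigpolyM.
by apply/funext => x; rewrite exprS.
Qed.

Lemma cintegrableZD (c : C) (f g : R -> C) : cintegrable f -> cintegrable g ->
  cintegrable (fun x => c * f x + g x).
Proof.
move=> [fr fi] [gr gi]; have mc := @measurable_circle R.
have IZ (r : R) (h : R -> R) : mu.-integrable circle (EFin \o h) ->
    mu.-integrable circle (EFin \o (fun x => r * h x)).
  exact: integrableZl.
split.
  rewrite (_ : _ \o _ = (EFin \o (fun x => (complex.Re c * complex.Re (f x))%R)) \-
    (EFin \o (fun x => (complex.Im c * complex.Im (f x))%R)) \+ (EFin \o (fun x => Re (g x))))%E.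
    by apply: integrableD => //; apply: integrableB => //; exact: IZ.
  by apply/funext => x /=; congr EFin; move: (f x) (g x) => [? ?] [? ?]; case: (c).
rewrite (_ : _ \o _ = (EFin \o (fun x => (complex.Re c * complex.Im (f x))%R)) \+
  (EFin \o (fun x => (complex.Im c * complex.Re (f x))%R)) \+ (EFin \o (fun x => Im (g x))))%E.
  by apply: integrableD => //; apply: integrableD => //; exact: IZ.
by apply/funext => x /=; congr EFin; move: (f x) (g x) => [? ?] [? ?]; case: (c).
Qed.

Lemma cintegrable0 : cintegrable (fun=> 0 : C).
Proof. by split; exact: integrable0. Qed.

Lemma cintegral0 : cintegral (fun=> 0 : C) = 0.
Proof.
transitivity (-1 * cintegral (fun=> 0) + cintegral (fun=> 0) : C).
  rewrite -cintegral_linear; [|exact: cintegrable0..].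
  by congr cintegral; apply/funext => x; rewrite mulr0 addr0.
by rewrite mulN1r addNr.
Qed.

Lemma cintegral_sum (I : Type) (s : seq I) (c : I -> C) (g : I -> R -> C) :
  (forall i, cintegrable (g i)) ->
  cintegrable (fun x => \sum_(i <- s) c i * g i x) /\
  cintegral (fun x => \sum_(i <- s) c i * g i x) =
    \sum_(i <- s) c i * cintegral (g i).
Proof.
move=> ig; elim: s => [|i s [IH1 IH2]].
  rewrite (_ : (fun _ => _) = fun=> 0); last by apply/funext => x; rewrite big_nil.
  by rewrite big_nil; split; [exact: cintegrable0|exact: cintegral0].
rewrite (_ : (fun _ => _) = (fun x => c i * g i x + \sum_(j <- s) c j * g j x)).
  by rewrite big_cons -IH2 -cintegral_linear//; split => //; exact: cintegrableZD.
by apply/funext => x; rewrite big_cons.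
Qed.

Lemma cintegrable_tpoly (f : R -> C) t : sq_integrable f -> trigpoly t ->
  cintegrable (fun x => f x * t x).
Proof.
move=> sf [s ->].
rewrite (_ : (fun x => _) = (fun x => \sum_(p <- s) p.2 * (f x * cexpi p.1 x))).
  by apply: (cintegral_sum s (fun p => p.2) (fun p => sq_integrable_cexpi p.1 sf)).1.
by apply/funext => x; rewrite big_distrr; apply: eq_bigr => p _; rewrite mulrCA.
Qed.

Lemma cintegral_tpoly_eq0 (f : R -> C) t : sq_integrable f ->
  (forall k, fourier f k = 0) -> trigpoly t -> cintegral (fun x => f x * t x) = 0.
Proof.
move=> sf f0 [s ->].
rewrite (_ : (fun x => _) = (fun x => \sum_(p <- s) p.2 * (f x * cexpi p.1 x))); last first.
  by apply/funext => x; rewrite big_distrr; apply: eq_bigr => p _; rewrite mulrCA.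
rewrite (cintegral_sum s (fun p => p.2) (fun p => sq_integrable_cexpi p.1 sf)).2.
rewrite big1// => p _; have /eqP := f0 (- p.1); rewrite /fourier opprK mulf_eq0.
case/orP => [/eqP[]/eqP|/eqP -> ]; last by rewrite mulr0.
by rewrite invr_eq0 gt_eqF// period_gt0.
Qed.

End TrigonometricPolynomials.

(** * Square-integrable functions with zero Fourier coefficients *)

Section Uniqueness.
Context {R : realType}.
Notation C := R[i].
Notation Re := complex.Re.
Notation Im := complex.Im.
Notation mu := (@lebesgue_measure R).
Notation circle := (@circle R).
Notation period := (@period R).

(* Lies below 1/2 exactly on ]0, y[ modulo the period. *)
Definition arc_gauge (y x : R) : R := 2^-1 * (1 + sin (x / 2) * sin ((x - y) / 2)).

Lemma arc_gauge_itv y x : 0 <= arc_gauge y x <= 1.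
Proof.
have : `|sin (x / 2) * sin ((x - y) / 2)| <= 1.
  by rewrite normrM mulr_ile1 ?sin_max.
by rewrite /arc_gauge ler_norml => /andP[? ?]; apply/andP; split; lra.
Qed.

Lemma sin_half_gt0 (x : R) : 0 < x < period -> 0 < sin (x / 2).
Proof.
rewrite /Defs.period mulr2n => /andP[x0 xp].
by apply: sin_gt0_pi; apply/andP; split; lra.
Qed.

Lemma arc_gauge_lt y x : 0 < x < y -> y < period -> arc_gauge y x < 2^-1.
Proof.
move=> /andP[x0 xy] yp; rewrite /arc_gauge.
have s1 : 0 < sin (x / 2) by apply: sin_half_gt0; lra.
have s2 : 0 < sin ((y - x) / 2) by apply: sin_half_gt0; lra.
have -> : (x - y) / 2 = - ((y - x) / 2) by ring.
by rewrite sinN mulrN; have := mulr_gt0 s1 s2; lra.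
Qed.

Lemma arc_gauge_gt y x : 0 < y < x -> x < period -> 2^-1 < arc_gauge y x.
Proof.
move=> /andP[y0 xy] xp; rewrite /arc_gauge.
have s1 : 0 < sin (x / 2) by apply: sin_half_gt0; lra.
have s2 : 0 < sin ((x - y) / 2) by apply: sin_half_gt0; lra.
by have := mulr_gt0 s1 s2; lra.
Qed.

(** The half-angle factors combine: [sin (x / 2) sin ((x - y) / 2) = (cos (y / 2) - cos (x - y / 2))
    / 2], whose frequencies are 0, 1 and -1. *)
Lemma trigpoly_arc_gauge y : trigpoly (fun x => (arc_gauge y x)%:C%C).
Proof.
pose c := cos (y / 2); pose s := sin (y / 2).
exists [:: (0, (2^-1 + c / 4)%:C%C);
  (1, Complex (- c / 8) (s / 8)); (-1, Complex (- c / 8) (- s / 8))].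
apply/funext => x; rewrite /tpoly !big_cons big_nil /= addr0 cexpi0 mulr1.
rewrite cexpiN cexpiE /= mul1r; apply/eqP; rewrite eq_complex /=.
have -> : arc_gauge y x = 2^-1 + (c - (cos x * c + sin x * s)) / 4.
  rewrite /arc_gauge; set a := x / 2.
  have xE : x = a + a by rewrite /a; field.
  have -> : (x - y) / 2 = a - y / 2 by rewrite /a mulrBl.
  rewrite sinB -/c -/s {1 2}xE cosD sinD.
  have := cos2Dsin2 a; move: (cos a) (sin a) => p q pq.
  by have -> : p * p = 1 - q * q by [rewrite -pq; ring]; field.
by apply/andP; split; apply/eqP; field.
Qed.

Lemma trigpoly_step n y : trigpoly (fun x => (step_approx n (arc_gauge y x))%:C%C).
Proof.
rewrite (_ : (fun x => _) =
  (fun x => (1 + -1 * (arc_gauge y x)%:C%C ^+ n) ^+ (2 ^ n))).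
  apply: trigpolyX; apply: trigpolyD; first exact: trigpoly_cst.
  apply: trigpolyM; first exact: trigpoly_cst.
  by apply: trigpolyX; exact: trigpoly_arc_gauge.
by apply/funext => x; rewrite /step_approx rmorphXn rmorphB rmorphXn rmorph1 mulN1r.
Qed.

Lemma continuous_arc_gauge y : continuous (arc_gauge y).
Proof.
have h (f : R -> R) : continuous f -> continuous (fun x => sin (f x)).
  move=> cf x; apply: (@continuous_comp _ _ _ f sin); first exact: cf.
  exact: continuous_sin.
have h1 : continuous (fun x : R => sin (x / 2)) by apply: h; exact: mulrr_continuous.
have h2 : continuous (fun x : R => sin ((x - y) / 2)).
  apply: h => x; apply: cvgM; last exact: cvg_cst.
  by apply: cvgB; [exact: cvg_id|exact: cvg_cst].
move=> x; apply: cvgM; first exact: cvg_cst.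
apply: cvgD; first exact: cvg_cst.
by apply: cvgM; [exact: h1|exact: h2].
Qed.

Lemma measurable_step n y :
  measurable_fun setT (fun x => step_approx n (arc_gauge y x)).
Proof.
apply: measurable_funX; apply: measurable_funB; first exact: measurable_cst.
apply: measurable_funX; apply: continuous_measurable_fun.
exact: continuous_arc_gauge.
Qed.

(** The step polynomials composed with the gauge are trigonometric polynomials with values in [0, 1]
    that converge to the indicator of the arc from 0 to [y]; dominated convergence transfers the
    orthogonality. *)
Lemma Rintegral_arc_eq0 (g : R -> R) y : mu.-integrable circle (EFin \o g) ->
  (forall t : R -> R, trigpoly (fun x => (t x)%:C%C) ->
    \int[mu]_(x in circle) (g x * t x) = 0) ->
  0 < y < period ->
  \int[mu]_(x in circle) (g \_ `]-oo, y]%classic) x = 0.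
Proof.
move=> ig gt0 /andP[y0 yp]; have mc := @measurable_circle R.
have mg : measurable_fun circle g.
  by case/integrableP: ig => /measurable_EFinP.
pose F n x := (g x * step_approx n (arc_gauge y x))%:E.
have [] := @dominated_convergence _ _ _ mu circle mc F
  (EFin \o (g \_ `]-oo, y]%classic)) (fun x => (`|g x|)%:E).
- move=> n; apply/measurable_EFinP; apply: measurable_funM => //.
  by apply: measurable_funTS; exact: measurable_step.
- apply/measurable_EFinP; apply/measurable_restrict => //.
  by apply: measurable_funS mg => // x [].
(* At these three points of the period the gauge is 1/2 and the limit is not controlled. *)
- exists [set` [:: 0; y; period]]; split.
  + apply: countable_measurable; last exact/finite_set_countable/finite_seq.
    by move=> t; exact: measurable_set1.
  + by apply: countable_lebesgue_measure0; exact/finite_set_countable/finite_seq.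
  move=> x /= H; apply: contrapT => xN; apply: H => cx.
  have {xN}[x0 xy xp] : [/\ x != 0, x != y & x != period].
    by move/negP: xN; rewrite !inE !negb_or => /and3P.
  have /andP[x0' xp'] : 0 < x < period.
    move: cx; rewrite /Defs.circle /= in_itv /= => /andP[c0 c1].
    by rewrite !lt_neqAle eq_sym x0 xp c0 c1.
  apply: cvg_EFin; first by apply: nearW.
  rewrite /= patchE; have [xy'|yx] := ltP x y.
    rewrite mem_set; last by rewrite /= in_itv /= ltW.
    rewrite -[X in _ --> X]mulr1; apply: cvgM; first exact: cvg_cst.
    apply: step_approx_cvg1; rewrite arc_gauge_lt ?x0'//.
    by have /andP[->] := arc_gauge_itv y x.
  have {}yx : y < x by rewrite lt_neqAle eq_sym xy.
  rewrite memNset; last by rewrite /= in_itv /= leNgt yx.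
  rewrite -[X in _ --> X](mulr0 (g x)); apply: cvgM; first exact: cvg_cst.
  apply: step_approx_cvg0; rewrite arc_gauge_gt ?y0//.
  by have /andP[_ ->] := arc_gauge_itv y x.
- exact: integrable_norm.
- apply: aeW => x n _; rewrite /F lee_fin normrM ler_piMr//.
  have /andP[a0 a1] := step_approx_itv n (arc_gauge_itv y x).
  by rewrite ger0_norm.
move=> _ _; rewrite (_ : (fun n => _) = cst 0%E).
  by move=> /(cvg_lim (@ereal_hausdorff R)); rewrite lim_cst// /Rintegral => <-.
apply/funext => n /=; rewrite -[LHS]fineK.
  by rewrite -/(Rintegral _ _ _) gt0//; exact: trigpoly_step.
apply: integrable_fin_num => //; apply: le_integrable ig => //.
  apply/measurable_EFinP; apply: measurable_funM => //.
  by apply: measurable_funTS; exact: measurable_step.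
move=> x _; rewrite /F lee_fin normrM ler_piMr//.
have /andP[a0 a1] := step_approx_itv n (arc_gauge_itv y x).
by rewrite ger0_norm.
Qed.

(** The integrals over []-oo, y]] of the extension by zero vanish for every [y], and differentiating
    in [y] recovers the function at almost every point. *)
Lemma ae_circle_eq0 (g : R -> R) : mu.-integrable circle (EFin \o g) ->
  (forall t : R -> R, trigpoly (fun x => (t x)%:C%C) ->
    \int[mu]_(x in circle) (g x * t x) = 0) ->
  {ae mu, forall x, circle x -> g x = 0}.
Proof.
move=> ig gt0; have mc := @measurable_circle R.
pose h := g \_ circle.
have F0 y : \int[mu]_(x in `]-oo, y]%classic) h x = 0.
  rewrite -(Rintegral_mkcondr mu `]-oo, y]%classic circle g).
  have [y0|y0] := ltP 0 y; last first.
    have [y0'|] := ltP y 0.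
      rewrite (_ : _ `&` _ = set0) ?Rintegral_set0//.
      apply/seteqP; split => // x [] /=; rewrite /Defs.circle /= !in_itv /= => xy.
      by case/andP=> x0 _; lra.
    move=> y0'; have {y0 y0'}-> : y = 0 by apply/le_anti/andP.
    rewrite (_ : _ `&` _ = [set 0]) ?Rintegral_set1//.
    apply/seteqP; split => [x []|x ->] /=; rewrite /Defs.circle /= !in_itv /=.
      by move=> x0 /andP[x0' _]; apply/le_anti/andP.
    by rewrite !lexx ltW// period_gt0.
  have [yp|py] := ltP y period.
    by rewrite setIC Rintegral_mkcondr; apply: Rintegral_arc_eq0 => //; apply/andP.
  rewrite (_ : _ `&` _ = circle); last first.
    apply/seteqP; split => [x []//|x cx]; split => //.
    move: cx; rewrite /Defs.circle /= !in_itv /= => /andP[_ xp].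
    exact: le_trans xp py.
  rewrite -[RHS](gt0 (cst 1)); last exact: (@trigpoly_cst R 1%:C%C).
  by apply: eq_Rintegral => x _; rewrite mulr1.
have ih : mu.-integrable setT (EFin \o h).
  by rewrite /h -restrict_EFin; apply/integrable_restrict => //; rewrite setTI.
have := @FTC1Ny _ h _ (integrable_locally mc ig).
have ihy y : mu.-integrable `]-oo, y]%classic (EFin \o h).
  exact: integrableS ih.
move=> /(_ ihy); apply: filterS; first exact: (ae_filter_ringOfSetsType mu).
move=> x [_]; rewrite (_ : (fun y => _) = cst 0); last exact/funext.
by rewrite derive1_cst => + cx; rewrite /h patchE mem_set.
Qed.

Lemma lebesgue_measure_shift (c : R) (A : set R) : measurable A ->
  mu [set x | A (x + c)] = mu A.
Proof.
move=> mA; pose f (x : R) : measurableTypeR R := x + c.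
have mf : measurable_fun [set: measurableTypeR R] f.
  apply: measurable_funD; first exact: measurable_id.
  exact: measurable_cst.
rewrite -[LHS]/(pushforward (mu : set (measurableTypeR R) -> _) f A).
apply/esym/lebesgue_measure_unique => //= _ [[x y] /=] _ <-.
rewrite /pushforward (_ : f @^-1` _ = `]x - c, y - c]%classic).
  by rewrite !lebesgue_measure_itv /= !lte_fin ltrD2r -!EFinB opprB addrA subrK.
by apply/seteqP; split=> z /=; rewrite !in_itv /= ltrBlDr lerBrDr.
Qed.

Lemma negligible_shift (N : set R) (c : R) : mu.-negligible N ->
  mu.-negligible [set x | N (x + c)].
Proof.
move=> [A [mA A0 NA]]; exists [set x | A (x + c)]; split.
- rewrite -[X in measurable X]setTI.
  have mf : measurable_fun [set: R] (fun x : R => x + c).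
    apply: measurable_funD; first exact: measurable_id.
    exact: measurable_cst.
  exact: mf.
- by rewrite lebesgue_measure_shift.
- by move=> x; exact: NA.
Qed.

(** The exceptional set is covered by the translates, by integer multiples of the period, of the
    exceptional set of one period; the index [n] is natural, hence the two signs in [M]. *)
Lemma periodic_ae_eq0 (f : R -> C) : periodic f period ->
  {ae mu, forall x, circle x -> f x = 0} -> {ae mu, forall x, f x = 0}.
Proof.
move=> pf; rewrite /almost_everywhere /= => Nf.
pose N := ~` [set x | circle x -> f x = 0].
pose M (n : nat) : set R := [set x | N (x + period *+ n)] `|` [set x | N (x + - (period *+ n))].
have : mu.-negligible (\bigcup_n M n).
  by apply: negligible_bigcup => n; apply: negligibleU; exact: negligible_shift.
apply: negligibleS => x /= fx; have p0 := period_gt0 (R := R).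
have pn (n : nat) y : f (y + period *+ n) = f y by rewrite periodicn.
have [x0|x0] := leP 0 x.
  pose n := Num.truncn (x / period).
  have := truncn_itv (divr_ge0 x0 (ltW p0)); rewrite -/n -natr1.
  rewrite ler_pdivlMr// ltr_pdivrMr// => /andP[n1 n2].
  exists n => //; right; rewrite /N /= => H; apply: fx.
  rewrite -[x](subrK (period *+ n)) pn; apply: H.
  rewrite /Defs.circle /= in_itv /= -mulr_natl; apply/andP; split; lra.
pose n := Num.truncn (- x / period).
have mx0 : 0 <= - x by lra.
have := truncn_itv (divr_ge0 mx0 (ltW p0)); rewrite -/n -natr1.
rewrite ler_pdivlMr// ltr_pdivrMr// => /andP[n1 n2].
exists n.+1 => //; left; rewrite /N /= => H; apply: fx.
rewrite -(pn n.+1); apply: H.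
rewrite /Defs.circle /= in_itv /= -mulr_natl -natr1; apply/andP; split; lra.
Qed.

(** Testing against real-valued polynomials separates the real and imaginary parts of [f]. *)
Theorem fourier_uniqueness (f : R -> C) : sq_integrable f ->
  (forall k, fourier f k = 0) -> {ae mu, forall x, circle x -> f x = 0}.
Proof.
move=> sf f0.
have [ir ii] : cintegrable f.
  have := sq_integrable_cexpi 0 sf; congr cintegrable.
  by apply/funext => x; rewrite cexpi0 mulr1.
have H (t : R -> R) : trigpoly (fun x => (t x)%:C%C) ->
    \int[mu]_(x in circle) (Re (f x) * t x) = 0 /\
    \int[mu]_(x in circle) (Im (f x) * t x) = 0.
  move=> ht; have := cintegral_tpoly_eq0 sf f0 ht; rewrite /cintegral => -[h1 h2].
  split; [rewrite -[RHS]h1|rewrite -[RHS]h2]; apply: eq_Rintegral => x _;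
    by case: (f x) => a b /=; ring.
have := ae_circle_eq0 ir (fun t ht => (H t ht).1).
have := ae_circle_eq0 ii (fun t ht => (H t ht).2).
apply: (@filterS2 _ _ (ae_filter_ringOfSetsType mu)) => x hi hr cx.
by move: (hr cx) (hi cx); case: (f x) => a b /= -> ->.
Qed.

End Uniqueness.

(** * Smooth functions and the Toeplitz gap *)

Section AbsoluteConvergence.
Context {R : realType}.

(** In [f = (f + |f|) - |f|] both families are nonnegative, so both sequences of partial sums are
    monotone and bounded. *)
Lemma cvg_sum_abs (T : eqType) (S : nat -> seq T) (f : T -> R) H :
  (forall n, uniq (S n)) -> (forall m n, (m <= n)%N -> {subset S m <= S n}) ->
  (forall n, \sum_(k <- S n) `|f k| <= H) ->
  cvgn (fun n => \sum_(k <- S n) f k).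
Proof.
move=> uS mS bH.
have cv (g : T -> R) : (forall k, 0 <= g k <= 2 * `|f k|) ->
    cvgn (fun n => \sum_(k <- S n) g k).
  move=> g0; apply: nondecreasing_is_cvgn.
    move=> m n mn; apply: sub_sum_le => //; first exact: mS.
    by move=> k; have /andP[] := g0 k.
  exists (2 * H) => _ [n _ <-].
  apply: (@le_trans _ _ (2 * \sum_(k <- S n) `|f k|)); last by rewrite ler_wpM2l.
  by rewrite big_distrr; apply: ler_sum => k _; have /andP[] := g0 k.
have -> : (fun n => \sum_(k <- S n) f k) =
    (fun n => \sum_(k <- S n) (f k + `|f k|) - \sum_(k <- S n) `|f k|).
  by apply/funext => n; rewrite big_split /= addrK.
apply: is_cvgB; apply: cv => k; have := ler_norm (f k); have := ler_norm (- f k);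
  rewrite normrN => *; apply/andP; split; have := normr_ge0 (f k); lra.
Qed.

Lemma le_sum_lim (T : eqType) (S : nat -> seq T) (f : T -> R) :
  (forall n, uniq (S n)) -> (forall m n, (m <= n)%N -> {subset S m <= S n}) ->
  (forall k, 0 <= f k) -> cvgn (fun n => \sum_(k <- S n) f k) ->
  forall n, \sum_(k <- S n) f k <= limn (fun n => \sum_(k <- S n) f k).
Proof.
move=> uS mS f0 cf n; apply: nondecreasing_cvgn_le => // i j ij.
by apply: sub_sum_le => //; exact: mS.
Qed.

End AbsoluteConvergence.

Section SmoothFunctions.
Context {R : realType}.
Notation C := R[i].
Notation Re := complex.Re.
Notation Im := complex.Im.
Notation cj := (@conjc R).
Notation mu := (@lebesgue_measure R).
Notation circle := (@circle R).
Notation period := (@period R).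
Implicit Types phi : R -> R.

Lemma smooth_has_derive phi : smooth_on_circle phi ->
  has_derive phi (phi^`()%classic).
Proof. by move=> [_ dphi] x; split => //; exact: (dphi 0%N). Qed.

Lemma smooth_derive1 phi : smooth_on_circle phi -> smooth_on_circle (phi^`()%classic).
Proof.
move=> [pphi dphi]; split.
  move=> x; rewrite /derive1; congr (lim _).
  have -> : (fun h : R => h^-1 *: (phi (h + (x + period)) - phi (x + period))) =
    (fun h : R => h^-1 *: (phi (h + x) - phi x)) => //.
  by apply/funext => h; rewrite addrA !pphi.
by move=> n x; have := dphi n.+1 x; rewrite derive1Sn.
Qed.

Lemma smooth_continuous phi : smooth_on_circle phi -> continuous phi.
Proof. by move=> /smooth_has_derive /has_derive_continuous. Qed.

Definition fourierR phi (k : int) : C := fourier (fun x => (phi x)%:C%C) k.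

Lemma fourierR_derive phi k : smooth_on_circle phi ->
  fourierR (phi^`()%classic) k = 'i%C * k%:~R%:C%C * fourierR phi k.
Proof.
move=> sphi; apply: fourier_derive; first by have [] := sphi.
  exact: smooth_has_derive.
exact: smooth_continuous (smooth_derive1 sphi).
Qed.

Lemma fourierR_derive2 phi k : smooth_on_circle phi ->
  fourierR (phi^`(2)%classic) k = - (k%:~R ^+ 2)%:C%C * fourierR phi k.
Proof.
move=> sphi; have -> : phi^`(2)%classic = (phi^`())^`()%classic by [].
rewrite fourierR_derive; last exact: smooth_derive1.
rewrite fourierR_derive// !mulrA; congr (_ * _).
by apply/eqP; rewrite eq_complex /=; apply/andP; split; apply/eqP; ring.
Qed.

Lemma fourierR_bounded phi : continuous phi ->
  exists D, forall k, normc (fourierR phi k) <= D.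
Proof.
move=> cphi; pose I := \int[mu]_(x in circle) `|phi x|.
have mc := @measurable_circle R.
have iphi : mu.-integrable circle (EFin \o phi) by exact: continuous_integrable.
have bnd (f : R -> R) : continuous f -> (forall x, `|f x| <= 1) ->
    `|\int[mu]_(x in circle) (phi x * f x)| <= I.
  move=> cf f1; have ipf : mu.-integrable circle (EFin \o (fun x => phi x * f x)).
    by apply: continuous_integrable => x; apply: cvgM; [exact: cphi|exact: cf].
  apply: le_trans (le_normr_Rintegral _ ipf) _ => //.
  apply: le_Rintegral => //; [exact: integrable_norm|exact: integrable_norm|].
  by move=> x _; rewrite normrM ler_piMr.
exists (period^-1 * (I + I)) => k; rewrite /fourierR /fourier normcM.
have -> : normc (period^-1)%:C%C = period^-1.
  by rewrite /= expr0n addr0 sqrtr_sqr ger0_norm// invr_ge0 ltW// period_gt0.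
apply: ler_wpM2l; first by rewrite invr_ge0 ltW// period_gt0.
have E (z : C) : normc z <= `|Re z| + `|Im z|.
  case: z => p q /=; rewrite -[leRHS]ger0_norm ?addr_ge0// -sqrtr_sqr ler_wsqrtr//.
  rewrite sqrrD !real_normK ?num_real//.
  by rewrite addrAC lerDl mulrn_wge0// mulr_ge0.
apply: le_trans (E _) _; rewrite /cintegral /=; apply: lerD.
  rewrite (_ : Rintegral _ _ _ = \int[mu]_(x in circle) (phi x * cos ((- k)%:~R * x))).
    by apply: bnd => [|x]; [exact: continuous_cosM|exact: cos_max].
  by apply: eq_Rintegral => x _; rewrite mul0r subr0.
rewrite (_ : Rintegral _ _ _ = \int[mu]_(x in circle) (phi x * sin ((- k)%:~R * x))).
  by apply: bnd => [|x]; [exact: continuous_sinM|exact: sin_max].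
by apply: eq_Rintegral => x _; rewrite mul0r addr0.
Qed.

(** Two derivatives multiply the coefficient by [- k^2], so each factor [1 + k^2] is traded for the
    bounds of [phi] and of its second derivative. *)
Lemma fourierR_decay phi (n : nat) : smooth_on_circle phi ->
  exists2 D, 0 <= D & forall k, (1 + k%:~R ^+ 2) ^+ n * normc (fourierR phi k) <= D.
Proof.
elim: n phi => [|n IH] phi sphi.
  have [D hD] := fourierR_bounded (smooth_continuous sphi).
  exists (Num.max 0 D) => [|k]; first by rewrite le_max lexx.
  by rewrite mul1r le_max hD orbT.
have [D D0 hD] := IH phi sphi.
have [D' D0' hD'] := IH _ (smooth_derive1 (smooth_derive1 sphi)).
exists (D + D') => [|k]; first exact: addr_ge0.
apply: le_trans (lerD (hD k) (hD' k)).
rewrite -/(phi^`(2)%classic) fourierR_derive2//.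
have -> (z : C) : normc (- (k%:~R ^+ 2)%:C%C * z) = k%:~R ^+ 2 * normc z.
  by rewrite normcM /= oppr0 expr0n addr0 sqrtr_sqr normrN ger0_norm ?sqr_ge0.
by rewrite le_eqVlt exprS; apply/orP; left; apply/eqP; ring.
Qed.

Lemma fourierR_conj phi k : continuous phi -> fourierR phi (- k) = cj (fourierR phi k).
Proof.
move=> cphi; rewrite /fourierR /fourier conjM conjc_real; congr (_ * _).
have mc := @measurable_circle R.
have ci : mu.-integrable circle (EFin \o (fun x => phi x * sin (k%:~R * x))).
  apply: continuous_integrable => x; apply: cvgM; first exact: cphi.
  exact: continuous_sinM.
rewrite /cintegral opprK /=; congr Complex.
  by apply: eq_Rintegral => x _; rewrite !mul0r !subr0 mulrNz mulNr cosN.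
rewrite -[RHS]mulN1r; under [in RHS]eq_Rintegral => x _.
  rewrite mul0r addr0 mulrNz mulNr sinN mulrN -mulN1r; over.
rewrite RintegralZl// mulrA mulrNN !mul1r.
by apply: eq_Rintegral => x _; rewrite mul0r addr0.
Qed.

End SmoothFunctions.

(** * The spectral gap of a decaying positive semidefinite Toeplitz kernel *)

Section ToeplitzKernel.
Context {R : realType}.
Notation C := R[i].
Notation Re := complex.Re.
Notation cj := (@conjc R).
Variables (h : int -> C) (A : R).
Hypotheses (h0 : h 0 = A%:C%C) (herm : forall k j, h (j - k) = cj (h (k - j))).
Hypothesis psd : forall L : seq (int * C),
  0 <= Re (\sum_(p <- L) \sum_(q <- L) cj p.2 * (h (p.1 - q.1) * q.2)).
Hypothesis A0 : 0 < A.

Lemma toeplitz_three m k (w u : C) :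
  Re (\sum_(p <- [:: (0, 1); (m, w); (k, u)])
    \sum_(q <- [:: (0, 1); (m, w); (k, u)]) cj p.2 * (h (p.1 - q.1) * q.2)) =
  A * (1 + nsq w + nsq u) + 2 * Re (cj w * h m) +
  2 * Re (cj u * (h k + h (k - m) * w)).
Proof.
rewrite !big_cons !big_nil !addr0 ![_.1]/= ![_.2]/= !subrr.
rewrite (herm m 0) (herm k 0) (herm k m) !subr0 h0.
move: (h m) (h k) (h (k - m)) w u => [p1 p2] [q1 q2] [r1 r2] [w1 w2] [u1 u2].
by rewrite /nsq /=; ring.
Qed.

(* Equality |h m| = A makes (1, w) at (0, m) a null vector of a positive
   semidefinite form, hence an element of its kernel. *)
Lemma toeplitz_null m k : A <= normc (h m) -> nsq (h k) = nsq (h (k - m)).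
Proof.
move=> Am.
have n0 : 0 < normc (h m) by rewrite (lt_le_trans A0).
(* [w] has modulus 1 and the phase that makes the cross term equal to [- |h m|]; [u] minimizes the
   form in the remaining coordinate. The form is then at most [- |z|^2 / A], so positivity forces
   [z = 0]. *)
pose w : C := - (h m * (normc (h m))^-1%:C%C).
pose z := h k + h (k - m) * w.
pose u : C := - ((A^-1)%:C%C * z).
have sqR (r : R) : nsq r%:C%C = r ^+ 2 by rewrite /nsq /= expr0n addr0.
have nsqN (c : C) : nsq (- c) = nsq c by case: c => p q; rewrite /nsq /= !sqrrN.
have w1 : nsq w = 1.
  by rewrite nsqN nsqM sqR nsqE -exprMn divff ?expr1n// gt_eqF.
have wm : Re (cj w * h m) = - normc (h m).
  have E (c : C) (r : R) : Re (cj (- (c * r%:C%C)) * c) = - (r * nsq c).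
    by case: c => p q; rewrite /nsq /=; ring.
  by rewrite E nsqE expr2 mulrA mulVf ?mul1r// gt_eqF.
have uz : Re (cj u * z) = - (A^-1 * nsq z).
  by rewrite /u; case: (z) => p q; rewrite /nsq /=; ring.
have nu : nsq u = A^-1 ^+ 2 * nsq z by rewrite nsqN nsqM sqR.
have := psd [:: (0, 1); (m, w); (k, u)].
rewrite toeplitz_three -/z.
rewrite w1 wm uz nu => H.
have zE : A^-1 * nsq z <= 0.
  have E : A * (A^-1 ^+ 2 * nsq z) = A^-1 * nsq z.
    by rewrite expr2 !mulrA divff ?mul1r// gt_eqF.
  by move: H; rewrite mulrDr E; lra.
have /nsq_eq0 : nsq z = 0.
  apply/le_anti; rewrite nsq_ge0 andbT.
  by move: zE; rewrite pmulr_rle0// invr_gt0.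
by move/eqP; rewrite addr_eq0 => /eqP ->; rewrite nsqN nsqM w1 mulr1.
Qed.

Hypothesis decay : exists D, forall k, (1 + k%:~R ^+ 2) * normc (h k) <= D.

(** Equality at [m] propagates through [toeplitz_null] to every multiple of [m], where decay forbids
    it. *)
Lemma toeplitz_strict m : m != 0 -> normc (h m) < A.
Proof.
move=> m0; rewrite ltNge; apply/negP => Am.
have nn (c : C) : 0 <= normc c by case: c => *; exact: sqrtr_ge0.
have E n : normc (h (m * Posz n)) = A.
  elim: n => [|n IH].
    by rewrite mulr0 h0 /= expr0n addr0 sqrtr_sqr ger0_norm// ltW.
  have := toeplitz_null (m * Posz n.+1) Am.
  have -> : m * Posz n.+1 - m = m * Posz n by lia.
  rewrite !nsqE => /eqP; rewrite -IH eqrXn2// => /eqP //.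
have [D hD] := decay.
have := truncnS_gt (D / A); set n := (_.+1)%N; rewrite ltr_pdivrMr// => nD.
have := hD (m * Posz n); rewrite E leNgt => /negP; apply.
apply: lt_le_trans nD _; rewrite ler_wpM2r ?(ltW A0)//.
have n2 : (n%:R : R) <= n%:R ^+ 2.
  by rewrite expr2 ler_peMr// ler1n.
apply: le_trans n2 _; rewrite intrM exprMn.
have m1 : 1 <= (m%:~R : R) ^+ 2.
  by rewrite -rmorphXn /= (ler_int R 1); nia.
have : 0 <= (n%:R : R) ^+ 2 by exact: sqr_ge0.
by rewrite -[(Posz n)%:~R]/(n%:R : R); nra.
Qed.

Lemma toeplitz_gap : exists2 delta, 0 < delta &
  forall m, m != 0 -> normc (h m) <= A - delta.
Proof.
have nn (c : C) : 0 <= normc c by case: c => *; exact: sqrtr_ge0.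
have [D hD] := decay.
have fin n : exists2 delta, 0 < delta &
    forall m, m \in zrange n -> m != 0 -> normc (h m) <= A - delta.
  elim: n => [|n [d d0 hd]].
    by exists 1 => // m; rewrite inE => ->.
  have p0 : Posz n.+1 != 0 by [].
  have q0 : - Posz n.+1 != 0 by [].
  exists (Num.min d (Num.min (A - normc (h (Posz n.+1))) (A - normc (h (- Posz n.+1))))).
    by rewrite !lt_min d0 !subr_gt0 !toeplitz_strict.
  move=> m; rewrite /= !inE => mP m0; rewrite lerBrDr addrC -lerBrDr !ge_min.
  case/or3P: mP => [/eqP ->|/eqP ->|mn]; rewrite ?lexx ?orbT//.
  by have := hd m mn m0; rewrite lerBrDr addrC -lerBrDr => ->.
(* Beyond this window decay gives [normc (h m) <= A / 2]; inside it finitely many strict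
   inequalities have a common margin. *)
pose n := (Num.truncn (2 * D / A)).+1.
have [d d0 hd] := fin n.
exists (Num.min d (A / 2)) => [|m m0]; first by rewrite lt_min d0 divr_gt0.
have [mn|mn] := boolP (m \in zrange n).
  by apply: le_trans (hd m mn m0) _; rewrite lerB// ge_min lexx.
have nD : 2 * D / A < n%:R := truncnS_gt _; rewrite ltr_pdivrMr// in nD.
apply: (@le_trans _ _ (A / 2)); last first.
  have : Num.min d (A / 2) <= A / 2 by rewrite ge_min lexx orbT.
  lra.
have hn : (n%:R : R) <= 1 + m%:~R ^+ 2.
  rewrite -rmorphXn /= -[1]/(1%:~R) -intrD -[n%:R]/((Posz n)%:~R) ler_int.
  by move: mn; rewrite mem_zrange; nia.
have nA : 0 < (n%:R : R) by rewrite ltr0n.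
rewrite -(ler_pM2l nA).
have := hD m; have := ler_wpM2r (nn (h m)) hn; lra.
Qed.

End ToeplitzKernel.

Section ToeplitzForm.
Context {R : realType}.
Notation C := R[i].
Notation Re := complex.Re.
Notation cj := (@conjc R).
Notation mu := (@lebesgue_measure R).
Notation circle := (@circle R).
Notation period := (@period R).
Variables (a : R -> R).
Hypotheses (sa : smooth_on_circle a) (a_ge0 : forall x, 0 <= a x).
Notation ah := (fourierR a).

Let ca : continuous a := smooth_continuous sa.

Lemma cintegrable_real (phi : R -> R) k : continuous phi ->
  cintegrable (fun x => (phi x)%:C%C * cexpi k x).
Proof.
move=> cphi; split.
  rewrite (_ : _ \o _ = EFin \o (fun x => phi x * cos (k%:~R * x))).
    apply: continuous_integrable => x; apply: cvgM; first exact: cphi.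
    exact: continuous_cosM.
  by apply/funext => x /=; rewrite mul0r subr0.
rewrite (_ : _ \o _ = EFin \o (fun x => phi x * sin (k%:~R * x))).
  apply: continuous_integrable => x; apply: cvgM; first exact: cphi.
  exact: continuous_sinM.
by apply/funext => x /=; rewrite mul0r addr0.
Qed.

(* Points of the list may repeat. *)
Lemma toeplitz_ge0 (L : seq (int * C)) :
  0 <= Re (\sum_(p <- L) \sum_(q <- L) cj p.2 * (ah (p.1 - q.1) * q.2)).
Proof.
pose g (r : (int * C) * (int * C)) (x : R) := (a x)%:C%C * cexpi (r.2.1 - r.1.1) x.
pose LL := [seq (p, q) | p <- L, q <- L].
have ig r : cintegrable (g r) by exact: cintegrable_real.
have [_ E] := cintegral_sum LL (fun r => cj r.1.2 * r.2.2) ig.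
have -> : \sum_(p <- L) \sum_(q <- L) cj p.2 * (ah (p.1 - q.1) * q.2) =
    period^-1%:C%C * \sum_(r <- LL) cj r.1.2 * r.2.2 * cintegral (g r).
  rewrite big_distrr big_allpairs_dep; apply: eq_bigr => p _; apply: eq_bigr => q _ /=.
  by rewrite /fourierR /fourier opprB; ring.
rewrite -E Re_realM mulr_ge0 ?invr_ge0 ?(ltW period_gt0)//.
apply: Rintegral_ge0 => x _.
rewrite (_ : \sum_(r <- LL) _ = (a x)%:C%C *
    (cj (tpoly L x) * tpoly L x)).
  by rewrite Re_realM Re_conjM mulr_ge0 ?nsq_ge0.
rewrite /tpoly conj_sum big_distrl big_distrr big_allpairs_dep.
apply: eq_bigr => p _ /=; rewrite [RHS]mulrA big_distrr; apply: eq_bigr => q _ /=.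
by rewrite conjM -cexpiN /g /= addrC cexpiD; ring.
Qed.

Lemma toeplitz_quad_ge0 (F : seq int) (x : int -> C) :
  0 <= quad F (fun k j => ah (k - j)) x.
Proof.
have := toeplitz_ge0 [seq (k, x k) | k <- F]; rewrite big_map.
rewrite /quad /dot; congr (_ <= Re _); apply: eq_bigr => k _.
by rewrite big_map big_distrr.
Qed.

Lemma fourier_herm k j : ah (j - k) = cj (ah (k - j)).
Proof. by rewrite -fourierR_conj// opprB. Qed.

Definition amean : R := Re (ah 0).

Lemma ah0E : ah 0 = amean%:C%C.
Proof.
have := fourierR_conj 0 ca; rewrite oppr0 /amean; case: (ah 0) => p q [qq].
by apply/eqP; rewrite eq_complex /= eqxx /=; apply/eqP; lra.
Qed.

(** A zero mean would make [a] vanish almost everywhere on one period, hence on the line, against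
    its positivity on a ball around [x0]. *)
Lemma amean_gt0 x0 : 0 < a x0 -> 0 < amean.
Proof.
move=> ax0; have mc := @measurable_circle R.
have ia : mu.-integrable circle (EFin \o a) by exact: continuous_integrable.
have aE : amean = period^-1 * \int[mu]_(x in circle) a x.
  rewrite /amean /fourierR /fourier Re_realM; congr (_ * _).
  by apply: eq_Rintegral => x _; rewrite oppr0 cexpi0 mulr1.
have I0 : 0 <= \int[mu]_(x in circle) a x by apply: Rintegral_ge0.
have p0 := @period_gt0 R.
rewrite aE mulr_gt0 ?invr_gt0// lt_def I0 andbT; apply/eqP => I_0.
have : ae_eq mu circle (EFin \o a) (cst 0%E).
  apply/ae_eq_integral_abs => //; first by case/integrableP: ia.
  under eq_integral => x _ do rewrite /= ger0_norm//.
  by rewrite -[LHS]fineK ?integrable_fin_num//; rewrite -/(Rintegral _ _ _) I_0.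
move=> a0.
have [pa _] := sa.
have : {ae mu, forall x, (a x)%:C%C = 0 :> C}.
  apply: periodic_ae_eq0 => [x|]; first by rewrite pa.
  apply: (@filterS _ _ (ae_filter_ringOfSetsType mu) _ _ _ a0).
  by move=> x + cx => /(_ cx) [->].
case=> N [mN N0 sN].
have na : nbhs x0 [set t | 0 < a t] by exact: cvgr_gt (a x0) (@ca x0) _ ax0.
move/nbhs_ballP: na => [e /= e0 be].
have : (mu (ball x0 e) <= mu N)%E.
  apply: le_measure; rewrite ?inE//; first exact: measurable_ball.
  move=> x /be /= ax; apply: sN => /= -[ax_0].
  by rewrite ax_0 ltxx in ax.
by rewrite lebesgue_measure_ball ?(ltW e0)// N0 lee_fin leNgt mulrn_wgt0.
Qed.

End ToeplitzForm.

(** * Fourier series of smooth functions *)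

Section ComplexLimits.
Context {R : realType}.
Notation C := R[i].
Notation Re := complex.Re.
Notation Im := complex.Im.
Notation mu := (@lebesgue_measure R).
Notation circle := (@circle R).

Definition ccvg (u : nat -> C) (l : C) :=
  (Re (u n) @[n --> \oo] --> Re l) /\ (Im (u n) @[n --> \oo] --> Im l).

Lemma ccvg_unique u l l' : ccvg u l -> ccvg u l' -> l = l'.
Proof.
move=> [r i] [r' i']; apply/eqP; rewrite eq_complex.
by rewrite (cvg_unique _ r r') ?(cvg_unique _ i i') ?eqxx.
Qed.

Lemma ccvgZ (c : C) u l : ccvg u l -> ccvg (fun n => c * u n) (c * l).
Proof.
move=> [r i]; have E (z : C) : c * z =
    Complex (Re c * Re z - Im c * Im z) (Re c * Im z + Im c * Re z).
  by case: c z => [? ?] [? ?].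
by split; under eq_fun do rewrite E; rewrite E /=;
  [apply: cvgB|apply: cvgD]; apply: cvgM => //; exact: cvg_cst.
Qed.

Lemma ccvg_near u l : (\forall n \near \oo, u n = l) -> ccvg u l.
Proof.
by move=> ul; split; apply: cvg_near_cst; apply: filterS ul => n ->.
Qed.

Lemma Rintegral_dominated (g : R -> R) (t : nat -> R -> R) (s : R -> R) (H : R) :
  mu.-integrable circle (EFin \o g) ->
  (forall n, measurable_fun setT (t n)) ->
  (forall n x, `|t n x| <= H) ->
  (forall x, t n x @[n --> \oo] --> s x) ->
  mu.-integrable circle (EFin \o (fun x => g x * s x)) /\
  \int[mu]_(x in circle) (g x * t n x) @[n --> \oo] -->
    \int[mu]_(x in circle) (g x * s x).
Proof.
move=> ig mt tH ts; have mc := @measurable_circle R.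
have mg : measurable_fun circle g by case/integrableP: ig => /measurable_EFinP.
have ms : measurable_fun setT s.
  by apply: (measurable_fun_cvg (h := t)) => // x _; exact: ts.
have H0 : 0 <= H by apply: le_trans (tH 0%N 0).
have igH : mu.-integrable circle (fun x => (H * `|g x|)%:E).
  have IZ (r : R) (h : R -> R) : mu.-integrable circle (EFin \o h) ->
    mu.-integrable circle (EFin \o (fun x => r * h x)) by exact: integrableZl.
  by apply: (IZ H (fun x => `|g x|)); exact: integrable_norm.
have igt n : mu.-integrable circle (EFin \o (fun x => g x * t n x)).
  apply: le_integrable igH => //.
    apply/measurable_EFinP; apply: measurable_funM; [exact: mg|exact: measurable_funTS (mt n)].
  move=> x _ /=; rewrite lee_fin normrM mulrC [leRHS]ger0_norm ?mulr_ge0//.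
  by rewrite ler_wpM2r ?tH.
have [] := @dominated_convergence _ _ _ mu circle mc
  (fun n => EFin \o (fun x => g x * t n x)) (EFin \o (fun x => g x * s x))
  (fun x => (H * `|g x|)%:E).
- by move=> n; case/integrableP: (igt n).
- apply/measurable_EFinP; apply: measurable_funM; [exact: mg|exact: measurable_funTS ms].
- apply: aeW => x _; apply: cvg_EFin; first by apply: nearW.
  by apply: cvgM; [exact: cvg_cst|exact: ts].
- exact: igH.
- apply: aeW => x n _ /=; rewrite lee_fin normrM mulrC.
  by rewrite ler_wpM2r ?tH.
move=> igs _ cv; split => //.
apply: fine_cvg; rewrite fineK; first exact: cv.
exact: integrable_fin_num.
Qed.

Lemma cintegral_dominated (g : R -> C) (t : nat -> R -> C) (s : R -> C) (H : R) :
  cintegrable g ->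
  (forall n, measurable_fun setT (fun x => Re (t n x))) ->
  (forall n, measurable_fun setT (fun x => Im (t n x))) ->
  (forall n x, normc (t n x) <= H) -> (forall x, ccvg (t^~ x) (s x)) ->
  ccvg (fun n => cintegral (fun x => g x * t n x)) (cintegral (fun x => g x * s x)).
Proof.
move=> [ir ii] mr mi bH ts; have mc := @measurable_circle R.
have nr n x : `|Re (t n x)| <= H.
  apply: le_trans (bH n x); case: (t n x) => p q /=.
  by rewrite -sqrtr_sqr ler_wsqrtr// lerDl sqr_ge0.
have ni n x : `|Im (t n x)| <= H.
  apply: le_trans (bH n x); case: (t n x) => p q /=.
  by rewrite -sqrtr_sqr ler_wsqrtr// lerDr sqr_ge0.
have cr x := (ts x).1; have ci x := (ts x).2.
have [irr crr] := Rintegral_dominated ir mr nr cr.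
have [iri cri] := Rintegral_dominated ir mi ni ci.
have [iir cir] := Rintegral_dominated ii mr nr cr.
have [iii cii] := Rintegral_dominated ii mi ni ci.
(* A constant sequence turns dominated convergence into integrability of a product with a bounded
   factor. *)
have cst_t (f : R -> R) (q : R -> R) : mu.-integrable circle (EFin \o f) ->
    measurable_fun setT q -> (forall x, `|q x| <= H) ->
    mu.-integrable circle (EFin \o (fun x => f x * q x)).
  by move=> if_ mq bq; apply: (Rintegral_dominated if_ (t := fun=> q) _ _ _).1 => // x;
    exact: cvg_cst.
split.
  have E (w : R -> C) : mu.-integrable circle (EFin \o (fun x => Re (g x) * Re (w x))) ->
      mu.-integrable circle (EFin \o (fun x => Im (g x) * Im (w x))) ->
      Re (cintegral (fun x => g x * w x)) =
      \int[mu]_(x in circle) (Re (g x) * Re (w x)) - \int[mu]_(x in circle) (Im (g x) * Im (w x)).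
    move=> i1 i2; rewrite -RintegralB//; apply: eq_Rintegral => x _.
    by case: (g x) (w x) => [? ?] [? ?].
  rewrite E//; under eq_fun => n do rewrite E ?cst_t//.
  exact: cvgB.
have E (w : R -> C) : mu.-integrable circle (EFin \o (fun x => Re (g x) * Im (w x))) ->
    mu.-integrable circle (EFin \o (fun x => Im (g x) * Re (w x))) ->
    Im (cintegral (fun x => g x * w x)) =
    \int[mu]_(x in circle) (Re (g x) * Im (w x)) + \int[mu]_(x in circle) (Im (g x) * Re (w x)).
  move=> i1 i2; rewrite -RintegralD//; apply: eq_Rintegral => x _.
  by case: (g x) (w x) => [? ?] [? ?].
rewrite E//; under eq_fun => n do rewrite E ?cst_t//.
exact: cvgD.
Qed.

End ComplexLimits.

(** * The Fourier series of a smooth function and the product formula *)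

Section FourierSeries.
Context {R : realType}.
Notation C := R[i].
Notation Re := complex.Re.
Notation Im := complex.Im.
Notation mu := (@lebesgue_measure R).
Notation circle := (@circle R).
Notation period := (@period R).
Variables (a : R -> R).
Hypothesis sa : smooth_on_circle a.
Notation ah := (fourierR a).

Lemma normc_ge0 (z : C) : 0 <= normc z.
Proof. by case: z => *; exact: sqrtr_ge0. Qed.

Lemma normRe_le (z : C) : `|Re z| <= normc z.
Proof. by case: z => p q /=; rewrite -sqrtr_sqr ler_wsqrtr// lerDl sqr_ge0. Qed.

Lemma normIm_le (z : C) : `|Im z| <= normc z.
Proof. by case: z => p q /=; rewrite -sqrtr_sqr ler_wsqrtr// lerDr sqr_ge0. Qed.

Lemma normc_sum_le (I : Type) (r : seq I) (f : I -> C) :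
  normc (\sum_(i <- r) f i) <= \sum_(i <- r) normc (f i).
Proof.
elim: r => [|i r IH]; first by rewrite !big_nil [normc _]normc0.
by rewrite !big_cons; apply: le_trans (le_normcD _ _) _; rewrite lerD2l.
Qed.

Lemma normc_cexpi k (x : R) : normc (cexpi k x) = 1.
Proof. by rewrite /= cos2Dsin2 sqrtr1. Qed.

(** One of the factors [1 + k^2] is sacrificed to the convergent sum of its inverses. *)
Lemma decay_bsum (f : int -> R) (n : nat) D :
  (forall k, 0 <= f k) -> (forall k, (1 + k%:~R ^+ 2) ^+ n.+1 * f k <= D) ->
  bsum (fun k => (1 + k%:~R ^+ 2) ^+ n * f k) (5 * D).
Proof.
move=> f0 hD F uF.
have k0 k : 0 < 1 + (k%:~R : R) ^+ 2 by rewrite ltr_wpDr ?sqr_ge0.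
have D0 : 0 <= D by apply: le_trans (hD 0); rewrite mulr_ge0// exprn_ge0// ltW.
apply: (@le_trans _ _ (\sum_(k <- F) (1 + (k%:~R : R) ^+ 2)^-1 * D)).
  apply: ler_sum => k _; rewrite ler_pdivlMl//.
  by rewrite mulrA -exprS.
by rewrite -big_distrl /=; apply: ler_wpM2r => //; exact: bsum_inv_sqr.
Qed.

Lemma ah_bsum (n : nat) : exists2 H, 0 <= H &
  bsum (fun k => (1 + k%:~R ^+ 2) ^+ n * normc (ah k)) H.
Proof.
have [D D0 hD] := fourierR_decay n.+1 sa.
exists (5 * D); first by rewrite mulr_ge0.
by apply: decay_bsum => // k; exact: normc_ge0.
Qed.

Definition psum (m : nat) (x : R) : C := \sum_(i <- zrange m) ah i * cexpi i x.

(** The sum of the series is first a function of its own; uniqueness of Fourier coefficients then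
    identifies it with [a] almost everywhere, which is all that integrals see. *)
Definition fseries (x : R) : C :=
  Complex (limn (fun m => Re (psum m x))) (limn (fun m => Im (psum m x))).

Lemma psum_cvg x : ccvg (psum^~ x) (fseries x).
Proof.
have [H H0 hH] := ah_bsum 0.
have S1 := @zrange_uniq; have S2 := zrange_sub.
split; rewrite /fseries /=.
  under eq_fun do rewrite /psum Re_sum.
  apply: (cvg_sum_abs (H := H)) => // n.
  apply: le_trans (hH _ (zrange_uniq n)); apply: ler_sum => k _.
  by rewrite mul1r; apply: le_trans (normRe_le _) _; rewrite normcM normc_cexpi mulr1.
have Im_sum (s : seq int) (f : int -> C) : Im (\sum_(i <- s) f i) = \sum_(i <- s) Im (f i).
  by apply: big_morph => // -[? ?] [? ?].
under eq_fun do rewrite /psum Im_sum.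
apply: (cvg_sum_abs (H := H)) => // n.
apply: le_trans (hH _ (zrange_uniq n)); apply: ler_sum => k _.
by rewrite mul1r; apply: le_trans (normIm_le _) _; rewrite normcM normc_cexpi mulr1.
Qed.

Lemma psum_bounded : exists H, forall m x, normc (psum m x) <= H.
Proof.
have [H H0 hH] := ah_bsum 0; exists H => m x.
apply: le_trans (normc_sum_le _ _) _; apply: le_trans (hH _ (zrange_uniq m)).
by apply: ler_sum => k _; rewrite mul1r normcM normc_cexpi mulr1.
Qed.

Lemma continuous_cexpi k : continuous (fun x : R => Re (cexpi k x)) /\
  continuous (fun x : R => Im (cexpi k x)).
Proof. by split; [exact: continuous_cosM|exact: continuous_sinM]. Qed.

Lemma measurable_tpoly (s : seq (int * C)) :
  measurable_fun setT (fun x => Re (tpoly s x)) /\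
  measurable_fun setT (fun x => Im (tpoly s x)).
Proof.
elim: s => [|[k c] s [IH1 IH2]].
  by split; rewrite (_ : (fun x => _) = cst 0);
    [exact: measurable_cst|apply/funext => x; rewrite /tpoly big_nil|
     exact: measurable_cst|apply/funext => x; rewrite /tpoly big_nil].
have [cc cs] := continuous_cexpi k.
have mc := continuous_measurable_fun cc; have ms := continuous_measurable_fun cs.
have E x : tpoly ((k, c) :: s) x = Complex
    (Re c * Re (cexpi k x) - Im c * Im (cexpi k x) + Re (tpoly s x))
    (Re c * Im (cexpi k x) + Im c * Re (cexpi k x) + Im (tpoly s x)).
  rewrite {1}/tpoly big_cons -/(tpoly s x) [(_, _).1]/= [(_, _).2]/=.
  by case: c (cexpi k x) (tpoly s x) => [? ?] [? ?] [? ?].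
have cM (r : R) (f : R -> R) : measurable_fun setT f -> measurable_fun setT (fun x => r * f x).
  by move=> mf; apply: measurable_funM => //; exact: measurable_cst.
split; under eq_fun do rewrite E /=; apply: measurable_funD => //;
  [apply: measurable_funB|apply: measurable_funD]; exact: cM.
Qed.

Lemma psumE m : psum m = tpoly [seq (k, ah k) | k <- zrange m].
Proof. by apply/funext => x; rewrite /psum /tpoly big_map. Qed.

Lemma measurable_fseries : measurable_fun setT (fun x => Re (fseries x)) /\
  measurable_fun setT (fun x => Im (fseries x)).
Proof.
split.
  apply: (measurable_fun_cvg (h := fun m x => Re (psum m x))) => [m|x _].
    by rewrite psumE; exact: (measurable_tpoly _).1.
  exact: (psum_cvg x).1.
apply: (measurable_fun_cvg (h := fun m x => Im (psum m x))) => [m|x _].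
  by rewrite psumE; exact: (measurable_tpoly _).2.
exact: (psum_cvg x).2.
Qed.

Lemma bounded_sq_integrable (f : R -> C) (H : R) :
  measurable_fun setT (fun x => Re (f x)) -> measurable_fun setT (fun x => Im (f x)) ->
  (forall x, `|Re (f x)| <= H) -> (forall x, `|Im (f x)| <= H) -> sq_integrable f.
Proof.
move=> mr mi hr hi; split => //; have mc := @measurable_circle R.
apply: (@le_lt_trans _ _ (\int[mu]_(x in circle) (cst (2 * H ^+ 2)%:E x))%E).
  apply: ge0_le_integral => //.
  - by move=> x _; rewrite lee_fin sqr_ge0.
  - apply/measurable_EFinP; apply: measurable_funTS.
    under eq_fun do rewrite normc_sqE.
    by apply: measurable_funD; apply: measurable_funX.
  - move=> x _; rewrite lee_fin normc_sqE -(real_normK (num_real (Re _))).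
    rewrite -(real_normK (num_real (Im _))).
    have := hr x; have := hi x; have := normr_ge0 (Re (f x)); have := normr_ge0 (Im (f x)).
    by rewrite !expr2; nra.
rewrite integral_cst//; apply: lte_mul_pinfty => //.
  by rewrite lee_fin mulr_ge0 ?sqr_ge0.
exact: mu_circle_fin.
Qed.

Lemma sq_integrable_fseries : sq_integrable fseries.
Proof.
have [H bH] := psum_bounded; have [mr mi] := measurable_fseries.
have lim_le (u : nat -> R) (l : R) : (u n @[n --> \oo] --> l) ->
    (forall n, `|u n| <= H) -> `|l| <= H.
  move=> ul uH; have nl : `|u n| @[n --> \oo] --> `|l| by exact: cvg_norm.
  by apply: (cvgr_to_le nl); apply: nearW.
apply: (@bounded_sq_integrable _ H) => // x.
  apply: lim_le (psum_cvg x).1 _ => n; exact: le_trans (normRe_le _) (bH n x).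
apply: lim_le (psum_cvg x).2 _ => n; exact: le_trans (normIm_le _) (bH n x).
Qed.

Lemma continuous_real_sq_integrable (phi : R -> R) : continuous phi ->
  periodic phi period -> sq_integrable (fun x => (phi x)%:C%C).
Proof.
move=> cphi pphi.
split; [exact: continuous_measurable_fun|exact: measurable_cst|].
under eq_integral => x _ do rewrite normc_sqE /= expr0n addr0.
have : mu.-integrable circle (EFin \o (fun x => phi x ^+ 2)).
  by apply: continuous_integrable => x; apply: cvgM; exact: cphi.
move=> /integrableP[_]; apply: le_lt_trans.
by rewrite le_eqVlt; apply/orP; left; apply/eqP; apply: eq_integral => x _ /=;
  rewrite ger0_norm// sqr_ge0.
Qed.

Lemma fourier_psum m k : (`|k| <= m)%N -> cintegral (fun x => cexpi (- k) x * psum m x) =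
  period%:C%C * ah k.
Proof.
move=> km.
rewrite (_ : (fun x => _) = (fun x => \sum_(i <- zrange m) ah i * cexpi (i - k) x)); last first.
  apply/funext => x; rewrite /psum big_distrr; apply: eq_bigr => i _ /=.
  by rewrite cexpiD; ring.
have ci i : cintegrable (fun x : R => cexpi (i - k) x).
  have := @cintegrable_real R (cst 1) (i - k) ltac:(by move=> ?; exact: cvg_cst).
  by congr cintegrable; apply/funext => x; rewrite mul1r.
rewrite (cintegral_sum _ ah ci).2 (bigD1_seq k) ?zrange_uniq ?mem_zrange//=.
rewrite cintegral_cexpi subrr eqxx big1 ?addr0; first by rewrite mulrC.
by move=> i ik; rewrite cintegral_cexpi subr_eq0 (negbTE ik) mulr0.
Qed.

Lemma fourier_fseries k : fourier fseries k = ah k.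
Proof.
have [H bH] := psum_bounded.
have ci : cintegrable (fun x : R => cexpi (- k) x).
  have := @cintegrable_real R (cst 1) (- k) ltac:(by move=> ?; exact: cvg_cst).
  by congr cintegrable; apply/funext => x; rewrite mul1r.
have cv : ccvg (fun m => cintegral (fun x => cexpi (- k) x * psum m x))
    (cintegral (fun x => cexpi (- k) x * fseries x)).
  apply: (cintegral_dominated (H := H)) => // [n|n|x].
  - by rewrite psumE; exact: (measurable_tpoly _).1.
  - by rewrite psumE; exact: (measurable_tpoly _).2.
  - exact: psum_cvg.
have cv' : ccvg (fun m => cintegral (fun x => cexpi (- k) x * psum m x))
    (period%:C%C * ah k).
  by apply: ccvg_near; near=> m; apply: fourier_psum; near: m; exact: nbhs_infty_ge.
rewrite /fourier (_ : (fun x => _) = (fun x => cexpi (- k) x * fseries x)); last first.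
  by apply/funext => x; rewrite mulrC.
rewrite (ccvg_unique cv cv') mulrA -rmorphM /= mulVf ?mul1r//.
by rewrite gt_eqF// period_gt0.
Unshelve. all: by end_near. Qed.

Lemma ae_fseries : {ae mu, forall x, circle x -> (a x)%:C%C = fseries x}.
Proof.
have ca := smooth_continuous sa.
have sqa := continuous_real_sq_integrable ca sa.1.
have sqd := sq_integrable_linear (-1) sq_integrable_fseries sqa.
have := fourier_uniqueness sqd; case=> [k|].
  rewrite fourier_linear//; last exact: sq_integrable_fseries.
  by rewrite fourier_fseries mulN1r addNr.
move=> N [mN N0 sN]; exists N; split => //; apply: subset_trans sN.
apply: subsetC => x /= H cx; have := H cx; rewrite !fctE.
by rewrite scaleN1r addrC => /eqP; rewrite subr_eq0 => /eqP.
Qed.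

Lemma cintegral_ae (f g : R -> C) :
  measurable_fun setT (fun x => Re (f x)) -> measurable_fun setT (fun x => Im (f x)) ->
  measurable_fun setT (fun x => Re (g x)) -> measurable_fun setT (fun x => Im (g x)) ->
  {ae mu, forall x, circle x -> f x = g x} -> cintegral f = cintegral g.
Proof.
move=> fr fi gr gi fg; have mc := @measurable_circle R.
have mE (h : R -> R) : measurable_fun setT h -> measurable_fun circle (EFin \o h).
  by move=> mh; apply/measurable_EFinP; exact: measurable_funTS.
congr Complex; congr fine; apply: ae_eq_integral => //;
  try exact: (mE (fun x => Re (f x))); try exact: (mE (fun x => Re (g x)));
  try exact: (mE (fun x => Im (f x))); try exact: (mE (fun x => Im (g x)));
  by apply: (@filterS _ _ (ae_filter_ringOfSetsType mu) _ _ _ fg) => x + cx => /(_ cx) ->.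
Qed.

Lemma measurable_cmul (f g : R -> C) :
  measurable_fun setT (fun x => Re (f x)) -> measurable_fun setT (fun x => Im (f x)) ->
  measurable_fun setT (fun x => Re (g x)) -> measurable_fun setT (fun x => Im (g x)) ->
  measurable_fun setT (fun x => Re (f x * g x)) /\
  measurable_fun setT (fun x => Im (f x * g x)).
Proof.
move=> fr fi gr gi.
have E x : f x * g x = Complex (Re (f x) * Re (g x) - Im (f x) * Im (g x))
   (Re (f x) * Im (g x) + Im (f x) * Re (g x)).
  by case: (f x) (g x) => [? ?] [? ?].
by split; under eq_fun do rewrite E /=; [apply: measurable_funB|apply: measurable_funD];
  apply: measurable_funM.
Qed.

(** The coefficients of [a] are summable, so its partial sums are uniformly bounded, and dominated
    convergence gives the convolution formula as a limit over the frequencies of [a]. *)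
Theorem fourier_mul (f : R -> C) k : sq_integrable f ->
  ccvg (fun m => \sum_(i <- zrange m) ah i * fourier f (k - i))
       (fourier (fun x => (a x)%:C%C * f x) k).
Proof.
move=> sf; have [H bH] := psum_bounded.
have cv : ccvg (fun m => cintegral (fun x => f x * cexpi (- k) x * psum m x))
    (cintegral (fun x => f x * cexpi (- k) x * fseries x)).
  apply: (cintegral_dominated (H := H)) => // [|n|n|x].
  - exact: sq_integrable_cexpi.
  - by rewrite psumE; exact: (measurable_tpoly _).1.
  - by rewrite psumE; exact: (measurable_tpoly _).2.
  - exact: psum_cvg.
have [fr fi _] := sf.
have [ck sk] := continuous_cexpi (- k).
have [er ei] := measurable_cmul fr fi (continuous_measurable_fun ck)
  (continuous_measurable_fun sk).
have [Sr Si] := measurable_fseries.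
have [ar ai _] := continuous_real_sq_integrable (smooth_continuous sa) sa.1.
have E : cintegral (fun x => f x * cexpi (- k) x * fseries x) =
    cintegral (fun x => (a x)%:C%C * f x * cexpi (- k) x).
  rewrite (_ : (fun x => (a x)%:C%C * f x * cexpi (- k) x) =
    (fun x => f x * cexpi (- k) x * (a x)%:C%C)); last by apply/funext => x; ring.
  have [r1 i1] := measurable_cmul er ei Sr Si.
  have [r2 i2] := measurable_cmul er ei ar ai.
  apply: cintegral_ae => //.
  by apply: (@filterS _ _ (ae_filter_ringOfSetsType mu) _ _ _ ae_fseries) => x + cx => /(_ cx) ->.
rewrite /fourier -E.
have := ccvgZ (period^-1)%:C%C cv; congr ccvg; apply/funext => m.
rewrite (_ : (fun x => _) = (fun x => \sum_(i <- zrange m) ah i * (f x * cexpi (i - k) x))).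
  rewrite (cintegral_sum _ ah (fun i => sq_integrable_cexpi (i - k) sf)).2.
  rewrite big_distrr; apply: eq_bigr => i _ /=.
  by rewrite opprB mulrCA.
apply/funext => x; rewrite /psum big_distrr; apply: eq_bigr => i _ /=.
by rewrite cexpiD; ring.
Qed.

End FourierSeries.

(** * Sobolev spaces and the generator on Fourier coefficients *)

Section SumsOverIntegers.
Context {R : realType}.
Variables (f : int -> R).
Hypothesis f0 : forall k, 0 <= f k.

Lemma esum_le_bsum (H : R) : bsum f H ->
  (\esum_(k in [set: int]) (f k)%:E <= H%:E)%E.
Proof.
move=> fH; apply: ge_ereal_sup => _ [F [finF _] <-].
have /finite_seqP[s Fs] := finF.
rewrite Fs (_ : [set` s] = [set` undup s]); last first.
  by apply/seteqP; split => x /=; rewrite mem_undup.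
rewrite -fsbig_seq ?undup_uniq// sumEFin lee_fin; apply: fH.
exact: undup_uniq.
Qed.

Lemma bsum_esum : (\esum_(k in [set: int]) (f k)%:E < +oo)%E ->
  bsum f (fine (\esum_(k in [set: int]) (f k)%:E)).
Proof.
move=> foo F uF; rewrite -lee_fin fineK; last first.
  by rewrite ge0_fin_numE// esum_ge0// => k _; rewrite lee_fin.
apply: ereal_sup_ubound; exists [set` F]; first by split => //; exact: finite_seq.
by rewrite -fsbig_seq// sumEFin.
Qed.

Lemma cvg_zrange_esum : (\esum_(k in [set: int]) (f k)%:E < +oo)%E ->
  (\sum_(k <- zrange n) f k) @[n --> \oo] --> fine (\esum_(k in [set: int]) (f k)%:E).
Proof.
move=> foo; set E := fine _; have fE := bsum_esum foo.
have cv : cvgn (fun n => \sum_(k <- zrange n) f k).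
  apply: (cvg_sum_abs (S := zrange) (H := E)) => //.
  - exact: zrange_uniq.
  - exact: zrange_sub.
  - by move=> n; under eq_bigr do rewrite ger0_norm//; exact: fE (zrange_uniq n).
suff -> : E = limn (fun n => \sum_(k <- zrange n) f k) by [].
apply/le_anti/andP; split.
  rewrite -lee_fin /E fineK; last first.
    by rewrite ge0_fin_numE// esum_ge0// => k _; rewrite lee_fin.
  apply/esum_le_bsum/bsum_zrange => // n.
  by apply: (le_sum_lim (S := zrange)) => //; [exact: zrange_uniq|exact: zrange_sub].
by apply: limr_le => //; apply: nearW => n; exact: fE (zrange_uniq n).
Qed.

Lemma bsum_tail E n : bsum f E ->
  bsum (fun k => if k \in zrange n then 0 else f k) (E - \sum_(k <- zrange n) f k).
Proof.
move=> fE F uF; rewrite lerBrDr.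
have -> : \sum_(k <- F) (if k \in zrange n then 0 else f k) =
    \sum_(k <- [seq k <- F | k \notin zrange n]) f k.
  by rewrite big_filter [RHS]big_mkcond; apply: eq_bigr => k _; case: ifP.
rewrite -big_cat; apply: fE; rewrite cat_uniq filter_uniq// zrange_uniq andbT /=.
by apply/hasPn => k kz; rewrite mem_filter kz.
Qed.

End SumsOverIntegers.

Section SobolevCoefficients.
Context {R : realType} (s : R).
Notation C := R[i].
Notation Re := complex.Re.
Notation Im := complex.Im.
Notation mu := (@lebesgue_measure R).
Notation H := (sobolev R s).
Implicit Types u v : H.

Lemma rep_sobolev_fun (f : sobolev_rep s) : sobolev_fun s f.
Proof. by have /asboolP := rep_funP f. Qed.

Lemma rep_sq_integrable (f : sobolev_rep s) : sq_integrable f.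
Proof. by have [] := rep_sobolev_fun f. Qed.

Lemma fourier_ae (f g : R -> C) k :
  measurable_fun setT (fun x => Re (f x)) -> measurable_fun setT (fun x => Im (f x)) ->
  measurable_fun setT (fun x => Re (g x)) -> measurable_fun setT (fun x => Im (g x)) ->
  {ae mu, forall x, f x = g x} -> fourier f k = fourier g k.
Proof.
move=> fr fi gr gi fg; congr (_ * _).
have [ck sk] := @continuous_cexpi R (- k).
have [r1 i1] := measurable_cmul fr fi (continuous_measurable_fun ck)
  (continuous_measurable_fun sk).
have [r2 i2] := measurable_cmul gr gi (continuous_measurable_fun ck)
  (continuous_measurable_fun sk).
apply: cintegral_ae => //.
by apply: (@filterS _ _ (ae_filter_ringOfSetsType mu) _ _ _ fg) => x + cx => ->.
Qed.

Lemma pi_eqP (f g : sobolev_rep s) :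
  \pi_H f = \pi_H g <-> {ae mu, forall x, f x = g x}.
Proof.
have E : (\pi_H f = \pi_H g) <-> (f - g \in @Defs.null_fun R s).
  rewrite [_ \in _](Quotient.idealrBE (@Defs.null_fun R s)); split => [/eqP|/eqP] //.
rewrite E; split=> [/asboolP fg|fg].
  apply: (@filterS _ _ (ae_filter_ringOfSetsType mu) _ _ _ fg) => x /= /eqP.
  by rewrite subr_eq0 => /eqP.
apply/asboolP; apply: (@filterS _ _ (ae_filter_ringOfSetsType mu) _ _ _ fg) => x /= fgx.
by rewrite !fctE fgx subrr.
Qed.

Lemma repr_pi_ae (f : sobolev_rep s) : {ae mu, forall x, repr (\pi_H f) x = f x}.
Proof. by apply/pi_eqP; rewrite reprK. Qed.

Definition scoef u (k : int) : C := fourier (repr u) k.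

Lemma scoef_pi (f : sobolev_rep s) k : scoef (\pi_H f) k = fourier f k.
Proof.
have [? ? _] := rep_sq_integrable f.
have [? ? _] := rep_sq_integrable (repr (\pi_H f)).
by apply: fourier_ae => //; exact: repr_pi_ae.
Qed.

Lemma scoefZD (c : C) u v k : scoef (c *: u + v) k = c * scoef u k + scoef v k.
Proof.
have -> : c *: u + v = \pi_H (c *: repr u + repr v).
  by rewrite pi_sobolevD pi_sobolev_scale !reprK.
by rewrite scoef_pi fourier_linear//; exact: rep_sq_integrable.
Qed.

Lemma scoefD u v k : scoef (u + v) k = scoef u k + scoef v k.
Proof. by rewrite -[u in LHS]scale1r scoefZD mul1r. Qed.

Lemma scoef0 k : scoef 0 k = 0.
Proof. by apply: (addrI (scoef 0 k)); rewrite -scoefD !addr0. Qed.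

Lemma scoefZ (c : C) u k : scoef (c *: u) k = c * scoef u k.
Proof. by rewrite -[_ *: _]addr0 scoefZD scoef0 addr0. Qed.

Lemma scoefN u k : scoef (- u) k = - scoef u k.
Proof. by rewrite -scaleN1r scoefZ mulN1r. Qed.

Lemma scoefB u v k : scoef (u - v) k = scoef u k - scoef v k.
Proof. by rewrite scoefD scoefN. Qed.

Lemma scoef_sum (I : Type) (r : seq I) (c : I -> C) (g : I -> H) k :
  scoef (\sum_(i <- r) c i *: g i) k = \sum_(i <- r) c i * scoef (g i) k.
Proof.
elim: r => [|i r IH]; first by rewrite !big_nil scoef0.
by rewrite !big_cons scoefZD IH.
Qed.

Lemma scoef_inj u : (forall k, scoef u k = 0) -> u = 0.
Proof.
move=> u0; rewrite -[u]reprK -[0]reprK; apply/pi_eqP.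
have E v : (forall k, scoef v k = 0) -> {ae mu, forall x, repr v x = 0}.
  move=> v0; have [pv _ _] := rep_sobolev_fun (repr v).
  apply: periodic_ae_eq0 => //; apply: fourier_uniqueness => //.
  exact: rep_sq_integrable.
(* [repr 0] need not be the zero function: its vanishing almost everywhere also goes through
   uniqueness. *)
have z0 := E 0 scoef0.
apply: (@filterS2 _ _ (ae_filter_ringOfSetsType mu) _ _ _ _ (E u u0) z0) => x.
by move=> -> ->.
Qed.

Definition weight (k : int) : R := (1 + k%:~R ^+ 2) `^ s.

Definition energy u : R := fine (sobolev_energy s (repr u)).

Lemma weight_gt0 k : 0 < weight k.
Proof. by rewrite powR_gt0// ltr_wpDr ?sqr_ge0. Qed.

Lemma energyE u : energy u =
  fine (\esum_(k in [set: int]) (weight k * nsq (scoef u k))%:E).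
Proof.
congr fine; apply: eq_esum => k _; congr EFin; rewrite nsqE //.
Qed.

Lemma wnsq_ge0 u k : 0 <= weight k * nsq (scoef u k).
Proof. by rewrite mulr_ge0 ?nsq_ge0 ?ltW// weight_gt0. Qed.

Lemma energy_fin u : (\esum_(k in [set: int]) (weight k * nsq (scoef u k))%:E < +oo)%E.
Proof.
have [_ _] := rep_sobolev_fun (repr u); apply: le_lt_trans.
by apply: le_esum => k _; rewrite nsqE.
Qed.

Lemma energy_bsum u : bsum (fun k => weight k * nsq (scoef u k)) (energy u).
Proof.
by rewrite energyE; apply: bsum_esum => [k|]; [exact: wnsq_ge0|exact: energy_fin].
Qed.

Lemma energy_cvg u :
  (\sum_(k <- zrange n) weight k * nsq (scoef u k)) @[n --> \oo] --> energy u.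
Proof.
by rewrite energyE; apply: cvg_zrange_esum => [k|]; [exact: wnsq_ge0|exact: energy_fin].
Qed.

Lemma energy_ge0 u : 0 <= energy u.
Proof. exact: bsum_ge0 (energy_bsum u). Qed.

Lemma energy_le u B : bsum (fun k => weight k * nsq (scoef u k)) B -> energy u <= B.
Proof.
move=> uB; rewrite -lee_fin energyE fineK; first exact: esum_le_bsum.
by rewrite ge0_fin_numE ?energy_fin// esum_ge0// => k _; rewrite lee_fin wnsq_ge0.
Qed.

Lemma energy_eq0 u : energy u = 0 -> u = 0.
Proof.
move=> u0; apply: scoef_inj => k; apply: nsq_eq0.
have := energy_bsum u (isT : uniq [:: k]); rewrite big_seq1 u0 => h.
apply/le_anti; rewrite nsq_ge0 andbT.
by move: h; rewrite pmulr_rle0// weight_gt0.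
Qed.

Lemma sobolev_normE u : sobolev_norm u = Num.sqrt (energy u).
Proof. by []. Qed.

End SobolevCoefficients.

Section TrigonometricTestFunctions.
Context {R : realType}.
Notation C := R[i].
Notation period := (@period R).

(** Real functions, because [weak_derivative2] tests against real functions; the family is closed
    under differentiation, which gives smoothness of every order by one induction. *)
Definition trig1 (c al be x : R) : R := al * cos (c * x) + be * sin (c * x).

Lemma trig1_derive c al be :
  has_derive (trig1 c al be) (trig1 c (c * be) (- (c * al))).
Proof.
apply/has_deriveP => x.
apply: is_derive_eq (is_deriveD (is_deriveZ al (is_derive_cosM c x))
  (is_deriveZ be (is_derive_sinM c x))) _.
by rewrite /trig1 /GRing.scale /=; ring.
Qed.

Lemma trig1_derive1n c al be n : exists al' be',
  (trig1 c al be)^`(n)%classic = trig1 c al' be'.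
Proof.
elim: n => [|n [al' [be' IH]]]; first by exists al, be.
exists (c * be'), (- (c * al')); apply/funext => x.
by rewrite derive1nS IH; have [_ ->] := trig1_derive c al' be' x.
Qed.

Lemma trig1_smooth (k : int) al be : smooth_on_circle (trig1 k%:~R al be).
Proof.
split=> [x|n x].
  have := cexpi_period k x; rewrite !cexpiE => -[ck sk].
  by rewrite /trig1 ck sk.
have [al' [be' ->]] := trig1_derive1n k%:~R al be n.
by have [] := trig1_derive k%:~R al' be' x.
Qed.

Lemma trig1_derive2 c al be x :
  (trig1 c al be)^`(2)%classic x = - (c ^+ 2 * trig1 c al be x).
Proof.
have E al' be' : (trig1 c al' be')^`()%classic = trig1 c (c * be') (- (c * al')).
  by apply/funext => y; have [_ ->] := trig1_derive c al' be' y.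
by rewrite derive1nS derive1n1 !E /trig1; ring.
Qed.

Lemma trig1_trigpoly (k : int) al be : trigpoly (fun x => (trig1 k%:~R al be x)%:C%C).
Proof.
exists [:: (k, Complex (al / 2) (- be / 2)); (- k, Complex (al / 2) (be / 2))].
apply/funext => x; rewrite /tpoly !big_cons big_nil addr0 ![_.1]/= ![_.2]/=.
rewrite cexpiN !cexpiE; apply/eqP; rewrite eq_complex /= /trig1.
by apply/andP; split; apply/eqP; field.
Qed.

(** The exponential [cexpi (- k)] is split into [cos] and [- i sin], each an eigenfunction of the
    second derivative for [- k^2]. *)
Lemma weak_derivative2_fourier (f g : R -> C) k :
  sq_integrable f -> sq_integrable g -> weak_derivative2 f g ->
  fourier g k = - (k%:~R ^+ 2)%:C%C * fourier f k.
Proof.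
move=> sf sg fg; set r : R := k%:~R.
pose I (h : R -> C) al be := cintegral (fun x => h x * (trig1 r al be x)%:C%C).
have ci h al be : sq_integrable h -> cintegrable (fun x => h x * (trig1 r al be x)%:C%C).
  by move=> sh; apply: cintegrable_tpoly => //; exact: trig1_trigpoly.
have IE (h : R -> C) : sq_integrable h ->
    fourier h k = (period^-1)%:C%C * (- 'i%C * I h 0 1 + I h 1 0).
  move=> sh; congr (_ * _); rewrite -cintegral_linear; [|exact: ci..].
  congr cintegral; apply/funext => x; rewrite cexpiN cexpiE -/r /trig1.
  by case: (h x) => p q; apply/eqP; rewrite eq_complex /=; apply/andP; split; apply/eqP; ring.
have fgI al be : I g al be = - (r ^+ 2)%:C%C * I f al be.
  rewrite /I -fg; last exact: trig1_smooth.
  rewrite -[RHS]addr0 -[X in _ + X](@cintegral0 R) -cintegral_linear;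
    [|exact: ci|exact: cintegrable0].
  congr cintegral; apply/funext => x; rewrite trig1_derive2 addr0.
  by rewrite rmorphN rmorphM /=; ring.
by rewrite !IE// !fgI; ring.
Qed.

End TrigonometricTestFunctions.

Section Generator.
Context {R : realType} (s : R).
Notation C := R[i].
Notation mu := (@lebesgue_measure R).
Notation period := (@period R).
Notation H := (sobolev R s).
Variable a : R -> R.
Hypothesis sa : smooth_on_circle a.
Notation ah := (fourierR a).

(** The product [a u] equals [i w - v] almost everywhere, with [w] the weak second derivative, whose
    coefficients are [- k^2] times those of [u]. *)
Lemma scoef_damped_schrodinger (u v : H) k : damped_schrodinger a u v ->
  scoef v k = - ('i%C * (k%:~R ^+ 2)%:C%C * scoef u k) -
    fourier (fun x => (a x)%:C%C * repr u x) k.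
Proof.
move=> [_ [w uw vE]].
have su := rep_sq_integrable (repr u); have sw := rep_sq_integrable (repr w).
have sv := rep_sq_integrable (repr v).
have [ar ai _] := continuous_real_sq_integrable (smooth_continuous sa) sa.1.
have [ur ui _] := su; have [vr vi _] := sv.
have siv := sq_integrable_linear (-1) sv (sq_integrable_linear 'i%C sw sq_integrable0).
have [dr di _] := siv.
have [aur aui] := measurable_cmul ar ai ur ui.
have -> : fourier (fun x => (a x)%:C%C * repr u x) k =
    fourier (-1 *: (repr v : R -> C) + ('i%C *: (repr w : R -> C) + 0)) k.
  apply: fourier_ae => //.
  apply: (@filterS _ _ (ae_filter_ringOfSetsType mu) _ _ _ vE) => x.
  by rewrite !fctE addr0 => ->; rewrite scaleN1r /GRing.scale /=; ring.
rewrite fourier_linear//; last exact: sq_integrable_linear sw sq_integrable0.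
rewrite fourier_linear//; last exact: sq_integrable0.
rewrite fourier0 (weak_derivative2_fourier k su sw uw) /scoef; ring.
Qed.

Lemma sobolev_fun_intro (s' : R) (f : R -> C) (B : R) : periodic f period ->
  sq_integrable f ->
  bsum (fun k => (1 + k%:~R ^+ 2) `^ s' * nsq (fourier f k)) B -> sobolev_fun s' f.
Proof.
move=> pf sf fB; split => //; rewrite /sobolev_energy.
apply: (@le_lt_trans _ _ B%:E); last exact: ltry.
by under eq_esum do rewrite -nsqE; exact: esum_le_bsum.
Qed.

Lemma sq_integrable_cexpi1 l : sq_integrable (cexpi l : R -> C).
Proof.
have [cr ci] := @continuous_cexpi R l.
apply: (@bounded_sq_integrable _ _ 1); try exact: continuous_measurable_fun.
  by move=> x; exact: cos_max.
by move=> x; exact: sin_max.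
Qed.

Lemma sobolev_fun_cexpi s' l : sobolev_fun s' (cexpi l : R -> C).
Proof.
apply: (@sobolev_fun_intro _ _ ((1 + l%:~R ^+ 2) `^ s')).
- exact: cexpi_period.
- exact: sq_integrable_cexpi1.
move=> F uF; have [lF|lF] := boolP (l \in F).
  rewrite (bigD1_seq l)//= fourier_cexpi eqxx big1 ?addr0.
    by rewrite /nsq /= expr1n expr0n addr0 mulr1.
  by move=> k kl; rewrite fourier_cexpi (negbTE kl) nsq0 mulr0.
rewrite big_seq big1 ?powR_ge0// => k kF; rewrite fourier_cexpi.
by rewrite (_ : k == l = false) ?nsq0 ?mulr0//; apply: contraNF lF => /eqP <-.
Qed.

Lemma sq_integrable_mul_cexpi l : sq_integrable (fun x => (a x)%:C%C * cexpi l x).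
Proof.
have ca := smooth_continuous sa.
have [ar ai fin] := continuous_real_sq_integrable ca sa.1.
have [cr ci] := @continuous_cexpi R l.
have [mr mi] := measurable_cmul ar ai (continuous_measurable_fun cr) (continuous_measurable_fun ci).
split => //; apply: le_lt_trans fin; rewrite le_eqVlt; apply/orP; left; apply/eqP.
by apply: eq_integral => x _; rewrite normcM normc_cexpi mulr1.
Qed.

Lemma fourier_mul_cexpi l k : fourier (fun x => (a x)%:C%C * cexpi l x) k = ah (k - l).
Proof.
congr (_ * cintegral _); apply/funext => x.
by rewrite -mulrA -cexpiD opprB.
Qed.

(** Peetre's inequality moves a weight from [l] to [k] at the price of a power of [k - l]. *)
Lemma peetre (k l : int) :
  1 + (k%:~R : R) ^+ 2 <= 2 * (1 + l%:~R ^+ 2) * (1 + (k - l)%:~R ^+ 2).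
Proof.
rewrite intrB; move: (k%:~R) (l%:~R) => x y.
have := sqr_ge0 (x - y - y); have := sqr_ge0 (y * (x - y)); have := sqr_ge0 y.
have := sqr_ge0 (x - y); rewrite !expr2; nra.
Qed.

Lemma weight_le (k l : int) (N : nat) (s' : R) : s' <= N%:R ->
  (1 + (k%:~R : R) ^+ 2) `^ s' <=
  (2 * (1 + l%:~R ^+ 2)) ^+ N * (1 + (k - l)%:~R ^+ 2) ^+ N.
Proof.
move=> sN; have k1 : 1 <= 1 + (k%:~R : R) ^+ 2 by rewrite lerDl sqr_ge0.
apply: le_trans (ler_powR k1 sN) _; rewrite powR_mulrn ?(le_trans _ k1)// -exprMn.
by rewrite lerXn2r ?nnegrE ?(le_trans _ k1)// ?mulr_ge0 ?addr_ge0 ?sqr_ge0//; exact: peetre.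
Qed.

(** Of the two factors [normc (ah (k - l))], one is bounded and the other is summed against the
    power of [k - l] produced by [weight_le]. *)
Lemma sobolev_fun_mul_cexpi s' l : sobolev_fun s' (fun x => (a x)%:C%C * cexpi l x).
Proof.
have [Hb Hb0 hH] := ah_bsum sa (Num.truncn s').+1.
have [D D0 hD] := fourierR_decay 0 sa.
pose N := (Num.truncn s').+1.
have sN : s' <= N%:R by exact: ltW (truncnS_gt _).
pose K := (2 * (1 + (l%:~R : R) ^+ 2)) ^+ N.
have K0 : 0 <= K by rewrite exprn_ge0// mulr_ge0// addr_ge0// sqr_ge0.
apply: (@sobolev_fun_intro _ _ (K * D * Hb)).
- by move=> x; rewrite sa.1 cexpi_period.
- exact: sq_integrable_mul_cexpi.
move=> F uF.
apply: (@le_trans _ _ (\sum_(k <- F) K * D * ((1 + (k - l)%:~R ^+ 2) ^+ N * normc (ah (k - l))))).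
  apply: ler_sum => k _; rewrite fourier_mul_cexpi nsqE expr2.
  have h1 := weight_le k l sN; have h2 := hD (k - l); rewrite mul1r in h2.
  have h3 := normc_ge0 (ah (k - l)).
  have h4 : 0 <= (1 + ((k - l)%:~R : R) ^+ 2) ^+ N by rewrite exprn_ge0// addr_ge0// sqr_ge0.
  apply: (@le_trans _ _ ((K * (1 + (k - l)%:~R ^+ 2) ^+ N) * (D * normc (ah (k - l))))).
    by apply: ler_pM; rewrite ?powR_ge0 ?mulr_ge0// ler_wpM2r.
  by rewrite le_eqVlt; apply/orP; left; apply/eqP; ring.
rewrite -big_distrr /=; apply: ler_wpM2l; first exact: mulr_ge0.
rewrite -(big_map (fun k => k - l) xpredT (fun d => (1 + d%:~R ^+ 2) ^+ N * normc (ah d))).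
by apply: hH; rewrite map_inj_uniq//; exact: addIr.
Qed.

End Generator.

(** * Exponentials as elements of the domain, and density of their span *)

Section Exponentials.
Context {R : realType} (s : R).
Notation C := R[i].
Notation Re := complex.Re.
Notation Im := complex.Im.
Notation mu := (@lebesgue_measure R).
Notation period := (@period R).
Notation H := (sobolev R s).
Variable a : R -> R.
Hypothesis sa : smooth_on_circle a.

Definition mk_rep (f : R -> C) (hf : sobolev_fun s f) : sobolev_rep s :=
  SobolevRep (introT (asboolP _) hf : f \in sobolev_pred s).

Definition exp_rep l : sobolev_rep s := mk_rep (sobolev_fun_cexpi s l).

Definition aexp_rep l : sobolev_rep s := mk_rep (sobolev_fun_mul_cexpi sa s l).

Definition exp_vec l : H := \pi_H (exp_rep l).

Lemma scoef_exp_vec l k : scoef (exp_vec l) k = (k == l)%:R.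
Proof. by rewrite scoef_pi fourier_cexpi. Qed.

(** Puts every exponential into the domain, with [i d^2/dx^2] acting as [- i l^2]; finite sums of
    exponentials are the dense set on which the energy inequality is integrated. *)
Lemma exp_vec_damped_schrodinger l :
  damped_schrodinger a (exp_vec l)
    (\pi_H ((- ('i%C * (l%:~R ^+ 2)%:C%C)) *: exp_rep l - aexp_rep l)).
Proof.
set v := \pi_H _; pose w : H := \pi_H ((- (l%:~R ^+ 2)%:C%C) *: exp_rep l).
have eE := repr_pi_ae (exp_rep l); have vE := repr_pi_ae ((- ('i%C * (l%:~R ^+ 2)%:C%C)) *: exp_rep l - aexp_rep l).
have wE := repr_pi_ae ((- (l%:~R ^+ 2)%:C%C) *: exp_rep l).
split.
  have [pe se _] := rep_sobolev_fun (repr (exp_vec l)).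
  have [_ _ en] := sobolev_fun_cexpi (s + 2) l.
  split => //; apply: le_lt_trans en; apply: le_esum => k _.
  by rewrite -/(scoef (exp_vec l) k) scoef_exp_vec fourier_cexpi.
exists w.
  move=> phi sphi.
  have ci (f : R -> R) : continuous f -> measurable_fun setT (fun x => Re (f x)%:C%C) /\
      measurable_fun setT (fun x => Im (f x)%:C%C).
    by move=> cf; split; [exact: continuous_measurable_fun|exact: measurable_cst].
  have prod_ae (g : sobolev_rep s) (f : R -> R) : continuous f ->
      cintegral (fun x => repr (\pi_H g) x * (f x)%:C%C) =
      cintegral (fun x => g x * (f x)%:C%C).
    move=> cf; have [fr fi] := ci f cf.
    have [gr gi _] := rep_sq_integrable g.
    have [hr hi _] := rep_sq_integrable (repr (\pi_H g)).
    have [r1 i1] := measurable_cmul gr gi fr fi.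
    have [r2 i2] := measurable_cmul hr hi fr fi.
    apply: cintegral_ae => //.
    by apply: (@filterS _ _ (ae_filter_ringOfSetsType mu) _ _ _ (repr_pi_ae g)) => x -> _.
  have sphi2 := smooth_derive1 (smooth_derive1 sphi).
  rewrite !prod_ae; [|exact: smooth_continuous|exact: (smooth_continuous sphi2)].
  have E (f : R -> R) : cintegral (fun x => cexpi l x * (f x)%:C%C) =
      period%:C%C * fourierR f (- l).
    rewrite /fourierR /fourier mulrA -rmorphM /= divff ?gt_eqF ?period_gt0// mul1r opprK.
    by congr cintegral; apply/funext => x; rewrite mulrC.
  rewrite (E (phi^`(2)%classic)) fourierR_derive2// mulrNz sqrrN.
  rewrite (_ : (fun x => _) = (fun x => - (l%:~R ^+ 2)%:C%C * ((phi x)%:C%C * cexpi l x) + 0)).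
    rewrite cintegral_linear; [|exact: cintegrable_real (smooth_continuous sphi)|exact: cintegrable0].
    rewrite cintegral0 addr0 (_ : (fun x => _) = (fun x => cexpi l x * (phi x)%:C%C)).
      by rewrite E mulrCA.
    by apply/funext => x; rewrite mulrC.
  apply/funext => x; rewrite addr0.
  by rewrite -[LHS]/((- (l%:~R ^+ 2)%:C%C * cexpi l x) * (phi x)%:C%C); ring.
have F := ae_filter_ringOfSetsType mu.
apply: (@filterS2 _ _ F _ _ _ _ eE); last first.
  apply: (@filterS2 _ _ F _ _ _ _ vE wE) => x hv hw.
  exact: (conj hv hw).
move=> x he [hv hw]; rewrite hv hw he.
rewrite -[LHS]/(- ('i%C * (l%:~R ^+ 2)%:C%C) * cexpi l x - (a x)%:C%C * cexpi l x).
rewrite -[RHS]/('i%C * (- (l%:~R ^+ 2)%:C%C * cexpi l x) - (a x)%:C%C * cexpi l x).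
by ring.
Qed.

Definition trunc (u : H) n : H := \sum_(l <- zrange n) scoef u l *: exp_vec l.

Lemma scoef_trunc u n k : scoef (trunc u n) k = if k \in zrange n then scoef u k else 0.
Proof.
rewrite scoef_sum; case: ifPn => [kn|kn].
  rewrite (bigD1_seq k) ?zrange_uniq//= scoef_exp_vec eqxx mulr1 big1 ?addr0// => l lk.
  by rewrite scoef_exp_vec eq_sym (negbTE lk) mulr0.
rewrite big_seq big1// => l ln; rewrite scoef_exp_vec (_ : k == l = false) ?mulr0//.
by apply: contraNF kn => /eqP ->.
Qed.

Lemma energy_trunc u n : energy (u - trunc u n) <=
  energy u - \sum_(k <- zrange n) weight s k * nsq (scoef u k).
Proof.
apply: energy_le => F uF; apply: le_trans (bsum_tail n (energy_bsum u) uF).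
apply: ler_sum => k _; rewrite scoefB scoef_trunc; case: ifP => _.
  by rewrite subrr nsq0 mulr0.
by rewrite subr0.
Qed.

Lemma energy_trunc_cvg u : energy (u - trunc u n) @[n --> \oo] --> (0 : R).
Proof.
apply: (@squeeze_cvgr _ _ _ _ (cst 0)
  (fun n => energy u - \sum_(k <- zrange n) weight s k * nsq (scoef u k))).
- by apply: nearW => n; rewrite energy_ge0 energy_trunc.
- exact: cvg_cst.
- rewrite -[X in _ --> X](subrr (energy u)); apply: cvgB; first exact: cvg_cst.
  exact: energy_cvg.
Qed.

End Exponentials.

(** * The Lyapunov functional *)

Section BoundedForms.
Context {R : realType}.
Notation C := R[i].
Notation Re := complex.Re.
Notation cj := (@conjc R).
Implicit Types (x y : int -> C).

Definition l2 x (X : R) := bsum (fun k => nsq (x k)) X.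

Lemma Re_conjM_le2 (z w : C) : `|Re (cj z * w)| <= 2^-1 * (nsq z + nsq w).
Proof.
apply: le_trans (Re_conjM_le z w) _; rewrite !nsqE.
have := sqr_ge0 (normc z - normc w); lra.
Qed.

Lemma dot_cvg x y X Y : l2 x X -> l2 y Y ->
  cvgn (fun n => Re (dot (zrange n) x y)).
Proof.
move=> xX yY; rewrite /dot; under eq_fun do rewrite Re_sum.
apply: (cvg_sum_abs (S := zrange) (H := 2^-1 * (X + Y))).
- exact: zrange_uniq.
- exact: zrange_sub.
move=> n; apply: (@le_trans _ _ (\sum_(k <- zrange n) 2^-1 * (nsq (x k) + nsq (y k)))).
  by apply: ler_sum => k _; exact: Re_conjM_le2.
rewrite -big_distrr big_split /= ler_wpM2l//.
by apply: lerD; [exact: xX (zrange_uniq n)|exact: yY (zrange_uniq n)].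
Qed.

Variables (P : int -> int -> C) (h : int -> R) (Hh : R).
Hypotheses (h0 : forall k, 0 <= h k) (hP : forall k j, normc (P k j) <= h (k - j)).
Hypothesis hH : bsum h Hh.

Lemma nsq_sum_le (I : Type) (r : seq I) (f : I -> C) (g : I -> R) :
  (forall i, normc (f i) <= g i) -> nsq (\sum_(i <- r) f i) <= (\sum_(i <- r) g i) ^+ 2.
Proof.
move=> fg; rewrite nsqE; have g0 i : 0 <= g i := le_trans (normc_ge0 _) (fg i).
have le : normc (\sum_(i <- r) f i) <= \sum_(i <- r) g i.
  by apply: le_trans (normc_sum_le _ _) _; apply: ler_sum.
by rewrite lerXn2r ?nnegrE ?normc_ge0// sumr_ge0.
Qed.

Lemma sumsq_matvec_le F x : uniq F -> sumsq F (matvec F P x) <= Hh ^+ 2 * sumsq F x.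
Proof.
move=> uF.
have := toeplitz_bound h0 hH (fun k => normc (x k)) uF uF.
under [X in _ <= _ * X -> _]eq_bigr do rewrite -nsqE.
apply: le_trans; apply: ler_sum => k _; apply: nsq_sum_le => j.
by rewrite normcM ler_wpM2r ?normc_ge0.
Qed.

Lemma Re_dot_matvec_le F x : uniq F -> 0 < Hh ->
  `|Re (dot F x (matvec F P x))| <= Hh * sumsq F x.
Proof.
move=> uF Hh0; rewrite Re_sum.
apply: le_trans (ler_norm_sum _ _ _) _.
(* The weights [Hh] and [Hh^-1] balance the two halves, because the matrix has norm at most [Hh];
   this keeps the bound linear in [Hh]. *)
apply: (@le_trans _ _ (\sum_(k <- F) 2^-1 * (Hh * nsq (x k) + Hh^-1 * nsq (matvec F P x k)))).
  apply: ler_sum => k _; apply: le_trans (Re_conjM_le _ _) _; rewrite !nsqE.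
  set p := normc (x k); set q := normc _.
  have E : Hh * p ^+ 2 + Hh^-1 * q ^+ 2 - 2 * (p * q) = Hh^-1 * (Hh * p - q) ^+ 2.
    by field; rewrite gt_eqF.
  have : 0 <= Hh^-1 * (Hh * p - q) ^+ 2 by rewrite mulr_ge0 ?sqr_ge0// invr_ge0 ltW.
  rewrite -E; lra.
rewrite -big_distrr big_split /= -!big_distrr /= -/(sumsq F x) -/(sumsq F (matvec F P x)).
have iH : 0 <= Hh^-1 by rewrite invr_ge0 ltW.
have := ler_wpM2l iH (sumsq_matvec_le x uF).
rewrite mulrA expr2 mulKf ?gt_eqF//; move: (Hh^-1 * _) => t; lra.
Qed.

(** The double sum over squares converges absolutely: a term is at most
    [h (k - j) (|x_k|^2 + |y_j|^2) / 2], and each half is summed first over the index that appears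
    in [h] alone. *)
Lemma matvec_cvg x y X Y : l2 x X -> l2 y Y ->
  cvgn (fun n => Re (dot (zrange n) x (matvec (zrange n) P y))).
Proof.
move=> xX yY.
pose S n := [seq (k, j) | k <- zrange n, j <- zrange n].
have SE (f : int * int -> R) n : \sum_(r <- S n) f r =
    \sum_(k <- zrange n) \sum_(j <- zrange n) f (k, j).
  by rewrite big_allpairs_dep.
have -> : (fun n => Re (dot (zrange n) x (matvec (zrange n) P y))) =
    (fun n => \sum_(r <- S n) Re (cj (x r.1) * (P r.1 r.2 * y r.2))).
  apply/funext => n; rewrite SE Re_sum; apply: eq_bigr => k _.
  by rewrite big_distrr Re_sum.
apply: (cvg_sum_abs (H := 2^-1 * (Hh * X + Hh * Y))).
- move=> n; apply: allpairs_uniq; [exact: zrange_uniq|exact: zrange_uniq|].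
  by move=> [? ?] [? ?].
- move=> m n mn [k j] /allpairsP[[k' j'] /= [mk mj [-> ->]]].
  by apply/allpairsP; exists (k', j'); split => //; exact: zrange_sub mn _ _.
move=> n; rewrite SE.
apply: (@le_trans _ _ (\sum_(k <- zrange n) \sum_(j <- zrange n)
    2^-1 * (h (k - j) * nsq (x k) + h (k - j) * nsq (y j)))).
  apply: ler_sum => k _; apply: ler_sum => j _ /=.
  apply: le_trans (Re_conjM_le _ _) _; rewrite normcM !nsqE.
  have := hP k j; have := normc_ge0 (x k); have := normc_ge0 (y j); have := h0 (k - j).
  move: (normc (x k)) (normc (y j)) (normc (P k j)) (h _) => p q r t t0 q0 p0 rt.
  apply: (@le_trans _ _ (t * (p * q))).
    by rewrite mulrCA; apply: ler_wpM2r => //; exact: mulr_ge0.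
  rewrite -mulrDr [leRHS]mulrCA; apply: ler_wpM2l => //.
  have := sqr_ge0 (p - q); lra.
under eq_bigr do rewrite -big_distrr big_split /=.
rewrite -big_distrr big_split /=; apply: ler_wpM2l => //; apply: lerD.
  apply: (@le_trans _ _ (\sum_(k <- zrange n) Hh * nsq (x k))).
    apply: ler_sum => k _; rewrite -big_distrl /=; apply: ler_wpM2r; first exact: nsq_ge0.
    exact: bsum_subr hH _ _ (zrange_uniq n).
  rewrite -big_distrr /=; apply: ler_wpM2l; first exact: bsum_ge0 hH.
  exact: xX (zrange_uniq n).
rewrite exchange_big /=.
apply: (@le_trans _ _ (\sum_(k <- zrange n) Hh * nsq (y k))).
  apply: ler_sum => k _; rewrite -big_distrl /=; apply: ler_wpM2r; first exact: nsq_ge0.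
  exact: bsum_subl hH _ _ (zrange_uniq n).
rewrite -big_distrr /=; apply: ler_wpM2l; first exact: bsum_ge0 hH.
exact: yY (zrange_uniq n).
Qed.

End BoundedForms.

Section Resonance.
Context {R : realType}.
Notation C := R[i].
Notation Re := complex.Re.
Notation cj := (@conjc R).

(** [k^2 = j^2] leaves the diagonal, worth [A |y|^2], and the antipodal pairs, which cost at most
    [(A - delta) |y|^2]. *)
Lemma resonant_bound (h : int -> C) (A delta : R) (F : seq int) (y : int -> C) :
  h 0 = A%:C%C -> (forall m, m != 0 -> normc (h m) <= A - delta) -> uniq F ->
  delta * sumsq F y <=
  \sum_(k <- F) \sum_(j <- F | (k%:~R : R) ^+ 2 == j%:~R ^+ 2)
    Re (cj (y k) * (h (k - j) * y j)).
Proof.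
move=> h0 hA uF.
have Ad : 0 <= A - delta by apply: le_trans (hA 1 isT); exact: normc_ge0.
have sqE (k j : int) : ((k%:~R : R) ^+ 2 == j%:~R ^+ 2) = (j == k) || (j == - k).
  by rewrite eqf_sqr -mulrNz !eqr_int eq_sym [k == - j]eq_sym eqr_oppLR.
have one (k : int) (c : R) : 0 <= c -> \sum_(j <- F | j == - k) c <= c.
  move=> c0; rewrite big_const_seq iter_addr_0.
  have : (count (fun j => j == - k) F <= 1)%N.
    by rewrite (count_uniq_mem _ uF) leq_b1.
  by case: (count _ _) => [|[|n]] // _; rewrite ?mulr0n ?mulr1n.
pose X k j : R := (A - delta) * (2^-1 * (nsq (y k) + nsq (y j))).
have X0 k j : 0 <= X k j by do 2! apply: mulr_ge0 => //; exact: addr_ge0 (nsq_ge0 _) (nsq_ge0 _).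
have term (k : int) : k \in F ->
    A * nsq (y k) - \sum_(j <- F | j == - k) X k j <=
    \sum_(j <- F | (k%:~R : R) ^+ 2 == j%:~R ^+ 2) Re (cj (y k) * (h (k - j) * y j)).
  move=> kF; rewrite [leRHS]big_mkcond (bigD1_seq k)//= eqxx subrr h0.
  have -> : Re (cj (y k) * (A%:C%C * y k)) = A * nsq (y k).
    by rewrite mulrCA Re_realM Re_conjM.
  rewrite lerD2l -sumrN [leLHS]big_mkcond.
  (* At [k = 0] the antipode is the diagonal entry; it is subtracted as well, which only lowers the
     bound since [X] is nonnegative. *)
  apply: (@le_trans _ _ (\sum_(j <- F | j != k) (if j == - k then - X k j else 0))).
    rewrite [leRHS]big_mkcond; apply: ler_sum => j _.
    by do 2! case: ifP => //; rewrite oppr_le0.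
  apply: ler_sum => j jk; rewrite sqE (negbTE jk) /=; case: ifP => // _.
  have hj : normc (h (k - j)) <= A - delta by apply: hA; rewrite subr_eq0 eq_sym.
  rewrite lerNl; apply: le_trans (ler_norm _) _; rewrite normrN.
  apply: le_trans (Re_conjM_le _ _) _; rewrite normcM mulrCA.
  rewrite /X !nsqE; apply: ler_pM; rewrite ?mulr_ge0 ?normc_ge0//.
  have := sqr_ge0 (normc (y k) - normc (y j)); lra.
apply: (@le_trans _ _ (\sum_(k <- F) (A * nsq (y k) - \sum_(j <- F | j == - k) X k j))); last first.
  by rewrite big_seq [leRHS]big_seq; apply: ler_sum.
rewrite sumrB -big_distrr /=.
have E1 : \sum_(k <- F) \sum_(j <- F | j == - k) X k j <= (A - delta) * sumsq F y.
  rewrite /X; under eq_bigr do rewrite -!big_distrr big_split /=.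
  rewrite -!big_distrr big_split /=; apply: ler_wpM2l => //.
  have S1 : \sum_(k <- F) \sum_(j <- F | j == - k) nsq (y k) <= sumsq F y.
    by apply: ler_sum => k _; apply: one; exact: nsq_ge0.
  have S2 : \sum_(k <- F) \sum_(j <- F | j == - k) nsq (y j) <= sumsq F y.
    rewrite (exchange_big_dep xpredT)//=; apply: ler_sum => j _.
    rewrite (eq_bigl (fun k => k == - j)); last by move=> k; rewrite eq_sym eqr_oppLR.
    by apply: one; exact: nsq_ge0.
  lra.
by rewrite /sumsq in E1 *; lra.
Qed.

End Resonance.

(** * Weighted coefficients and their commutator with multiplication by [a] *)

Section WeightedForm.
Context {R : realType} (s : R).
Notation C := R[i].
Notation Im := complex.Im.
Notation H := (sobolev R s).
Variable a : R -> R.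
Hypotheses (sa : smooth_on_circle a) (a_ge0 : forall x, 0 <= a x).
Notation ah := (fourierR a).
Notation A := (fun k j : int => ah (k - j)).

Variables (sigma : int -> R) (c : R) (M : nat).
Hypotheses (sigma0 : forall k, 0 <= sigma k)
  (sigma_le : forall k, sigma k ^+ 2 <= weight s k) (c0 : 0 <= c)
  (sigma_comm : forall k j, `|sigma k - sigma j| <=
     c * (1 + (k - j)%:~R ^+ 2) ^+ M * (sigma j / Num.sqrt (1 + j%:~R ^+ 2))).

(** Used with [sigma] the square root of the Sobolev weight and with [sigma = 1]. The hypothesis
    [sigma_comm] makes a difference of weights smaller than the weight by one derivative, up to a
    power of [k - j] that the decay of [ah] absorbs. *)
Definition wcoef (u : H) (k : int) : C := (sigma k)%:C%C * scoef u k.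

Lemma nsq_wcoef u k : nsq (wcoef u k) = sigma k ^+ 2 * nsq (scoef u k).
Proof. by rewrite nsqM {1}/nsq /= expr0n addr0. Qed.

Lemma wcoef_l2 u : l2 (wcoef u) (energy u).
Proof.
move=> F uF; apply: le_trans (energy_bsum u uF); apply: ler_sum => k _.
by rewrite nsq_wcoef ler_wpM2r ?nsq_ge0.
Qed.

Lemma wcoefZD (z : C) u v k : wcoef (z *: u + v) k = z * wcoef u k + wcoef v k.
Proof. by rewrite /wcoef scoefZD; ring. Qed.

Definition afourier (u : H) (k : int) : C := fourier (fun x => (a x)%:C%C * repr u x) k.

(* Carries the commutator of the weight [sigma] with multiplication by [a], and
   the truncation error. *)
Definition residual (n : nat) (u : H) (k : int) : C :=
  (sigma k)%:C%C * afourier u k - matvec (zrange n) A (wcoef u) k.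

Lemma cvg_sum_seq (I : eqType) (r : seq I) (f : nat -> I -> R) (g : I -> R) :
  (forall i, i \in r -> f n i @[n --> \oo] --> g i) ->
  (\sum_(i <- r) f n i) @[n --> \oo] --> \sum_(i <- r) g i.
Proof.
elim: r => [|i r IH] fg.
  by rewrite big_nil; under eq_fun do rewrite big_nil; exact: cvg_cst.
rewrite big_cons; under eq_fun do rewrite big_cons.
apply: cvgD; first by apply: fg; rewrite mem_head.
by apply: IH => j jr; apply: fg; rewrite inE jr orbT.
Qed.

Lemma ccvg_nsq (u : nat -> C) l : ccvg u l -> nsq (u n) @[n --> \oo] --> nsq l.
Proof. by move=> [r i]; apply: cvgD; apply: cvgM. Qed.

Lemma ccvgB (u v : nat -> C) l l' : ccvg u l -> ccvg v l' ->
  ccvg (fun n => u n - v n) (l - l').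
Proof.
move=> [r i] [r' i']; have IB (z w : C) : Im (z - w) = Im z - Im w by case: z w => [? ?] [? ?].
split; first by under eq_fun do rewrite ReB; rewrite ReB; exact: cvgB.
by under eq_fun do rewrite IB; rewrite IB; exact: cvgB.
Qed.

(** The convolution cut off at shifts of size [m]. A shift that stays in the window carries the
    weight difference, one that leaves it carries the whole weight at [k]; commutator and truncation
    are thus treated in one sum. *)
Definition residual_part (n m : nat) (u : H) (k : int) : C :=
  \sum_(i <- zrange m) ah i *
    ((sigma k - if k - i \in zrange n then sigma (k - i) else 0)%:C%C * scoef u (k - i)).

Lemma residual_part_cvg n u k : k \in zrange n ->
  ccvg (fun m => residual_part n m u k) (residual n u k).
Proof.
move=> kn; have su := rep_sq_integrable (repr u).
have h1 := ccvgZ (sigma k)%:C%C (fourier_mul sa k su).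
pose g m : C := \sum_(i <- zrange m) ah i *
  ((if k - i \in zrange n then sigma (k - i) else 0)%:C%C * scoef u (k - i)).
have h2 : ccvg g (matvec (zrange n) A (wcoef u) k).
  apply: ccvg_near; near=> m.
  pose f (j : int) : C := ah (k - j) * wcoef u j.
  (* For [k] and [j] in the window the shift [k - j] has size at most [2 n]. *)
  have mn : (n + n <= m)%N by near: m; exact: nbhs_infty_ge.
  have -> : g m = \sum_(j <- [seq k - i | i <- zrange m] | j \in zrange n) f j.
    rewrite big_map /g [RHS]big_mkcond; apply: eq_bigr => i _; case: ifP => _.
      by rewrite /f /wcoef opprB addrCA subrr addr0.
    by rewrite mul0r mulr0.
  rewrite /matvec -[LHS]big_filter; apply: perm_big; apply: uniq_perm.
  - by rewrite filter_uniq// map_inj_uniq ?zrange_uniq// => i j /addrI /oppr_inj.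
  - exact: zrange_uniq.
  move=> j; rewrite mem_filter; apply: andb_idr => jn.
  apply/mapP; exists (k - j); last by rewrite opprB addrCA subrr addr0.
  by move: kn jn mn; rewrite !mem_zrange; lia.
have := ccvgB h1 h2; congr ccvg; apply/funext => m.
rewrite big_distrr /g -sumrB; apply: eq_bigr => i _ /=.
by rewrite rmorphB -/(scoef u (k - i)); move: (scoef _ _) => z /=; ring.
Unshelve. all: by end_near. Qed.

(** Outside the window [sigma k] is at most the weight difference plus [sigma (k - i)], so the
    commutator kernel acts everywhere and the plain kernel only on the tail. The convolution bound
    applies to each, uniformly in the cutoff [m]. *)
Lemma residual_bound n u H0 H1 Xp T :
  bsum (fun i => normc (ah i)) H0 ->
  bsum (fun i => c * (1 + i%:~R ^+ 2) ^+ M * normc (ah i)) H1 ->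
  bsum (fun j => sigma j ^+ 2 * nsq (scoef u j) / (1 + j%:~R ^+ 2)) Xp ->
  bsum (fun j => if j \in zrange n then 0 else sigma j ^+ 2 * nsq (scoef u j)) T ->
  sumsq (zrange n) (residual n u) <= 2 * (H1 ^+ 2 * Xp) + 2 * (H0 ^+ 2 * T).
Proof.
move=> hH0 hH1 hX hT.
set F := zrange n; have uF : uniq F by exact: zrange_uniq.
have j0 (j : int) : 0 < 1 + (j%:~R : R) ^+ 2 by rewrite ltr_wpDr ?sqr_ge0.
pose p (j : int) := sigma j / Num.sqrt (1 + j%:~R ^+ 2) * normc (scoef u j).
pose q (j : int) := if j \in F then 0 else sigma j * normc (scoef u j).
pose h1 (i : int) := c * (1 + (i%:~R : R) ^+ 2) ^+ M * normc (ah i).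
have h10 i : 0 <= h1 i by rewrite !mulr_ge0 ?normc_ge0// exprn_ge0// ltW.
have p2 : bsum (fun j => p j ^+ 2) Xp.
  move=> G uG; apply: le_trans (hX G uG); apply: ler_sum => j _.
  suff -> : p j ^+ 2 = sigma j ^+ 2 * nsq (scoef u j) / (1 + j%:~R ^+ 2) by [].
  by rewrite /p !exprMn exprVn sqr_sqrtr ?(ltW (j0 j))// nsqE mulrAC.
have q2 : bsum (fun j => q j ^+ 2) T.
  move=> G uG; apply: le_trans (hT G uG); apply: ler_sum => j _.
  by rewrite /q; case: ifP => _; rewrite ?expr0n// exprMn nsqE.
have part m : \sum_(k <- F) nsq (residual_part n m u k) <=
    2 * (H1 ^+ 2 * Xp) + 2 * (H0 ^+ 2 * T).
  have c1 := convolution_bound h10 hH1 uF (zrange_uniq m) p2.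
  have c2 := convolution_bound (fun i => normc_ge0 (ah i)) hH0 uF (zrange_uniq m) q2.
  apply: (@le_trans _ _ (\sum_(k <- F) (2 * (\sum_(i <- zrange m) h1 i * p (k - i)) ^+ 2 +
      2 * (\sum_(i <- zrange m) normc (ah i) * q (k - i)) ^+ 2))); last first.
    by rewrite big_split /= -!big_distrr /=; apply: lerD; rewrite ler_wpM2l.
  apply: ler_sum => k _.
  apply: (@le_trans _ _ ((\sum_(i <- zrange m) (h1 i * p (k - i) + normc (ah i) * q (k - i))) ^+ 2)).
    apply: (nsq_sum_le (zrange m)) => i.
    rewrite -[leRHS]/(h1 i * p (k - i) + normc (ah i) * q (k - i)).
    rewrite (normcM (ah i) (_ * _)) (normcM _%:C%C (scoef u (k - i))).
    have -> : h1 i * p (k - i) + normc (ah i) * q (k - i) =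
      normc (ah i) * (c * (1 + i%:~R ^+ 2) ^+ M * p (k - i) + q (k - i)).
      by rewrite /h1; ring.
    apply: ler_wpM2l; first exact: normc_ge0.
    have nR (r : R) : normc r%:C%C = `|r| by rewrite /= expr0n addr0 sqrtr_sqr.
    rewrite nR; set x := normc _; have x0 : 0 <= x by exact: normc_ge0.
    have := sigma_comm k (k - i); rewrite opprB addrCA subrr addr0 => hc.
    have hcx := ler_wpM2r x0 hc.
    rewrite /q -/F; case: ifP => _.
      by apply: le_trans hcx _; rewrite addr0 /p -/x le_eqVlt; apply/orP; left; apply/eqP; ring.
    rewrite subr0 -/x.
    have : `|sigma k| * x <= `|sigma k - sigma (k - i)| * x + sigma (k - i) * x.
      rewrite -mulrDl ler_wpM2r// -[X in _ <= _ + X]ger0_norm//.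
      by apply: le_trans (ler_normD _ _); rewrite subrK.
    move=> /le_trans; apply; rewrite lerD2r; apply: le_trans hcx _.
    by rewrite /p -/x le_eqVlt; apply/orP; left; apply/eqP; ring.
  rewrite big_split /=; move: (\sum_(i <- _) _) (\sum_(i <- _) _) => S1 S2.
  have := sqr_ge0 (S1 - S2); lra.
have cv : (\sum_(k <- F) nsq (residual_part n m u k)) @[m --> \oo] -->
    sumsq F (residual n u).
  by apply: cvg_sum_seq => k kF; apply: ccvg_nsq; exact: residual_part_cvg.
by apply: (cvgr_to_le cv); apply: nearW => m; exact: part.
Qed.

End WeightedForm.

(** * The Lyapunov form as a limit of forms on finite windows *)

Section LyapunovForm.
Context {R : realType} (s : R).
Notation C := R[i].
Notation Re := complex.Re.
Notation cj := (@conjc R).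
Notation H := (sobolev R s).
Variable a : R -> R.
Hypotheses (sa : smooth_on_circle a) (a_ge0 : forall x, 0 <= a x).
Notation ah := (fourierR a).
Notation A := (fun k j : int => ah (k - j)).
Notation kap := (fun k : int => (k%:~R : R) ^+ 2).
Notation B := (comB A kap).

Variables (eps delta H0 : R).
Hypotheses (H0_gt0 : 0 < H0) (hH0 : bsum (fun i => normc (ah i)) H0).
Hypotheses (delta_gt0 : 0 < delta)
  (gap : forall m, m != 0 -> normc (ah m) <= amean a - delta).
Hypotheses (eps_gt0 : 0 < eps) (eps_le1 : eps <= 1) (epsH : eps * H0 <= 2^-1)
  (eps_delta : eps * ((2 * H0 + 1) * H0 ^+ 2) <= delta / 4).

Variables (sigma : int -> R) (c : R) (M : nat).
Hypotheses (sigma0 : forall k, 0 <= sigma k)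
  (sigma_le : forall k, sigma k ^+ 2 <= weight s k) (c0 : 0 <= c)
  (sigma_comm : forall k j, `|sigma k - sigma j| <=
     c * (1 + (k - j)%:~R ^+ 2) ^+ M * (sigma j / Num.sqrt (1 + j%:~R ^+ 2))).
Notation y := (wcoef sigma).

(** Distinct squares of integers differ by at least 1, so the divisor has modulus at least 1. *)
Lemma comB_le k j : normc (B k j) <= normc (ah (k - j)).
Proof.
rewrite /comB; case: eqP => [_|kj]; first by rewrite [normc _]normc0 normc_ge0.
rewrite (normcM (ah (k - j)) _) ler_piMr ?normc_ge0//.
rewrite normcV (normcM 'i%C _).
have -> : normc 'i%C = 1 :> R by rewrite /= expr0n expr1n add0r sqrtr1.
have -> (r : R) : normc r%:C%C = `|r| by rewrite /= expr0n addr0 sqrtr_sqr.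
rewrite mul1r invf_le1.
  rewrite -!rmorphXn /= -intrB -intr_norm ler1z -gtz0_ge1 normr_gt0 subr_eq0.
  by apply/eqP => E; apply: kj; rewrite -!rmorphXn /= E.
by rewrite normr_gt0 subr_eq0; apply/eqP.
Qed.

Lemma A_herm k j : ah (j - k) = cj (ah (k - j)).
Proof. exact: fourier_herm. Qed.

Let hermA k j : A j k = cj (A k j) := A_herm k j.

(** The Hermitian form of [1 + eps B]. Keeping its real part gives the real symmetric form that the
    energy derivative and Cauchy-Schwarz call for; [wformZZ] supplies homogeneity under complex
    scalars. *)
Definition wform_n n (u v : H) : R :=
  Re (dot (zrange n) (y u) (y v)) +
  eps * Re (dot (zrange n) (y u) (matvec (zrange n) B (y v))).

Definition wform (u v : H) : R := limn (fun n => wform_n n u v).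

Lemma wform_cvg u v : wform_n n u v @[n --> \oo] --> wform u v.
Proof.
have lu := wcoef_l2 sigma_le u; have lv := wcoef_l2 sigma_le v.
have c1 := dot_cvg lu lv.
have c2 := matvec_cvg (fun k => normc_ge0 (ah k)) comB_le hH0 lu lv.
have c3 : cvgn (fun n => eps * Re (dot (zrange n) (y u) (matvec (zrange n) B (y v)))).
  by apply: is_cvgM => //; exact: is_cvg_cst.
exact: (is_cvgD c1 c3).
Qed.

Lemma wform_nC n u v : wform_n n u v = wform_n n v u.
Proof.
rewrite /wform_n Re_dotC; congr (_ + _ * _).
by rewrite (herm_dot _ (hermB _ hermA)) ReC.
Qed.

Lemma wform_nZD n (r : R) u v w :
  wform_n n w (r%:C%C *: u + v) = r * wform_n n w u + wform_n n w v.
Proof.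
have E k : y (r%:C%C *: u + v) k = r%:C%C * y u k + y v k by exact: wcoefZD.
rewrite /wform_n (eq_dot (fun _ _ => erefl) (v' := fun k => r%:C%C * y u k + y v k)) => [|k _]; last exact: E.
rewrite (eq_dot (fun _ _ => erefl) (v := matvec _ _ (y (_ + _)))
  (v' := fun k => r%:C%C * matvec (zrange n) B (y u) k + matvec (zrange n) B (y v) k)); last first.
  move=> k _; rewrite -matvecZ -matvecD; apply: eq_bigr => j _.
  by rewrite E.
by rewrite !dotDr !dotZr !ReD !Re_realM; ring.
Qed.

Lemma wform_nZZ n (z : C) u : wform_n n (z *: u) (z *: u) = nsq z * wform_n n u u.
Proof.
have E k : y (z *: u) k = z * y u k by rewrite /wcoef scoefZ; ring.
have zz (w : C) : Re (cj z * (z * w)) = nsq z * Re w.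
  by case: z {E} w => [? ?] [? ?]; rewrite /nsq /=; ring.
rewrite /wform_n (eq_dot (v := y (z *: u)) (u' := fun k => z * y u k) (v' := fun k => z * y u k)
  (fun k _ => E k) (fun k _ => E k)).
rewrite (eq_dot (u := y (z *: u)) (v := matvec _ _ _) (u' := fun k => z * y u k)
  (v' := fun k => z * matvec (zrange n) B (y u) k) (fun k _ => E k)); last first.
  by move=> k _; rewrite -matvecZ; apply: eq_bigr => j _; rewrite E.
by rewrite !dotZl !dotZr !zz; ring.
Qed.

Lemma cvg_unique_real (f : nat -> R) (l l' : R) :
  (f n @[n --> \oo] --> l) -> (f n @[n --> \oo] --> l') -> l = l'.
Proof. by move=> h h'; exact: (cvg_unique _ h h'). Qed.

Lemma wformC u v : wform u v = wform v u.
Proof.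
apply: (cvg_unique_real (@wform_cvg u v)).
by under eq_fun do rewrite wform_nC; exact: wform_cvg.
Qed.

Lemma wformZD (r : R) u v w : wform w (r%:C%C *: u + v) = r * wform w u + wform w v.
Proof.
apply: (cvg_unique_real (@wform_cvg _ _) _).
under eq_fun do rewrite wform_nZD; apply: cvgD (@wform_cvg _ _).
by apply: cvgM (@wform_cvg _ _); exact: cvg_cst.
Qed.

Lemma wformZZ (z : C) u : wform (z *: u) (z *: u) = nsq z * wform u u.
Proof.
apply: (cvg_unique_real (@wform_cvg _ _) _).
under eq_fun do rewrite wform_nZZ.
by apply: cvgM (@wform_cvg _ _); exact: cvg_cst.
Qed.

Definition wenergy (u : H) : R := limn (fun n => sumsq (zrange n) (y u)).

Lemma wenergy_cvg u : sumsq (zrange n) (y u) @[n --> \oo] --> wenergy u.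
Proof.
have lu := wcoef_l2 sigma_le u.
have := dot_cvg lu lu; rewrite /wenergy.
by under eq_fun do rewrite Re_dot_self.
Qed.

Lemma wenergy_bsum u : bsum (fun k => nsq (y u k)) (wenergy u).
Proof.
apply: bsum_zrange => [k|n]; first exact: nsq_ge0.
apply: (le_sum_lim (S := zrange)); [exact: zrange_uniq|exact: zrange_sub| |].
  by move=> k; exact: nsq_ge0.
by apply/cvg_ex; exists (wenergy u); exact: wenergy_cvg.
Qed.

(** The form of [B] is bounded by [H0], and [eps * H0 <= 1/2]: this perturbation bound makes the
    form equivalent to the weighted energy. *)
Lemma wform_n_bound n u :
  `|wform_n n u u - sumsq (zrange n) (y u)| <= 2^-1 * sumsq (zrange n) (y u).
Proof.
rewrite /wform_n Re_dot_self addrAC subrr add0r normrM gtr0_norm//.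
have := Re_dot_matvec_le (fun k => normc_ge0 (ah k)) comB_le hH0 (y u) (zrange_uniq n) H0_gt0.
move/(ler_wpM2l (ltW eps_gt0)) => /le_trans; apply.
by rewrite mulrA ler_wpM2r ?sumsq_ge0.
Qed.

Lemma wform_ge u : 2^-1 * wenergy u <= wform u u.
Proof.
have c1 : (2^-1 * sumsq (zrange n) (y u)) @[n --> \oo] --> 2^-1 * wenergy u.
  by apply: cvgM (@wenergy_cvg u); exact: cvg_cst.
apply: (ler_cvg_to c1 (@wform_cvg u u)); apply: nearW => n.
by have := wform_n_bound n u; rewrite ler_norml => /andP[? ?]; lra.
Qed.

Lemma wform_le u : wform u u <= 2 * wenergy u.
Proof.
have c1 : (2 * sumsq (zrange n) (y u)) @[n --> \oo] --> 2 * wenergy u.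
  by apply: cvgM (@wenergy_cvg u); exact: cvg_cst.
apply: (ler_cvg_to (@wform_cvg u u) c1); apply: nearW => n.
have := wform_n_bound n u; rewrite ler_norml => /andP[? ?].
by have := sumsq_ge0 (zrange n) (y u); lra.
Qed.

(** On a finite window the skewness of [iK] and the commutator identity are plain sums; couplings
    out of the window sit in [residual]. The bounds [alpha = H0] and [beta = H0 ^+ 2] do not depend
    on [n]. *)
Lemma wform_n_dissipation n u v : damped_schrodinger a u v ->
  2 * wform_n n u v <= - (eps * delta / 2) * sumsq (zrange n) (y u) +
    (1 + 4 / (eps * delta)) * sumsq (zrange n) (residual a sigma n u).
Proof.
move=> uv; set F := zrange n; have uF : uniq F := zrange_uniq n.
have nn k : 0 <= normc (ah k) := normc_ge0 _.
have E : wform_n n u v = Re (dot F (fun k => y u k + eps%:C%C * matvec F B (y u) k) (y v)).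
  rewrite dotDl dotZl conjc_real ReD Re_realM; congr (_ + _ * _).
  by rewrite -/F (herm_dot _ (hermB _ hermA)) dotC.
rewrite E.
apply: (lyapunov_dissipation (A := A) (kap := kap) hermA (alpha := H0) (beta := H0 ^+ 2)) => //.
- by move=> x; exact: toeplitz_quad_ge0.
- move=> x; apply: le_trans (ler_norm _) _.
  exact: (Re_dot_matvec_le nn (P := A) (fun _ _ => lexx _) hH0 x uF H0_gt0).
- by move=> x; exact: (sumsq_matvec_le nn comB_le hH0 x uF).
- exact: resonant_bound (ah0E sa) gap uF.
- exact: ltW.
move=> k kF; rewrite /wcoef (scoef_damped_schrodinger sa k uv) /residual -/F.
by rewrite /afourier; ring.
Qed.

(** The truncation part of the residual is the tail of a convergent energy and disappears in the
    limit; the commutator part, measured with one derivative less, stays. *)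
Lemma wform_dissipation H1 u v Xp : damped_schrodinger a u v ->
  bsum (fun i => c * (1 + i%:~R ^+ 2) ^+ M * normc (ah i)) H1 ->
  bsum (fun j => sigma j ^+ 2 * nsq (scoef u j) / (1 + j%:~R ^+ 2)) Xp ->
  2 * wform u v <= - (eps * delta / 2) * wenergy u +
    (1 + 4 / (eps * delta)) * (2 * (H1 ^+ 2 * Xp)).
Proof.
move=> uv hH1 hX; set K := 1 + _.
have K0 : 0 <= K by rewrite addr_ge0// divr_ge0// mulr_ge0// ltW.
pose T n := wenergy u - sumsq (zrange n) (y u).
have T_cvg : T n @[n --> \oo] --> (0 : R).
  rewrite -[X in _ --> X](subrr (wenergy u)).
  by apply: cvgB (@wenergy_cvg u); exact: cvg_cst.
have c1 : 2 * wform_n n u v @[n --> \oo] --> 2 * wform u v.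
  by apply: cvgM (@wform_cvg u v); exact: cvg_cst.
have c2 : (- (eps * delta / 2) * sumsq (zrange n) (y u) +
     K * (2 * (H1 ^+ 2 * Xp) + 2 * (H0 ^+ 2 * T n))) @[n --> \oo] -->
    - (eps * delta / 2) * wenergy u + K * (2 * (H1 ^+ 2 * Xp) + 2 * (H0 ^+ 2 * 0)).
  apply: cvgD; first by apply: cvgM (@wenergy_cvg u); exact: cvg_cst.
  apply: cvgM; first exact: cvg_cst.
  apply: cvgD; first exact: cvg_cst.
  apply: cvgM; first exact: cvg_cst.
  by apply: cvgM T_cvg; exact: cvg_cst.
rewrite !mulr0 addr0 in c2; apply: (ler_cvg_to c1 c2); apply: nearW => n.
apply: le_trans (wform_n_dissipation n uv) _; rewrite lerD2l ler_wpM2l//.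
apply: (residual_bound sa sigma0 c0 sigma_comm hH0 hH1 hX) => F uF.
have := bsum_tail n (wenergy_bsum u) uF; apply: le_trans.
by apply: ler_sum => k _; rewrite nsq_wcoef.
Qed.

End LyapunovForm.

(** * Contractive groups *)

Section InnerProduct.
Context {R : realType} {V : lmodType R[i]}.
Notation C := R[i].
Variable G : V -> V -> R.
Hypotheses (GC : forall u v, G u v = G v u)
  (GZD : forall (r : R) u v w, G w (r%:C%C *: u + v) = r * G w u + G w v)
  (GZZ : forall (z : C) u, G (z *: u) (z *: u) = nsq z * G u u)
  (G_ge0 : forall u, 0 <= G u u).

Definition fnorm (u : V) : R := Num.sqrt (G u u).

Lemma fnorm_ge0 u : 0 <= fnorm u. Proof. exact: sqrtr_ge0. Qed.

Lemma fnorm_sqr u : fnorm u ^+ 2 = G u u. Proof. by rewrite sqr_sqrtr. Qed.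

Lemma inner_expand u v (r : R) :
  G (r%:C%C *: v + u) (r%:C%C *: v + u) = G u u + 2 * r * G u v + r ^+ 2 * G v v.
Proof. by rewrite GZD (GC (_ + _) v) (GC (_ + _) u) !GZD (GC v u); ring. Qed.

Lemma fnormZ (z : C) u : fnorm (z *: u) = normc z * fnorm u.
Proof.
rewrite /fnorm GZZ sqrtrM ?nsq_ge0// nsqE sqrtr_sqr ger0_norm//.
exact: normc_ge0.
Qed.

Lemma cauchy_schwarz u v : `|G u v| <= fnorm u * fnorm v.
Proof.
have sq : G u v ^+ 2 <= G u u * G v v.
  have [v0|v0] := eqVneq (G v v) 0.
    have [->|uv] := eqVneq (G u v) 0; first by rewrite expr0n v0 mulr0.
    (* For a degenerate [v] the expansion is affine in the scalar, and this scalar gives it the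
       negative value [- G u u - 2]. *)
    have := G_ge0 (((- (G u u + 1) / G u v)%:C)%C *: v + u).
    rewrite inner_expand v0 mulr0 addr0 -mulrA mulrA -[2 * _ * _]mulrA divfK//.
    by have := G_ge0 u; lra.
  have v1 : 0 < G v v by rewrite lt_def v0 G_ge0.
  have := G_ge0 (((- G u v / G v v)%:C)%C *: v + u); rewrite inner_expand.
  have -> : G u u + 2 * (- G u v / G v v) * G u v + (- G u v / G v v) ^+ 2 * G v v =
      (G u u * G v v - G u v ^+ 2) / G v v by field; rewrite gt_eqF.
  by rewrite pmulr_lge0 ?invr_gt0// subr_ge0.
rewrite -sqrtrM// -sqrtr_sqr; exact: ler_wsqrtr.
Qed.

Lemma fnormD u v : fnorm (u + v) <= fnorm u + fnorm v.
Proof.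
rewrite -(ler_sqr (fnorm_ge0 _) (addr_ge0 (fnorm_ge0 _) (fnorm_ge0 _))).
have := inner_expand v u 1; rewrite scale1r => E.
rewrite fnorm_sqr E sqrrD !fnorm_sqr.
by have := cauchy_schwarz v u; rewrite ler_norml => /andP[_]; lra.
Qed.

Lemma fnorm0 : fnorm 0 = 0.
Proof. by rewrite -[0 in LHS](scale0r (0 : V)) fnormZ [normc _]normc0 mul0r. Qed.

Lemma fnormN u : fnorm (- u) = fnorm u.
Proof. by rewrite -scaleN1r fnormZ normcN [normc _]normc1 mul1r. Qed.

End InnerProduct.

(** * Energy decay along orbits of the group *)

Section ContractiveGroup.
Context {R : realType} {V : lmodType R[i]}.
Notation C := R[i].
Variable G : V -> V -> R.
Hypotheses (GC : forall u v, G u v = G v u)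
  (GZD : forall (r : R) u v w, G w (r%:C%C *: u + v) = r * G w u + G w v)
  (GZZ : forall (z : C) u, G (z *: u) (z *: u) = nsq z * G u u)
  (G_ge0 : forall u, 0 <= G u u).
Notation N := (fnorm G).

Variables (N0 : V -> R) (m M : R).
Hypotheses (N0_ge0 : forall u, 0 <= N0 u) (m0 : 0 < m) (M0 : 0 < M)
  (N0_le : forall u, m * N0 u <= N u) (N_le : forall u, N u <= M * N0 u).

Variable S : R -> {linear V -> V}.
Hypothesis grpS : C0_group N0 S.

Lemma group_bounded t : exists2 K, 0 <= K & forall u, N (S t u) <= K * N u.
Proof.
have N00 : N0 0 = 0.
  apply/le_anti; rewrite N0_ge0 andbT -(ler_pM2l m0) mulr0.
  by apply: le_trans (N0_le _) _; rewrite fnorm0.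
have [K hK] : exists K : R, forall u, N0 u <= 1 -> N0 (S t u) <= K.
  have := C0_group_bounded grpS t; set O := opnorm _ _ => Ofin.
  have ub u : N0 u <= 1 -> ((N0 (S t u))%:E <= O)%E.
    by move=> u1; apply: ereal_sup_ubound; exists u.
  exists (fine O) => u u1; rewrite -lee_fin fineK ?ub//.
  rewrite fin_numElt Ofin andbT; apply: lt_le_trans (ub 0 _); rewrite ?ltNyr// N00.
  exact: ler01.
exists (M * K / m).
  apply: divr_ge0 (ltW m0); apply: mulr_ge0; first exact: ltW.
  by apply: le_trans (N0_ge0 _) (hK 0 _); rewrite N00.
move=> u; have [u0|u0] := eqVneq (N u) 0.
  have Nu0 : N0 u = 0.
    apply/le_anti; rewrite N0_ge0 andbT -(ler_pM2l m0) mulr0.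
    by apply: le_trans (N0_le _) _; rewrite u0.
  have NS r : 0 < r -> r * N (S t u) <= M * K.
    move=> r0; have -> : r * N (S t u) = N (S t (r%:C%C *: u)).
      by rewrite linearZ /= fnormZ//= expr0n addr0 sqrtr_sqr gtr0_norm.
    apply: le_trans (N_le _) _; rewrite ler_wpM2l ?(ltW M0)//; apply: hK.
    rewrite -(ler_pM2l m0); apply: le_trans (N0_le _) _.
    by rewrite fnormZ// u0 mulr0 mulr_ge0// ltW.
  rewrite u0 mulr0 leNgt; apply/negP => p.
  have := NS ((M * K + 1) / N (S t u)); rewrite divfK ?gt_eqF// => h.
  have MK : 0 <= M * K.
    apply: mulr_ge0; first exact: ltW.
    by apply: le_trans (N0_ge0 _) (hK 0 _); rewrite N00.
  have /h : 0 < (M * K + 1) / N (S t u) by rewrite divr_gt0//; lra.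
  lra.
have u1 : 0 < N u by rewrite lt_def u0 fnorm_ge0.
pose r := m / N u; have r0 : 0 < r by rewrite divr_gt0.
have NrE w : N (r%:C%C *: w) = r * N w.
  by rewrite fnormZ//= expr0n addr0 sqrtr_sqr gtr0_norm.
have : N (S t (r%:C%C *: u)) <= M * K.
  apply: le_trans (N_le _) _; rewrite ler_wpM2l ?(ltW M0)//; apply: hK.
  rewrite -(ler_pM2l m0); apply: le_trans (N0_le _) _.
  by rewrite NrE /r divfK ?gt_eqF// mulr1.
rewrite linearZ /= NrE /r mulrAC ler_pdivrMr// => h.
by rewrite mulrAC ler_pdivlMr// mulrC.
Qed.

Lemma generatorE u v : generator N0 S u v <->
  (fun h : R => N ((h^-1)%:C%C *: (S h u - u) - v)) @ 0^' --> (0 : R).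
Proof.
split=> [g|g].
  apply: (@squeeze_cvgr _ _ _ _ (cst 0)
    (fun h => M * N0 ((h^-1)%:C%C *: (S h u - u) - v))).
  - by apply: nearW => h; rewrite fnorm_ge0 N_le.
  - exact: cvg_cst.
  - by rewrite -[X in _ --> X](mulr0 M); apply: cvgM g; exact: cvg_cst.
apply: (@squeeze_cvgr _ _ _ _ (cst 0)
  (fun h => m^-1 * N ((h^-1)%:C%C *: (S h u - u) - v))).
- by apply: nearW => h; rewrite N0_ge0 ler_pdivlMl ?N0_le.
- exact: cvg_cst.
- by rewrite -[X in _ --> X](mulr0 m^-1); apply: cvgM g; exact: cvg_cst.
Qed.

Lemma generatorZD (c : C) u v u' v' : generator N0 S u v -> generator N0 S u' v' ->
  generator N0 S (c *: u + u') (c *: v + v').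
Proof.
move=> /generatorE g /generatorE g'; apply/generatorE.
pose r w z (h : R) := (h^-1)%:C%C *: (S h w - w) - z.
apply: (@squeeze_cvgr _ _ _ _ (cst 0) (fun h => normc c * N (r u v h) + N (r u' v' h))).
- apply: nearW => h; rewrite fnorm_ge0 /= -fnormZ//.
  have -> : (h^-1)%:C%C *: (S h (c *: u + u') - (c *: u + u')) - (c *: v + v') =
      c *: r u v h + r u' v' h.
    rewrite linearP opprD addrACA -scalerBr scalerDr scalerA mulrC -scalerA.
    by rewrite opprD addrACA -scalerBr.
  exact: fnormD.
- exact: cvg_cst.
- rewrite [X in _ --> X](_ : 0 = normc c * 0 + 0); last by rewrite mulr0 addr0.
  by apply: cvgD g'; apply: cvgM g; exact: cvg_cst.
Qed.

Lemma generator_sum (I : Type) (r : seq I) (c : I -> C) (f g : I -> V) :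
  (forall i, generator N0 S (f i) (g i)) ->
  generator N0 S (\sum_(i <- r) c i *: f i) (\sum_(i <- r) c i *: g i).
Proof.
move=> fg; elim: r => [|i r IH]; last by rewrite !big_cons; exact: generatorZD.
apply/generatorE; rewrite !big_nil.
under eq_fun do rewrite linear0 !subr0 scaler0 fnorm0//.
exact: cvg_cst.
Qed.

(** [S t] commutes with [S h] and is bounded, so it carries the difference quotient of [u] to that
    of [S t u]. *)
Lemma generator_orbit t u v : generator N0 S u v -> generator N0 S (S t u) (S t v).
Proof.
move=> /generatorE g; apply/generatorE; have [K K0 hK] := group_bounded t.
apply: (@squeeze_cvgr _ _ _ _ (cst 0)
  (fun h => K * N ((h^-1)%:C%C *: (S h u - u) - v))).
- apply: nearW => h; rewrite fnorm_ge0 /=.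
  have -> : S h (S t u) = S t (S h u).
    by rewrite -!(C0_groupD grpS) addrC.
  by rewrite -linearB -linearZ -linearB hK.
- exact: cvg_cst.
- by rewrite -[X in _ --> X](mulr0 K); apply: cvgM g; exact: cvg_cst.
Qed.

(** With [S h U = U + h (W + r h)], the difference quotient of the energy misses [2 G U W] by
    [2 G U (r h) + h N (W + r h)^2], which tends to 0 by Cauchy-Schwarz. *)
Lemma is_derive_orbit_energy u v t : generator N0 S u v ->
  is_derive t (1 : R) (fun t => G (S t u) (S t u)) (2 * G (S t u) (S t v)).
Proof.
move=> /(generator_orbit t) /generatorE g.
set U := S t u in g *; set W := S t v in g *.
pose r (h : R) : V := (h^-1)%:C%C *: (S h U - U) - W.
have E (h : R) : h != 0 -> S (h + t) u = h%:C%C *: (W + r h) + U.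
  move=> h0; rewrite (C0_groupD grpS) -/U /r [W + _]addrC subrK scalerA -rmorphM /= divff//.
  by rewrite scale1r subrK.
have q (h : R) : h != 0 -> h^-1 * (G (S (h + t) u) (S (h + t) u) - G U U) - 2 * G U W =
    2 * G U (r h) + h * N (W + r h) ^+ 2.
  move=> h0; rewrite E// inner_expand// fnorm_sqr//.
  have -> : G U (W + r h) = G U W + G U (r h).
    by have := GZD 1 W (r h) U; rewrite scale1r mul1r.
  by field.
have rN h : N (r h) = N ((h^-1)%:C%C *: (S h U - U) - W) by [].
have bound (h : R) : h != 0 ->
    `|h^-1 * (G (S (h + t) u) (S (h + t) u) - G U U) - 2 * G U W| <=
    2 * (N U * N (r h)) + `|h| * (N W + N (r h)) ^+ 2.
  move=> h0; rewrite q//; apply: le_trans (ler_normD _ _) _; apply: lerD.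
    by rewrite normrM ger0_norm// ler_wpM2l// cauchy_schwarz.
  rewrite normrM [X in _ * X]ger0_norm ?sqr_ge0// ler_wpM2l//.
  by rewrite lerXn2r ?nnegrE ?addr_ge0 ?fnorm_ge0 ?fnormD.
have rc : (fun h => N (r h)) @ 0^' --> (0 : R) by exact: g.
have hc : (fun h : R => `|h|) @ 0^' --> (0 : R).
  apply/cvgr0Pnorm_le => e e0.
  by apply: filterS (dnbhs0_le e0) => h; rewrite normr_id.
have bc : (fun h => 2 * (N U * N (r h)) + `|h| * (N W + N (r h)) ^+ 2) @ 0^' --> (0 : R).
  rewrite [X in _ --> X](_ : (0 : R) = 2 * (N U * 0) + 0 * (N W + 0) ^+ 2); last by ring.
  apply: cvgD.
    by apply: cvgM; [exact: cvg_cst|apply: cvgM; [exact: cvg_cst|exact: rc]].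
  apply: cvgM; first exact: hc.
  by rewrite expr2; under eq_fun do rewrite expr2; apply: cvgM;
    (apply: cvgD; [exact: cvg_cst|exact: rc]).
have qc : (fun h : R => h^-1 * (G (S (h + t) u) (S (h + t) u) - G U U)) @ 0^' -->
    2 * G U W.
  apply/cvgrPdist_le => e e0.
  have /cvgr0Pnorm_le /(_ e e0) hb0 := bc.
  apply: filterS2 (nbhs_dnbhs_neq (0 : R)) hb0 => h h0 hb.
  rewrite distrC; apply: le_trans (bound h h0) _.
  exact: le_trans (ler_norm _) hb.
pose f (t : R) := G (S t u) (S t u).
have fE : (fun h : R => h^-1 *: ((f \o shift t) (h *: (1 : R)) - f t)) =
    (fun h : R => h^-1 * (G (S (h + t) u) (S (h + t) u) - G U U)).
  by apply/funext => h; rewrite /f /= [_ *: 1]mulr1.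
apply: DeriveDef; first by rewrite /derivable fE; apply/cvg_ex; exists (2 * G U W).
by rewrite /derive fE; apply: cvg_lim => //; exact: Rhausdorff.
Qed.

Variable omega : R.
Hypothesis dissipative : forall u v, generator N0 S u v -> 2 * G u v <= - omega * G u u.

Lemma orbit_energy_decay u v T : generator N0 S u v -> 0 <= T ->
  G (S T u) (S T u) <= expR (- omega * T) * G u u.
Proof.
move=> g; rewrite le_eqVlt => /predU1P[<-|T0].
  by rewrite mulr0 expR0 mul1r !(C0_group0 grpS).
pose f (t : R) := G (S t u) (S t u).
(* Integrating factor: dissipation makes [w] nonincreasing. *)
pose w (t : R) := expR (omega * t) * f t.
have dw (t : R) : is_derive t (1 : R) w
    (expR (omega * t) * (2 * G (S t u) (S t v)) + f t * (expR (omega * t) * omega)).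
  apply: is_derive_eq (is_deriveM (is_derive1_comp (is_derive_expR _) (is_derive_mull omega t))
    (is_derive_orbit_energy t g)) _.
  by rewrite /GRing.scale.
have cw : continuous w.
  have hw : has_derive w (w^`()%classic) by move=> x; split => //; have [] := dw x.
  exact: has_derive_continuous hw.
have : w T <= w 0.
  apply: (@ler0_derive1_le_cc _ w 0 T) => //.
  - move=> t _; rewrite derive1E; have [_ ->] := dw t.
    rewrite [f t * _]mulrCA -mulrDr mulr_ge0_le0 ?expR_ge0//.
    have := dissipative (generator_orbit t g); rewrite -/(f t); lra.
  - exact: continuous_subspaceT.
  - by rewrite in_itv /= lexx ltW.
  - by rewrite in_itv /= lexx ltW.
  - exact: ltW.
rewrite /w /f mulr0 expR0 mul1r (C0_group0 grpS) mulNr expRN => h.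
by rewrite ler_pdivlMl ?expR_gt0.
Qed.

Hypothesis domain_dense : forall u e, 0 < e ->
  exists p v, generator N0 S p v /\ N (u - p) <= e.

(** On the domain, the square root of the energy decay gives the rate [omega / 2]. For a general
    vector the crude bound [K] acts only on the error [u - p], and the total loss is
    [(K + q) * N (u - p)]. *)
Theorem group_contraction T u : 0 <= T ->
  N (S T u) <= expR (- (omega / 2) * T) * N u.
Proof.
move=> T0; have [K K0 hK] := group_bounded T; set q := expR _.
have q0 : 0 < q by exact: expR_gt0.
have dom p v : generator N0 S p v -> N (S T p) <= q * N p.
  move=> g; have nq : 0 <= q * N p by rewrite mulr_ge0 ?fnorm_ge0// ltW.
  rewrite -(ler_sqr (fnorm_ge0 _ _) nq).
  rewrite exprMn !fnorm_sqr// -expRM_natl; apply: le_trans (orbit_energy_decay g T0) _.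
  rewrite ler_wpM2r// ler_expR le_eqVlt; apply/orP; left; apply/eqP.
  by field.
apply/ler_addgt0Pr => e e0.
have Kq : 0 < K + q by rewrite ltr_wpDl.
have [p [v [g up]]] := domain_dense u (divr_gt0 e0 Kq).
have -> : S T u = S T (u - p) + S T p by rewrite -linearD subrK.
apply: le_trans (fnormD GC GZD G_ge0 _ _) _.
have h1 := hK (u - p); have h2 := dom p v g.
have h3 : N p <= N u + N (u - p).
  have {1}-> : p = u + - (u - p) by rewrite opprB addrC subrK.
  by apply: le_trans (fnormD GC GZD G_ge0 _ _) _; rewrite fnormN.
have h4 : (K + q) * N (u - p) <= e by rewrite mulrC -ler_pdivlMr.
have h5 := ler_wpM2l (ltW q0) h3.
lra.
Qed.

End ContractiveGroup.

(** * The equivalent norm *)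

Section WeightCommutator.
Context {R : realType}.
Implicit Types (g K tau : R).

Lemma expr_sub1_le g K (n : nat) : 0 <= g <= K -> 1 <= K ->
  `|g ^+ n - 1| <= n%:R * K ^+ n * `|g - 1|.
Proof.
move=> /andP[g0 gK] K1; have K0 : 0 <= K by lra.
elim: n => [|n IH]; first by rewrite expr0 subrr normr0 !mul0r.
have -> : g ^+ n.+1 - 1 = g * (g ^+ n - 1) + (g - 1) by rewrite exprS; ring.
apply: le_trans (ler_normD _ _) _; rewrite normrM (ger0_norm g0).
have h1 : g * `|g ^+ n - 1| <= K * (n%:R * K ^+ n * `|g - 1|).
  by apply: ler_pM.
have h2 : `|g - 1| <= K ^+ n.+1 * `|g - 1|.
  by rewrite ler_peMl// exprn_ege1.
apply: le_trans (lerD h1 h2) _; rewrite -natr1 exprS le_eqVlt; apply/orP; left.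
by apply/eqP; ring.
Qed.

(** Powers of [g] stay on one side of 1 and move away from it as the exponent grows, so a real
    exponent may be replaced by a larger integer. *)
Lemma powR_sub1_le g tau (n : nat) : 0 < g -> 0 <= tau <= n%:R ->
  `|g `^ tau - 1| <= `|g ^+ n - 1|.
Proof.
move=> g0 /andP[t0 tn]; rewrite -powR_mulrn ?(ltW g0)//.
have [g1|g1] := leP 1 g.
  have h1 := ler_powR g1 t0; have h2 := ler_powR g1 tn.
  by rewrite powRr0 in h1; rewrite !ger0_norm; lra.
have gg : 0 < g <= 1 by rewrite g0 ltW.
have h1 := ger_powR gg t0; have h2 := ger_powR gg tn.
by rewrite powRr0 in h1; rewrite !ler0_norm; lra.
Qed.

Variables (s : R).
Hypothesis s0 : 0 <= s.

Definition sqrt_weight (k : int) : R := Num.sqrt (weight s k).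

Lemma sqrt_weightE k : sqrt_weight k = (1 + k%:~R ^+ 2) `^ (s / 2).
Proof. by rewrite /sqrt_weight /weight -powR12_sqrt ?powR_ge0// -powRrM. Qed.

Lemma weight_ge1 k : 1 <= weight s k.
Proof.
have k1 : 1 <= 1 + (k%:~R : R) ^+ 2 by rewrite lerDl sqr_ge0.
by have := ler_powR k1 s0; rewrite powRr0.
Qed.

(** [x^2 - y^2 = d (d + 2 y)] with [d = x - y]: one root of [1 + y^2] in the denominator absorbs
    [y], the other remains. This is the gain of one derivative. *)
Lemma ratio_sub1_le (x y : R) :
  `|(1 + x ^+ 2) / (1 + y ^+ 2) - 1| <=
  2 * (1 + (x - y) ^+ 2) / Num.sqrt (1 + y ^+ 2).
Proof.
have y1 : 0 < 1 + y ^+ 2 by rewrite ltr_wpDr ?sqr_ge0.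
set t := Num.sqrt _; have t2 : t ^+ 2 = 1 + y ^+ 2 by rewrite sqr_sqrtr// ltW.
have t0 : 0 < t by rewrite sqrtr_gt0.
have t1 : 1 <= t.
  by rewrite -(@ler_pXn2r _ 2)// ?nnegrE ?(ltW t0)// expr1n t2 lerDl sqr_ge0.
have yt : `|y| <= t by rewrite -sqrtr_sqr ler_wsqrtr// lerDr.
set d := x - y.
have -> : (1 + x ^+ 2) / (1 + y ^+ 2) - 1 = (d * (d + 2 * y)) / t ^+ 2.
  by rewrite t2 /d; field; rewrite gt_eqF.
rewrite normrM normfV [`|t ^+ 2|]ger0_norm ?sqr_ge0//.
rewrite ler_pdivrMr ?exprn_gt0// expr2 mulrA divfK ?gt_eqF//.
rewrite normrM.
have h1 : `|d + 2 * y| <= `|d| + 2 * t.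
  apply: le_trans (ler_normD _ _) _; rewrite lerD2l normrM ger0_norm//.
  by rewrite ler_wpM2l.
apply: le_trans (ler_wpM2l (normr_ge0 d) h1) _.
rewrite -[d * d]/(d ^+ 2) -(real_normK (num_real d)).
move: `|d| (normr_ge0 d) => e e0.
have := sqr_ge0 (e - 1); have : 0 <= (t - 1) * e ^+ 2 by rewrite mulr_ge0 ?sqr_ge0//; lra.
rewrite !expr2 => p q.
have : 0 <= t * ((e - 1) * (e - 1)) by rewrite mulr_ge0// ltW.
lra.
Qed.

Lemma sqrt_weight_comm : exists c (M : nat), 0 <= c /\
  forall k j, `|sqrt_weight k - sqrt_weight j| <=
    c * (1 + (k - j)%:~R ^+ 2) ^+ M * (sqrt_weight j / Num.sqrt (1 + j%:~R ^+ 2)).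
Proof.
have [n sn] : exists n : nat, 0 <= s / 2 <= n%:R.
  exists (Num.truncn (s / 2)).+1; apply/andP.
  by split; [exact: divr_ge0|exact/ltW/truncnS_gt].
(* The power contributes [n (2 (1 + d^2))^n] and the ratio [2 (1 + d^2) / sqrt (1 + j^2)], hence the
   exponent [n.+1]. *)
exists (n%:R * 2 ^+ n * 2), n.+1; split; first by rewrite !mulr_ge0// exprn_ge0.
move=> k j; have kp (i : int) : 0 < 1 + (i%:~R : R) ^+ 2 by rewrite ltr_wpDr ?sqr_ge0.
set d := (k - j)%:~R; pose g : R := (1 + k%:~R ^+ 2) / (1 + j%:~R ^+ 2).
have g0 : 0 < g by rewrite divr_gt0.
have d1 : 1 <= 1 + d ^+ 2 by rewrite lerDl sqr_ge0.
have gK : 0 <= g <= 2 * (1 + d ^+ 2).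
  rewrite ltW//= ler_pdivrMr// mulrAC; exact: peetre.
have K1 : 1 <= 2 * (1 + d ^+ 2) by lra.
have sE : sqrt_weight k - sqrt_weight j = sqrt_weight j * (g `^ (s / 2) - 1).
  rewrite mulrBr mulr1 !sqrt_weightE -powRM ?(ltW (kp _)) ?(ltW g0)//.
  by have -> : (1 + j%:~R ^+ 2) * g = 1 + k%:~R ^+ 2 by rewrite /g mulrC divfK// gt_eqF.
rewrite sE normrM ger0_norm ?sqrtr_ge0//.
have h1 := powR_sub1_le g0 sn; have h2 := expr_sub1_le n gK K1.
have h3 := ratio_sub1_le k%:~R j%:~R; rewrite -/g -intrB -/d in h3.
have K0 : 0 <= n%:R * (2 * (1 + d ^+ 2)) ^+ n.
  by rewrite mulr_ge0// exprn_ge0//; lra.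
have h4 := le_trans (le_trans h1 h2) (ler_wpM2l K0 h3).
apply: le_trans (ler_wpM2l (sqrtr_ge0 _) h4) _.
rewrite exprMn [_ ^+ n.+1]exprS le_eqVlt; apply/orP; left; apply/eqP.
by rewrite /sqrt_weight; ring.
Qed.

End WeightCommutator.

Section Assembly.
Context {R : realType} (s : R).
Hypothesis s0 : 0 <= s.
Notation C := R[i].
Notation H := (sobolev R s).
Variable a : R -> R.
Hypotheses (sa : smooth_on_circle a) (a_ge0 : forall x, 0 <= a x).
Hypothesis mean_gt0 : 0 < amean a.
Notation ah := (fourierR a).

Lemma lyapunov_constants : exists eps delta H0 : R,
  [/\ 0 < H0 /\ bsum (fun i => normc (ah i)) H0,
      0 < delta /\ (forall m, m != 0 -> normc (ah m) <= amean a - delta),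
      0 < eps, eps <= 1 &
      eps * H0 <= 2^-1 /\ eps * ((2 * H0 + 1) * H0 ^+ 2) <= delta / 4].
Proof.
have [D D0 hD] := fourierR_decay 1 sa.
have [delta delta0 gap] : exists2 delta, 0 < delta &
    forall m, m != 0 -> normc (ah m) <= amean a - delta.
  apply: toeplitz_gap (ah0E sa) (fourier_herm sa) _ mean_gt0 _.
    exact: toeplitz_ge0.
  by exists D => k; have := hD k; rewrite expr1.
have [H1 H10 hH1] := ah_bsum sa 0.
(* Adding 1 makes the bound strictly positive, as the divisions by [H0] and [L] require. *)
pose H0 := H1 + 1; have H00 : 0 < H0 by rewrite ltr_wpDl.
pose L := (2 * H0 + 1) * H0 ^+ 2.
have L0 : 0 < L by rewrite mulr_gt0 ?exprn_gt0// addr_gt0// mulr_gt0.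
exists (Num.min 1 (Num.min (2^-1 / H0) (delta / 4 / L))), delta, H0; split.
- split => // F uF; apply: (@le_trans _ _ H1); last by rewrite lerDl.
  apply: le_trans (hH1 F uF); apply: ler_sum => k _; by rewrite mul1r.
- by split.
- by rewrite !lt_min ltr01 !divr_gt0.
- by rewrite ge_min lexx.
- by split; [rewrite -ler_pdivlMr// !ge_min lexx orbT|
    rewrite -ler_pdivlMr// !ge_min lexx !orbT].
Qed.

Theorem lyapunov_inner_product : exists (G : H -> H -> R) (m M omega : R),
  [/\ [/\ forall u v, G u v = G v u,
          forall (r : R) u v w, G w (r%:C%C *: u + v) = r * G w u + G w v &
          forall (z : C) u, G (z *: u) (z *: u) = nsq z * G u u],
      0 < m /\ 0 < M,
      forall u, m * energy u <= G u u /\ G u u <= M * energy u,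
      0 < omega &
      forall u v, damped_schrodinger a u v -> 2 * G u v <= - omega * G u u].
Proof.
have [eps [delta [H0 [[H00 hH0] [d0 gap] e0 e1 [eH ed]]]]] := lyapunov_constants.
have [c [Mx [c0 comm]]] := sqrt_weight_comm s0.
pose sg := sqrt_weight s; pose one := fun _ : int => 1 : R.
have sg0 k : 0 <= sg k by exact: sqrtr_ge0.
have sg2 k : sg k ^+ 2 = weight s k by rewrite sqr_sqrtr// ltW// weight_gt0.
have sg_le k : sg k ^+ 2 <= weight s k by rewrite sg2.
have one0 k : 0 <= one k by exact: ler01.
have one_le k : one k ^+ 2 <= weight s k by rewrite expr1n; exact: weight_ge1.
(* A constant weight commutes with [a], so the residual of the L^2 functional is pure truncation. *)
have one_comm k j : `|one k - one j| <=
    0 * (1 + (k - j)%:~R ^+ 2) ^+ 0 * (one j / Num.sqrt (1 + j%:~R ^+ 2)).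
  by rewrite subrr normr0 !mul0r.
have [Hc Hc0 hHc] := ah_bsum sa Mx.
pose H1 := c * Hc.
have hH1 : bsum (fun i => c * (1 + i%:~R ^+ 2) ^+ Mx * normc (ah i)) H1.
  move=> F uF; rewrite /H1; under eq_bigr do rewrite -mulrA.
  by rewrite -big_distrr /=; apply: ler_wpM2l => //; exact: hHc.
have h0 : bsum (fun i => 0 * (1 + i%:~R ^+ 2) ^+ 0 * normc (ah i)) 0.
  by move=> F uF; rewrite big1// => i _; rewrite !mul0r.
pose Gs := wform (s := s) a eps sg; pose G1 := wform (s := s) a eps one.
pose Y0 (u : H) : R := wenergy one u.
have Es (u : H) : wenergy sg u = energy u.
  apply: (cvg_unique_real (@wenergy_cvg _ _ _ sg_le u)).
  under eq_fun => n do
    [rewrite /sumsq; under eq_bigr => k _ do rewrite nsq_wcoef sg2].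
  exact: energy_cvg.
have Y0_ge0 u : 0 <= Y0 u by exact: bsum_ge0 (wenergy_bsum one_le u).
have Y0_le u : Y0 u <= energy u.
  have c1 := @wenergy_cvg _ _ _ one_le u; have c2 := @wenergy_cvg _ _ _ sg_le u.
  rewrite -Es; apply: (ler_cvg_to c1 c2); apply: nearW => n; apply: ler_sum => k _.
  by rewrite !nsq_wcoef ler_wpM2r ?nsq_ge0// sg2 expr1n weight_ge1.
have ed0 : 0 < eps * delta by rewrite mulr_gt0.
pose C2 := (1 + 4 / (eps * delta)) * (2 * H1 ^+ 2).
have C20 : 0 <= C2.
  rewrite mulr_ge0 ?mulr_ge0 ?sqr_ge0// addr_ge0// divr_ge0// ltW//.
(* Chosen so that the part [C2 * eta * energy u] of the commutator error costs at most half of the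
   dissipation [eps * delta / 2]. *)
pose eta := eps * delta / 4 / (C2 + 1).
have C21 : 0 < C2 + 1 by rewrite ltr_wpDl.
have eta0 : 0 < eta by rewrite !divr_gt0.
pose Ce := eta^-1 `^ s; have Ce0 : 0 <= Ce by exact: powR_ge0.
(* Where [1 + j^2 >= 1 / eta], the gained derivative supplies the factor [eta]; elsewhere the weight
   itself is at most [eta^(- s) = Ce]. *)
have wle (j : int) : weight s j / (1 + j%:~R ^+ 2) <= eta * weight s j + Ce.
  have j1 : 1 <= 1 + (j%:~R : R) ^+ 2 by rewrite lerDl sqr_ge0.
  have j0 : 0 < 1 + (j%:~R : R) ^+ 2 by lra.
  have w0 := weight_gt0 s j.
  have [h|h] := leP eta^-1 (1 + (j%:~R : R) ^+ 2).
    apply: (@le_trans _ _ (eta * weight s j)); last by rewrite lerDl.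
    rewrite mulrC ler_wpM2r ?(ltW w0)//.
    by rewrite -[eta]invrK lef_pV2// posrE invr_gt0.
  apply: (@le_trans _ _ Ce); last by rewrite lerDr mulr_ge0// ltW.
  apply: (@le_trans _ _ (weight s j)).
    by rewrite ler_pdivrMr// ler_peMr// ltW.
  by apply: ge0_ler_powR => //; rewrite ?nnegrE ?invr_ge0; lra.
have hX (u : H) : bsum (fun j => sg j ^+ 2 * nsq (scoef u j) / (1 + j%:~R ^+ 2))
    (eta * energy u + Ce * Y0 u).
  move=> F uF; apply: (@le_trans _ _ (\sum_(k <- F)
      (eta * (weight s k * nsq (scoef u k)) + Ce * nsq (wcoef one u k)))).
    apply: ler_sum => k _; rewrite nsq_wcoef expr1n mul1r sg2 mulrAC mulrA -mulrDl.
    by rewrite ler_wpM2r ?nsq_ge0.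
  rewrite big_split -!big_distrr /=; apply: lerD; apply: ler_wpM2l => //.
  - exact: ltW.
  - exact: energy_bsum.
  - exact: (wenergy_bsum one_le u).
have hX1 (u : H) : bsum (fun j => one j ^+ 2 * nsq (scoef u j) / (1 + j%:~R ^+ 2)) (energy u).
  move=> F uF; apply: le_trans (energy_bsum u uF); apply: ler_sum => k _.
  have k1 : 1 <= 1 + (k%:~R : R) ^+ 2 by rewrite lerDl sqr_ge0.
  rewrite expr1n mul1r mulrC ler_wpM2r ?nsq_ge0//.
  apply: le_trans (weight_ge1 s0 k); rewrite invf_le1//; lra.
(* The multiple of the L^2 functional whose dissipation exactly cancels the low-frequency error
   [C2 * Ce * Y0 u]. *)
pose K := C2 * Ce * (2 / (eps * delta)).
have K0 : 0 <= K.
  by apply: mulr_ge0; [exact: mulr_ge0|apply: divr_ge0 => //; exact: ltW].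
have E2 : C2 * eta <= eps * delta / 4.
  rewrite /eta mulrCA ler_piMr ?divr_ge0 ?(ltW ed0)//.
  by rewrite ler_pdivrMr// mul1r lerDl.
have E3 : K * (eps * delta / 2) = C2 * Ce.
  by rewrite /K; field; rewrite !gt_eqF.
have GsC u v : Gs u v = Gs v u := wformC sa eps hH0 sg_le u v.
have G1C u v : G1 u v = G1 v u := wformC sa eps hH0 one_le u v.
have GsZD (r : R) u v w : Gs w (r%:C%C *: u + v) = r * Gs w u + Gs w v :=
  wformZD eps hH0 sg_le r u v w.
have G1ZD (r : R) u v w : G1 w (r%:C%C *: u + v) = r * G1 w u + G1 w v :=
  wformZD eps hH0 one_le r u v w.
have GsZZ (z : C) u : Gs (z *: u) (z *: u) = nsq z * Gs u u := wformZZ eps hH0 sg_le z u.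
have G1ZZ (z : C) u : G1 (z *: u) (z *: u) = nsq z * G1 u u := wformZZ eps hH0 one_le z u.
have D1 u v : damped_schrodinger a u v -> 2 * Gs u v <= - (eps * delta / 2) * energy u +
    (C2 * eta * energy u + C2 * Ce * Y0 u).
  move=> uv; rewrite -[X in _ * X + _]Es.
  have := wform_dissipation sa a_ge0 H00 hH0 d0 gap e0 e1 ed sg0 sg_le c0 comm uv hH1 (hX u).
  rewrite -/(Gs u v); congr (_ <= _ + _).
  by rewrite /C2; move: (energy u) (Y0 u) => p q; ring.
have D2 u v : damped_schrodinger a u v -> 2 * G1 u v <= - (eps * delta / 2) * Y0 u.
  move=> uv.
  have := wform_dissipation sa a_ge0 H00 hH0 d0 gap e0 e1 ed one0 one_le (lexx 0) one_comm uv h0 (hX1 u).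
  by rewrite expr0n mul0r !mulr0 addr0.
have gs (u : H) : 2^-1 * energy u <= Gs u u <= 2 * energy u.
  rewrite -Es (wform_ge H00 hH0 e0 eH sg_le) (wform_le H00 hH0 e0 eH sg_le)//.
have g1 (u : H) : 2^-1 * Y0 u <= G1 u u <= 2 * Y0 u.
  by rewrite (wform_ge H00 hH0 e0 eH one_le) (wform_le H00 hH0 e0 eH one_le).
have E0 (u : H) := energy_ge0 u.
clearbody Gs G1 Y0 K C2 Ce eta.
(* The dissipation left is [eps * delta / 4] times the energy; dividing by the upper bound
   [2 + 2 * K] of the form turns it into a rate. *)
exists (fun u v => Gs u v + K * G1 u v), 2^-1, (2 + 2 * K),
  (eps * delta / 4 / (2 + 2 * K)).
have KK : 0 < 2 + 2 * K by lra.
have upper (u : H) : Gs u u + K * G1 u u <= (2 + 2 * K) * energy u.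
  have /andP[_ h1] := gs u; have /andP[_ h2] := g1 u.
  have := ler_wpM2l K0 (le_trans h2 (ler_wpM2l (ler0n _ 2) (Y0_le u))); lra.
split.
- split=> [u v|r u v w|z u].
  + by rewrite GsC G1C.
  + by rewrite GsZD G1ZD !mulrDr addrACA mulrCA.
  + by rewrite GsZZ G1ZZ mulrDr mulrCA.
- by [].
- move=> u; split; last exact: upper.
  have /andP[h1 _] := gs u; have /andP[h2 _] := g1 u.
  have : 0 <= K * G1 u u.
    by rewrite mulr_ge0// (le_trans _ h2)// mulr_ge0.
  by move: h1 => /[swap]; lra.
- by rewrite !divr_gt0.
move=> u v uv; have F1 := D1 u v uv.
have E4 := ler_wpM2r (E0 u) E2.
have E5 := ler_wpM2l K0 (D2 u v uv).
have E6 : K * (- (eps * delta / 2) * Y0 u) = - (C2 * Ce * Y0 u) by rewrite -E3; ring.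
rewrite E6 in E5.
have E7 : eps * delta / 4 / (2 + 2 * K) * (Gs u u + K * G1 u u) <= eps * delta / 4 * energy u.
  rewrite -mulrA ler_wpM2l ?divr_ge0 ?(ltW ed0)//.
  by rewrite ler_pdivrMl// upper.
rewrite mulNr; move: E4 E5 E7 F1; clear; lra.
Qed.

End Assembly.

Theorem lemma4p10 (R : realType)
  (a : R -> R) (a0 : R) (I1 : set R)
  (ha_smooth : smooth_on_circle a)
  (ha_ge0 : forall x, 0 <= a x)
  (ha0 : 0 < a0)
  (hI1_open : open_on_circle I1)
  (hI1_nonempty : I1 !=set0)
  (ha_I1 : forall x, I1 x -> a0 <= a x)
  (s : R) (hs : 0 <= s)
  (Sa : R -> {linear sobolev R s -> sobolev R s})
  (hSa_group : C0_group (@sobolev_norm R s) Sa)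
  (hSa_generator : forall u v : sobolev R s,
     generator (@sobolev_norm R s) Sa u v <-> damped_schrodinger a u v) :
  exists N : sobolev R s -> R,
    [/\ is_norm N,
        equivalent_norms N (@sobolev_norm R s) &
        forall T : R, 0 < T ->
          exists q0 : R, 0 < q0 < 1 /\ (opnorm N (Sa T) <= q0%:E)%E].
Proof.
have [x0 Ix0] := hI1_nonempty.
have mean_gt0 : 0 < amean a by apply: (@amean_gt0 _ a ha_smooth ha_ge0 x0);
  exact: lt_le_trans ha0 (ha_I1 x0 Ix0).
have [G [m [M [omega [[GC GZD GZZ] [m0 M0] GE om0 diss]]]]] :=
  lyapunov_inner_product hs ha_smooth ha_ge0 mean_gt0.
have G_ge0 u : 0 <= G u u.
  by apply: le_trans (GE u).1; rewrite mulr_ge0 ?energy_ge0// ltW.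
pose N := fnorm G.
have N0_ge0 (u : sobolev R s) : 0 <= sobolev_norm u by exact: sqrtr_ge0.
have sm0 : 0 < Num.sqrt m by rewrite sqrtr_gt0.
have sM0 : 0 < Num.sqrt M by rewrite sqrtr_gt0.
have N0_le u : Num.sqrt m * sobolev_norm u <= N u.
  by rewrite sobolev_normE -sqrtrM ?(ltW m0)// ler_wsqrtr// (GE u).1.
have N_le u : N u <= Num.sqrt M * sobolev_norm u.
  by rewrite sobolev_normE -sqrtrM ?(ltW M0)// ler_wsqrtr// (GE u).2.
have dissN u v : generator (@sobolev_norm R s) Sa u v -> 2 * G u v <= - omega * G u u.
  by move/hSa_generator; exact: diss.
have dense u e : 0 < e -> exists p v,
    generator (@sobolev_norm R s) Sa p v /\ N (u - p) <= e.
  move=> e0.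
  have [n hn] : exists n, energy (u - trunc u n) <= (e / Num.sqrt M) ^+ 2.
    have e2 : 0 < (e / Num.sqrt M) ^+ 2 by rewrite exprn_gt0// divr_gt0.
    have /cvgr0Pnorm_le /(_ _ e2) [n _ hn] := @energy_trunc_cvg _ s u.
    by exists n; apply: le_trans (ler_norm _) (hn n (leqnn n)).
  (* The image of the truncation under the generator is left open and found by linearity from the
     exponentials. *)
  exists (trunc u n); eexists; split.
    apply: (generator_sum GC GZD GZZ G_ge0 N0_ge0 sm0 N0_le N_le) => l.
    exact/hSa_generator/(exp_vec_damped_schrodinger s ha_smooth l).
  apply: le_trans (N_le _) _; rewrite mulrC -ler_pdivlMr//.
  rewrite sobolev_normE -[leRHS]ger0_norm ?divr_ge0 ?(ltW e0) ?(ltW sM0)//.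
  by rewrite -sqrtr_sqr ler_wsqrtr.
exists N; split.
- split.
  + move=> u Nu0; apply: energy_eq0; apply/le_anti; rewrite energy_ge0 andbT.
    rewrite -(ler_pM2l m0) mulr0; apply: le_trans (GE u).1 _.
    by have := sqr_sqrtr (G_ge0 u); rewrite -[Num.sqrt _]/(N u) Nu0 expr0n => <-.
  + exact: fnormD.
  + exact: fnormZ.
- by exists (Num.sqrt m), (Num.sqrt M); split.
(* The exponential decay holds with prefactor 1, so this factor is below 1 for every positive [T],
   however small. *)
move=> T T0; exists (expR (- (omega / 2) * T)); split.
  by rewrite expR_gt0 expR_lt1 mulNr oppr_lt0 mulr_gt0// divr_gt0.
apply: ge_ereal_sup => _ [u /= Nu1 <-]; rewrite lee_fin.
apply: le_trans (group_contraction GC GZD GZZ G_ge0 N0_ge0 sm0 sM0 N0_le N_le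
  hSa_group dissN dense u (ltW T0)) _.
by rewrite ler_piMr// expR_ge0.
Qed.
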